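(* There are exactly 3 Hadamard equivalence classes of $11\times 11$ matrices with entries in $\{-1,1\}$ having maximal determinant.
   Context: A $\pm1$ matrix of order $n$ is said to have maximal determinant (to be a D-optimal design of order $n$) if the absolute value of its determinant is the largest among all $n\times n$ matrices with entries in $\{-1,1\}$. Two matrices with entries in $\{-1,1\}$ are Hadamard equivalent if one can be converted into the other by a sequence of permutations of rows and columns and negations of rows and columns (transposition is not allowed as an equivalence operation). *)

(* Defs.v *)
From mathcomp Require Import all_boot all_order all_algebra all_fingroup.
From mathcomp Require Import boolp classical_sets functions cardinality.
From Stdlib Require Import Relation_Operators.

Set Implicit Arguments.
Unset Strict Implicit.
Unset Printing Implicit Defensive.

Import Order.TTheory GRing.Theory Num.Theory.
Local Open Scope ring_scope.
Local Open Scope classical_set_scope.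

Definition sign_matrix n (A : 'M[int]_n) : Prop :=
  forall i j, A i j = 1 \/ A i j = -1.

Definition D_optimal n : set 'M[int]_n :=
  [set A | sign_matrix A /\
    forall B : 'M[int]_n, sign_matrix B -> `|\det B| <= `|\det A|].
Arguments D_optimal : clear implicits.

Definition neg_row n (k : 'I_n) (A : 'M[int]_n) : 'M[int]_n :=
  \matrix_(i, j) (if i == k then - A i j else A i j).

Definition neg_col n (k : 'I_n) (A : 'M[int]_n) : 'M[int]_n :=
  \matrix_(i, j) (if j == k then - A i j else A i j).

Inductive hadamard_step n (A : 'M[int]_n) : 'M[int]_n -> Prop :=
| HadamardRowPerm (s : 'S_n) : hadamard_step A (row_perm s A)
| HadamardColPerm (s : 'S_n) : hadamard_step A (col_perm s A)
| HadamardNegRow (k : 'I_n) : hadamard_step A (neg_row k A)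
| HadamardNegCol (k : 'I_n) : hadamard_step A (neg_col k A).

(* The reflexive transitive closure is already symmetric, since the inverse of
   a step is again a step. *)
Definition hadamard_equiv n : 'M[int]_n -> 'M[int]_n -> Prop :=
  clos_refl_trans _ (@hadamard_step n).

(* Steps preserve the entry set {-1, 1} and the absolute value of the
   determinant, so the class of a D-optimal matrix consists of D-optimal
   matrices and need not be intersected with them. *)
Definition hadamard_class n (A : 'M[int]_n) : set 'M[int]_n :=
  [set B | hadamard_equiv A B].

(* Main.v *)
(* Up to negations all rows have an even number of entries -1. Choose the rows of
   a matrix of large determinant greedily: after the rows P, take next a row x of
   largest pivot, i.e. of largest squared distance p to the span of P. The squared
   determinant is the product of the pivots, and as pivots decrease along the
   sequence it is at most det(P P^T) p^k when k rows remain. For n = 11 and the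
   bound 327680 = 5 * 2^16 this leaves few choices of x, and up to permutations
   and negations of rows and columns the partial matrices that occur form the
   graph recorded in the tables below, which was found by a computer search. That
   each table exhausts the possible extensions of the previous one is verified by
   computation; pivots are evaluated from the inverse of the Gram matrix of P. The
   last table consists of three matrices of determinant 327680 in absolute value,
   and the sum of the absolute values of the entries of A A^T separates their
   classes. *)

From Stdlib Require Import ZArith Relation_Operators.
Require Import Defs.
From mathcomp Require Import all_boot all_order all_algebra all_fingroup.
From mathcomp Require Import boolp classical_sets functions cardinality.
From mathcomp Require Import ssrZ zify ring lra.

Set Implicit Arguments.
Unset Strict Implicit.
Unset Printing Implicit Defensive.

Import Order.TTheory GRing.Theory Num.Theory.

(** * Schur complements of a bilinear form *)

Section SchurForms.
Local Open Scope ring_scope.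
Variable F : realFieldType.

(** With an even number of entries -1 in every row, two rows differ in an even number of places, so
    all inner products are congruent to 3 modulo 4. Subtracting the first row of a Gram matrix from
    the others shows that the Gram determinant of m rows is divisible by 4^(m-1); the quotient is
    the volume of these rows. For full matrices 327680^2 = 4^10 * 102400, so the search handles
    small integers, and a new row of pivot p turns volume d into d p / 4. For the same reason four
    times the volume clears the denominators of the inverse Gram matrix. A pivot depends only on the
    set of rows chosen before, so different greedy orders can share a node; all that a node keeps of
    its history is a lower bound for the volume before the last choice, which caps the later pivots.
    No canonical form is computed: an edge carries the row order that yields the next node, and
    comparing sorted columns settles the rest. Maximality needs no separate argument: every matrix
    with determinant at least 327680 in absolute value is led to a leaf, and the leaves attain
    exactly this value. *)

Definition schur T (b : T -> T -> F) (a : T) : T -> T -> F :=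
  fun x y => b x y - b x a * b a y / b a a.

(** For a positive definite [b] this is the form on components orthogonal to [P], and its diagonal
    values are the pivots. Since division by zero gives zero, a vector of [P] that depends on its
    predecessors leaves the form unchanged. *)
Definition form T (b : T -> T -> F) (P : seq T) : T -> T -> F := foldl (@schur T) b P.

(** The Gram determinant of [s], evaluated by Gaussian elimination as the product of the successive
    pivots. *)
Fixpoint chain T (b : T -> T -> F) (s : seq T) : F :=
  if s is x :: s' then b x x * chain (schur b x) s' else 1.

Lemma form_rcons T (b : T -> T -> F) P a : form b (rcons P a) = schur (form b P) a.
Proof. by rewrite /form -cats1 foldl_cat. Qed.

Lemma chain_cat T (b : T -> T -> F) P S :
  chain b (P ++ S) = chain b P * chain (form b P) S.
Proof. by elim: P b => [|a P IH] b /=; rewrite ?mul1r // IH mulrA. Qed.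

Lemma chain_rcons T (b : T -> T -> F) P a :
  chain b (rcons P a) = chain b P * form b P a a.
Proof. by rewrite -cats1 chain_cat /= mulr1. Qed.

(** The predicate [D] is needed because the maps used later preserve inner products only between
    words of length 11. *)
Lemma form_isometry T T' (D : pred T) (b : T -> T -> F) (b' : T' -> T' -> F) (f : T -> T') P x y :
  (forall x y, D x -> D y -> b' (f x) (f y) = b x y) -> all D P -> D x -> D y ->
  form b' (map f P) (f x) (f y) = form b P x y.
Proof.
elim: P b b' => [|a P IH] b b' /= Hb; first by move=> _; apply: Hb.
case/andP=> Da DP Dx Dy; apply: IH => // u v Du Dv.
by rewrite /schur !Hb.
Qed.

Lemma chain_isometry T T' (D : pred T) (b : T -> T -> F) (b' : T' -> T' -> F) (f : T -> T') P :
  (forall x y, D x -> D y -> b' (f x) (f y) = b x y) -> all D P ->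
  chain b' (map f P) = chain b P.
Proof.
elim: P b b' => [|a P IH] b b' //= Hb /andP[Da DP].
by rewrite Hb // (IH (schur b a)) // => u v Du Dv; rewrite /schur !Hb.
Qed.

Variables (V : lmodType F) (b : V -> V -> F).
Hypothesis b_lin : forall t x y z, b (t *: x + y) z = t * b x z + b y z.
Hypothesis b_sym : forall x y, b x y = b y x.
Hypothesis b_ge0 : forall x, 0 <= b x x.
Hypothesis b_def : forall x, b x x = 0 -> x = 0.

Lemma b_D x y z : b (x + y) z = b x z + b y z.
Proof. by have := b_lin 1 x y z; rewrite scale1r mul1r. Qed.
Lemma b_0 z : b 0 z = 0.
Proof. by have h := b_D 0 0 z; rewrite addr0 in h; lra. Qed.
Lemma b_Z t x z : b (t *: x) z = t * b x z.
Proof. by rewrite -[t *: x]addr0 b_lin b_0 addr0. Qed.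
Lemma b_B x y z : b (x - y) z = b x z - b y z.
Proof. by rewrite b_D -scaleN1r b_Z mulN1r. Qed.

(** The second clause expresses that [u] lies in the span of [P] through double orthogonality, which
    avoids naming coefficients. *)
Definition is_projection (P : seq V) (x u : V) : Prop :=
  (forall a, a \in P -> b (x - u) a = 0) /\
  (forall z, (forall a, a \in P -> b z a = 0) -> b z u = 0).

(** The difference [u - u'] is orthogonal to [P], hence to both [u] and [u'], hence to itself. *)
Lemma projection_unique P x u u' : is_projection P x u -> is_projection P x u' -> u = u'.
Proof.
move=> [H1 H2] [H1' H2'].
have H a : a \in P -> b (u - u') a = 0.
  move=> aP; have h := H1 a aP; have h' := H1' a aP; rewrite !b_B in h h' *; lra.
apply/subr0_eq/b_def; rewrite b_B b_sym H2 // b_sym H2' //; lra.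
Qed.

(** A Gram-Schmidt step: when [a] joins [P], the projection of [x] gains the multiple [t] of the
    component [a - w] of [a] orthogonal to [P]. *)
Lemma form_projection P x : exists2 u, is_projection P x u & forall y, form b P x y = b (x - u) y.
Proof.
elim/last_ind: P x => [|P a IH] x.
  exists 0; last by move=> y; rewrite subr0.
  by split=> // z _; rewrite b_sym b_0.
have [u [ux1 ux2] Hu] := IH x.
have [w [wa1 wa2] Hw] := IH a.
pose t := form b P x a / form b P a a.
have Haa : form b P a a = b (a - w) (a - w).
  by rewrite Hw b_sym b_B b_sym (b_sym w) [b _ w]wa2 ?subr0 // => c cP; apply: wa1.
have E y : form b (rcons P a) x y = b (x - (u + t *: (a - w))) y.
  by rewrite opprD addrA b_B b_Z -Hu -Hw form_rcons /schur /t; ring.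
have HP c : c \in P -> b (x - (u + t *: (a - w))) c = 0.
  by move=> cP; rewrite opprD addrA b_B b_Z ux1 // wa1 // mulr0 subr0.
have Ha : b (x - (u + t *: (a - w))) a = 0.
  rewrite -E form_rcons /schur.
  (* If the pivot of [a] vanishes, then [a] equals its own projection [w], to which [x - u] is
     already orthogonal; the correction with [t = 0] is the right one. *)
  have [z0|nz] := eqVneq (form b P a a) 0; last by field.
  have aw : a - w = 0 by apply: b_def; rewrite -Haa.
  have -> : form b P x a = 0.
    by rewrite Hu (subr0_eq aw) wa2 // => c cP; apply: ux1.
  by rewrite !mul0r subr0.
exists (u + t *: (a - w)); last exact: E.
split=> [c|z Hz].
  by rewrite mem_rcons inE => /predU1P[->|/HP].
have zP c : c \in P -> b z c = 0 by move=> cP; apply: Hz; rewrite mem_rcons inE cP orbT.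
rewrite b_sym b_D b_Z b_B b_sym ux2 // (b_sym w) wa2 // b_sym Hz ?mem_rcons ?inE ?eqxx //.
by lra.
Qed.

Lemma formE P x u y : is_projection P x u -> form b P x y = b (x - u) y.
Proof. by move=> Hu; have [u' Hu' ->] := form_projection P x;
  rewrite (projection_unique Hu Hu'). Qed.

(** The conditions that characterise the projection mention only membership in [P], so order and
    repetitions do not matter. *)
Lemma form_eq_mem P P' x y : P =i P' -> form b P x y = form b P' x y.
Proof.
move=> E; have [u [H1 H2] ->] := form_projection P x; rewrite (@formE _ _ u) //; split=> [a|z Hz].
  by rewrite -E; apply: H1.
by apply: H2 => a; rewrite E; apply: Hz.
Qed.

Lemma form_gram P x : exists2 z, (forall a, a \in P -> b z a = 0) & form b P x x = b z z.
Proof.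
have [u [H1 H2] E] := form_projection P x; exists (x - u) => //.
by rewrite E [RHS]b_B (b_sym u) H2 // subr0 b_sym.
Qed.

Lemma form_ge0 P x : 0 <= form b P x x.
Proof. by have [z _ ->] := form_gram P x. Qed.

Lemma form_sym P x y : form b P x y = form b P y x.
Proof.
have [u [H1 H2] ->] := form_projection P x; have [w [H1' H2'] ->] := form_projection P y.
have e1 : b (x - u) w = 0 by apply: H2'.
have e2 : b (y - w) u = 0 by apply: H2.
move: e1 e2; rewrite !b_B (b_sym w u) (b_sym y u) (b_sym y x) (b_sym x w).
lra.
Qed.

Lemma form_rcons_le P a x : form b (rcons P a) x x <= form b P x x.
Proof.
rewrite form_rcons /schur lerBlDr lerDl form_sym divr_ge0 ?form_ge0 //.
by rewrite -expr2 sqr_ge0.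
Qed.

(** Later pivots are taken over larger sets of rows and can only be smaller, so each of the factors
    stays below [p]. *)
Lemma chain_le P S p : (forall y, y \in S -> form b P y y <= p) ->
  chain (form b P) S <= p ^+ size S.
Proof.
elim: S P => [|x S IH] P H //=.
rewrite exprS ler_pM ?form_ge0 //.
- rewrite -form_rcons; elim: S (rcons P x) {IH H} => [|y S IH] Q /=; first exact: ler01.
  by rewrite mulr_ge0 ?form_ge0 // -form_rcons.
- by apply: H; rewrite mem_head.
rewrite -form_rcons; apply: IH => y yS; apply: le_trans (form_rcons_le _ _ _) _.
by apply: H; rewrite inE yS orbT.
Qed.

(** Put [r] in front of [P]: the bound is the pivot of [x] over [r] alone, and further rows only
    lower it. This is the cheap test by which candidates are filtered. *)
Lemma form_le_single P r x : r \in P -> form b P x x <= b x x - b x r ^+ 2 / b r r.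
Proof.
move=> rP; rewrite (@form_eq_mem P (r :: P)); last first.
  by move=> y; rewrite inE; case: eqP => // ->.
suff H Q Q' : form b (Q ++ Q') x x <= form b Q x x.
  by apply: le_trans (H [:: r] P) _; rewrite /form /= /schur (b_sym r x) expr2.
elim/last_ind: Q' => [|Q' a IH]; first by rewrite cats0.
by rewrite -rcons_cat; apply: le_trans IH; apply: form_rcons_le.
Qed.

(** The two pivots of [a] and [c], in either order, multiply to the 2 by 2 determinant of [form b P]
    on them; the remaining pivots see the same set of predecessors. *)
Lemma chain_swap P a c S : chain b (P ++ a :: c :: S) = chain b (P ++ c :: a :: S).
Proof.
have E : form b P a a * form b (rcons P a) c c = form b P c c * form b (rcons P c) a a.
  (* The degenerate case of the Cauchy-Schwarz inequality. It covers the zero pivots, where the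
     quotient in [schur] is only a convention. *)
  have null u v : form b P u u = 0 -> form b P u v = 0.
    have [z [H1 H2] Hz] := form_projection P u.
    rewrite !Hz => H0; suff -> : u - z = 0 by rewrite b_0.
    by apply: b_def; rewrite b_B (b_sym z) (H2 (u - z)) // subr0 b_sym.
  rewrite !form_rcons /schur (form_sym P c a).
  have [a0|na] := eqVneq (form b P a a) 0; have [c0|nc] := eqVneq (form b P c c) 0.
  - by rewrite a0 c0 !mul0r.
  - by rewrite a0 (null a c a0) !mul0r subr0 mulr0.
  - by rewrite c0 form_sym (null c a c0) !mul0r subr0 mulr0.
  by field; rewrite na nc.
rewrite !chain_cat /= -!form_rcons !mulrA -(mulrA (chain b P)) E mulrA; congr (_ * _).
rewrite -[S in LHS]map_id; apply: (@chain_isometry _ _ predT) => [x y _ _|]; last exact/allP.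
by apply: form_eq_mem => z; rewrite !(mem_rcons, inE) orbCA.
Qed.

(** The head of [s] is brought to the front of [t] by adjacent swaps, after a prefix that is already
    common to both. *)
Lemma chain_perm s t : perm_eq s t -> chain b s = chain b t.
Proof.
rewrite -[s]cat0s -[t]cat0s perm_cat2l.
elim: s [::] t => [|a s IH] P t; first by rewrite perm_sym => /perm_nilP ->.
move=> st; have at_ : a \in t by rewrite -(perm_mem st) mem_head.
case/splitPr: t / at_ st => t1 t2 st.
rewrite -cat_rcons (IH _ (t1 ++ t2)); last first.
  rewrite -(perm_cons a); apply: perm_trans st _.
  exact: permEl (perm_catCA t1 [:: a] t2).
rewrite cat_rcons; elim: t1 P {IH st} => [|c t1 IH] P //=.
by rewrite chain_swap -cat_rcons IH cat_rcons.
Qed.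

End SchurForms.

(** * The squared determinant as a product of pivots *)

Section DeterminantChain.
Local Open Scope ring_scope.
Variables (F : realFieldType) (n : nat).
Implicit Types x y z : 'rV[F]_n.

Definition rdot x y : F := \sum_j x 0 j * y 0 j.

Lemma rdot_lin t x y z : rdot (t *: x + y) z = t * rdot x z + rdot y z.
Proof.
rewrite /rdot mulr_sumr -big_split /=; apply: eq_bigr => j _; rewrite !mxE; ring.
Qed.
Lemma rdot_sym x y : rdot x y = rdot y x.
Proof. by apply: eq_bigr => j _; rewrite mulrC. Qed.
Lemma rdot_ge0 x : 0 <= rdot x x.
Proof. by apply: sumr_ge0 => j _; rewrite -expr2 sqr_ge0. Qed.
Lemma rdot_def x : rdot x x = 0 -> x = 0.
Proof.
move=> H; apply/rowP => j; rewrite mxE; apply/eqP; rewrite -sqrf_eq0 expr2; apply/eqP.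
by apply: (psumr_eq0P _ H) => // k _; rewrite -expr2 sqr_ge0.
Qed.

Let pivot (s : seq 'rV[F]_n) i := form rdot (take i s) (nth 0 s i) (nth 0 s i).

Lemma chain_take s k : (k <= size s)%N -> chain rdot (take k s) = \prod_(i < k) pivot s i.
Proof.
elim: k => [|k IH] H; first by rewrite take0 big_ord0.
by rewrite (take_nth 0) // chain_rcons big_ord_recr /= IH // ltnW.
Qed.

(** The hypothesis is a disjunction because the identity is used in both directions: from a large
    determinant to its pivots, and from the computed pivots of a leaf to its determinant. *)
Lemma sqr_det_chain (A : 'M[F]_n) :
  let c := chain rdot [seq row i A | i <- enum 'I_n] in
  \det A != 0 \/ c != 0 -> \det A ^+ 2 = c.
Proof.
set s := [seq _ | _ <- _] => c Hnz.
have ss : size s = n by rewrite size_map size_enum_ord.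
have sE (i : 'I_n) : nth 0 s i = row i A.
  by rewrite (nth_map i) ?size_enum_ord // nth_ord_enum.
have cE : c = \prod_(i < n) pivot s i by rewrite -chain_take ?ss // take_oversize // ss.
have [u Hu Eu] : exists2 u : 'I_n -> 'rV_n,
    forall i : 'I_n, is_projection rdot (take i s) (row i A) (u i)
  & forall (i : 'I_n) y, form rdot (take i s) (row i A) y = rdot (row i A - u i) y.
  have H (i : 'I_n) := form_projection rdot_lin rdot_sym rdot_def (take i s) (row i A).
  exact (@fin_all_exists2 'I_n (fun=> 'rV_n) (fun i u => is_projection rdot (take i s) (row i A) u)
    (fun i u => forall y, form rdot (take i s) (row i A) y = rdot (row i A - u) y) H).
pose z (i : 'I_n) := row i A - u i.
have take_row (i j : 'I_n) : (i < j)%N -> row i A \in take j s.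
  by move=> ij; rewrite -sE -(nth_take 0 ij) mem_nth // size_take ss ltn_ord.
have zA (i j : 'I_n) : (i < j)%N -> rdot (row i A) (z j) = 0.
  by move=> ij; rewrite rdot_sym; apply: (Hu j).1; apply: take_row.
have take_sub (i j : 'I_n) a : (i < j)%N -> a \in take i s -> a \in take j s.
  move=> ij; rewrite -(subnKC (ltnW ij)) takeD mem_cat => ->; exact: isT.
have zu (i j : 'I_n) : (i <= j)%N -> rdot (u i) (z j) = 0.
  move=> ij; rewrite rdot_sym; apply: (Hu i).2 => a ai; apply: (Hu j).1.
  by move: ij; rewrite leq_eqVlt => /predU1P[/val_inj <-|/take_sub] //; apply.
have zz (i j : 'I_n) : (i <= j)%N -> rdot (z i) (z j) = rdot (row i A) (z j).
  by move=> ij; rewrite /z b_B ?zu ?subr0 //; apply: rdot_lin.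
have piv i : rdot (row i A) (z i) = pivot s i.
  by rewrite /pivot sE Eu rdot_sym.
(* The rows of [Z] are the Gram-Schmidt vectors. The product of [A] with the transpose of [Z] is
   triangular and that of [Z] with its own transpose is diagonal, both with the pivots on the
   diagonal. *)
pose Z : 'M[F]_n := \matrix_(i, j) z i 0 j.
have E1 i j : (A *m Z^T) i j = rdot (row i A) (z j).
  by rewrite mxE; apply: eq_bigr => k _; rewrite !mxE.
have E2 i j : (Z *m Z^T) i j = rdot (z i) (z j).
  by rewrite mxE; apply: eq_bigr => k _; rewrite !mxE.
have D1 : \det A * \det Z = c.
  rewrite -[\det Z]det_tr -det_mulmx det_trig ?cE.
    by apply: eq_bigr => i _; rewrite E1 piv.
  by apply/is_trig_mxP => i j ij; rewrite E1 zA.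
have D2 : \det Z ^+ 2 = c.
  rewrite expr2 -[X in _ * X]det_tr -det_mulmx det_trig ?cE.
    by apply: eq_bigr => i _; rewrite E2 zz // piv.
  by apply/is_trig_mxP => i j ij; rewrite E2 zz ?zA // ltnW.
(* For invertible [A] no pivot vanishes: a column [w] of the inverse is orthogonal to all rows but
   row [i], hence to the projection of row [i] on the earlier rows, while its product with row [i]
   is 1. *)
have {Hnz} c0 : c != 0.
  case: Hnz => // dA; rewrite cE; apply/prodf_neq0 => i _; apply/eqP => pi0.
  have zi0 : z i = 0 by apply: rdot_def; rewrite zz // piv.
  pose w := (col i (invmx A))^T.
  have wA k : rdot w (row k A) = (k == i)%:R.
    transitivity ((A *m invmx A) k i); last by rewrite mulmxV ?mxE // unitmxE unitfE.
    by rewrite mxE; apply: eq_bigr => j _; rewrite !mxE mulrC.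
  have: rdot w (u i) = 0.
    apply: (Hu i).2 => a /(nthP 0)[k]; rewrite size_take ss ltn_ord => ki <-.
    have kn : (k < n)%N by apply: ltn_trans ki (ltn_ord i).
    by rewrite nth_take // -[k]/(val (Ordinal kn)) sE wA -val_eqE /= ltn_eqF.
  by rewrite -(subr0_eq zi0) wA eqxx => /eqP; rewrite oner_eq0.
apply: (mulIf c0); rewrite -{1}D2 -exprMn D1; ring.
Qed.

End DeterminantChain.

(** * The certificate checker *)

Notation bits := (seq bool).

(** Looks up the Hamming distance of [x] and [y] in the table [t] without computing it: the table
    loses its head at each disagreement, and the head that remains is the answer. *)
Fixpoint ham_nth T (d : T) (t : seq T) (x y : bits) : T :=
  match x, y with
  | a :: x', b :: y' =>
      ham_nth d (match a, b with
                 | true, true | false, false => t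
                 | _, _ => match t with [::] => [::] | _ :: t' => t' end
                 end) x' y'
  | _, _ => match t with [::] => d | h :: _ => h end
  end.

Fixpoint zipw A B C (f : A -> B -> C) (s : seq A) (t : seq B) : seq C :=
  match s, t with a :: s', b :: t' => f a b :: zipw f s' t' | _, _ => [::] end.

Fixpoint parity_words n (e : bool) : seq bits :=
  if n is n'.+1 then
    map (cons false) (parity_words n' e) ++ map (cons true) (parity_words n' (~~ e))
  else if e then [::] else [:: [::]].

Definition even_word (x : bits) : bool := (size x == 11) && ~~ foldr addb false x.

Fixpoint columns (n : nat) (rows : seq bits) : seq bits :=
  if rows is r :: rows' then zipw cons r (columns n rows') else nseq n [::].

(** The conditionals let an eager evaluation stop at the first difference, which a conjunction would
    not. *)
Fixpoint bits_eqb (x y : bits) : bool :=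
  match x, y with
  | [::], [::] => true
  | a :: x', b :: y' => if eqb a b then bits_eqb x' y' else false
  | _, _ => false
  end.

Fixpoint bits_leb (x y : bits) : bool :=
  match x, y with
  | [::], _ => true
  | a :: x', b :: y' => if eqb a b then bits_leb x' y' else b
  | _, _ => false
  end.

Fixpoint lbits_eqb (x y : seq bits) : bool :=
  match x, y with
  | [::], [::] => true
  | a :: x', b :: y' => if bits_eqb a b then lbits_eqb x' y' else false
  | _, _ => false
  end.

Fixpoint insert_bits x s :=
  if s is y :: s' then if bits_leb x y then x :: s else y :: insert_bits x s' else [:: x].

(** The sorted list of columns is a normal form of a list of rows under column permutations. *)
Definition sort_bits s := foldr insert_bits [::] s.

(* Within each block of equal columns, [x] starts with its [false] entries. *)
Fixpoint ties_sorted (c : bits) (a : bool) (cols : seq bits) (x : bits) : bool :=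
  match cols, x with
  | d :: cols', b :: x' =>
      if (if a then (if b then false else bits_eqb c d) else false) then false
      else ties_sorted d b cols' x'
  | _, _ => true
  end.

Definition ip_values : seq Z :=
  Eval compute in [seq Z.sub 11 (Z.mul 2 (Z.of_nat h)) | h <- iota 0 12].
Definition inner (x y : bits) : Z := ham_nth Z0 ip_values x y.

Fixpoint dotZ (v w : seq Z) : Z :=
  match v, w with
  | a :: v', b :: w' => Z.add (Z.mul a b) (dotZ v' w')
  | _, _ => Z0
  end.

Definition mulvZ (A : seq (seq Z)) v := map (fun r => dotZ r v) A.

(* The inverse [A / q] of a Gram matrix bordered by [v]; nothing is proved about
   this formula, since [is_inverse] checks its result. *)
Definition border (v : seq Z) (qA : Z * seq (seq Z)) : Z * seq (seq Z) :=
  let: (q, A) := qA in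
  let u := mulvZ A v in
  let c := Z.sub (Z.mul 11 q) (dotZ v u) in
  let w := map (fun t => Z.opp (Z.div t 4)) u in
  (Z.div c 4,
   rcons
     (zipw (fun r t =>
        rcons (zipw (fun a t' => Z.div (Z.add (Z.mul c a) (Z.mul t t')) (Z.mul 4 q)) r u)
              (Z.opp (Z.div t 4))) A u)
     (rcons w (Z.div q 4))).

Fixpoint gram_inverse (pre rows : seq bits) qA :=
  if rows is r :: rows' then
    gram_inverse (rcons pre r) rows' (border (map (inner r) pre) qA)
  else qA.

(** Checks that the Gram matrix of [P] times the transpose of [A] is [q] times the identity. This
    one-sided relation suffices, since it already provides the coefficients of projections. *)
Definition is_inverse (P : seq bits) (q : Z) (A : seq (seq Z)) : bool :=
  all (fun j =>
    let g := map (inner (nth [::] P j)) P in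
    all (fun l => Z.eqb (dotZ g (nth [::] A l)) (if j == l then q else Z0)) (iota 0 (size P)))
    (iota 0 (size P)).

(* A node describes the first [m] rows of a candidate matrix: their Gram
   determinant is [4 ^ (m - 1) * vol], no remaining row has a pivot above
   [4 * vol / parent_vol], and a child of volume at most [low_vol] cannot be
   completed to a matrix of large determinant. *)
Record node := Node { rows : seq bits; vol : Z; parent_vol : Z; low_vol : Z }.

Definition node0 := Node [::] Z0 Z0 Z0.

(* The order in which the rows of a node and of one new row have to be taken to
   obtain a node of the next table, and the index of that node. *)
Definition edge := (seq nat * nat)%type.

(** Adding the first row to every row negates the columns in which it has an entry -1, so that the
    first row becomes constant as in every node. *)
Definition child_rows (Q : seq bits) (s : seq nat) : seq bits :=
  let Qs := map (nth [::] Q) s in map (zipw addb (head [::] Qs)) Qs.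

Definition is_perm (s : seq nat) n := (size s == n) && all (fun i => i \in s) (iota 0 n).

(** Here [c] is [4 * d] times the pivot of [x], so the child has volume [c / 16]. As several parents
    may lead to one node, its [parent_vol] only has to be at most [d]: a smaller value allows larger
    pivots and is therefore safe. *)
Definition edge_ok (tbl : seq node) (P : seq bits) (d : Z) (x : bits) (c : Z) (e : edge) : bool :=
  let: (s, i) := e in
  let Q := rcons P x in
  let nd := nth node0 tbl i in
  [&& i < size tbl, size (rows nd) == size Q, all even_word (rows nd), Z.ltb 0 (parent_vol nd),
      Z.eqb c (Z.mul 16 (vol nd)), Z.leb (parent_vol nd) d, is_perm s (size Q)
    & lbits_eqb (sort_bits (columns 11 (child_rows Q s))) (columns 11 (rows nd))].

(** A useful pivot p satisfies [4 * b < d * p], and a single row with inner product v forces p <= 11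
    - v^2 / 11. The resulting inequality is tabulated by Hamming distance. *)
Definition candidates (P : seq bits) (d b : Z) (X : seq bits) : seq bits :=
  let tab := map (fun v => Z.ltb (Z.mul 44 b) (Z.mul d (Z.sub 121 (Z.mul v v)))) ip_values in
  foldl (fun X r => filter (ham_nth false tab r) X) X P.

(** The first test discards children of too small a volume, the second those whose pivot
    [c / (4 * d)] exceeds the cap [4 * d / e] left by the previous greedy choice. Each survivor
    consumes one edge, so the edges are listed in the order of enumeration. *)
Fixpoint edges_ok (tbl : seq node) P d e b A X (es : seq edge) : bool :=
  if X is x :: X' then
    let v := map (inner x) P in
    let c := Z.sub (Z.mul 44 d) (dotZ v (mulvZ A v)) in
    if Z.leb c (Z.mul 16 b) then edges_ok tbl P d e b A X' es
    else if Z.ltb (Z.mul 16 (Z.mul d d)) (Z.mul c e) then edges_ok tbl P d e b A X' es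
    else if es is f :: es' then
      if edge_ok tbl P d x c f then edges_ok tbl P d e b A X' es' else false
    else false
  else if es is [::] then true else false.

(** With k rows missing and d' the volume of the child, the greedy bound on the determinant reads
    102400 * d^(k-1) <= d'^k, which the power inequality excludes for d' <= b. The inversion starts
    from the 1 by 1 Gram matrix 11, with inverse 4 / 44. *)
Definition node_ok (tbl : seq node) (X : seq bits) (nd : node) (es : seq edge) : bool :=
  let: Node P d e b := nd in
  let m := size P in
  let k := 11 - m in
  let cols := columns 11 P in
  let: (q, A) := gram_inverse [:: head [::] P] (behead P) (Zpos 44, [:: [:: Zpos 4]]) in
  [&& 0 < m, m < 11, Z.ltb 0 d, Z.ltb 0 e, Z.leb 0 b,
      Z.ltb (Z.pow b (Z.of_nat k)) (Z.mul 102400 (Z.pow d (Z.of_nat k.-1))),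
      Z.eqb q (Z.mul 4 d), sorted bits_leb cols, is_inverse P q A
    & edges_ok tbl P d e b A (filter (ties_sorted [::] false cols) (candidates P d b X)) es].

Fixpoint level_ok tbl X (nds : seq node) (ess : seq (seq edge)) :=
  match nds, ess with
  | [::], _ => true
  | nd :: nds', es :: ess' => if node_ok tbl X nd es then level_ok tbl X nds' ess' else false
  | _, _ => false
  end.

Fixpoint pos_bits (p : positive) : bits :=
  match p with xH => [::] | xO p' => false :: pos_bits p' | xI p' => true :: pos_bits p' end.

Definition digit (a b c d : bool) : nat :=
  ((if a then 1 else 0) + ((if b then 2 else 0) + ((if c then 4 else 0) + (if d then 8 else 0))))%N.

Fixpoint digits (s : bits) : seq nat :=
  if s is [:: a, b, c, d & s'] then digit a b c d :: digits s' else [::].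

(* A row is read from the binary digits of a number, lowest digit first and
   without the leading one; [true] stands for the entry [-1]. The first row is
   constant and omitted. *)
Definition mkn (r : seq positive) (d e b : Z) : node :=
  Node (nseq 11 false :: map pos_bits r) d e b.

(* The row order is read from hexadecimal digits, lowest digit first and without
   the leading one. *)
Definition mke (p : positive) (i : nat) : edge := (digits (pos_bits p), i).

(** Evaluates the volume of a complete matrix row by row, testing every intermediate inverse. The
    search bounds determinants only for matrices assumed large, so the leaves need their own
    evaluation. *)
Fixpoint last_volume (pre rest : seq bits) (d : Z) (qA : Z * seq (seq Z)) : option Z :=
  if rest is x :: rest' then
    let: (q, A) := qA in
    let v := map (inner x) pre in
    let c := Z.sub (Z.mul 44 d) (dotZ v (mulvZ A v)) in
    let d' := Z.div c 16 in
    if [&& Z.eqb q (Z.mul 4 d), is_inverse pre q A, Z.eqb c (Z.mul 16 d') & Z.ltb 0 d] then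
      last_volume (rcons pre x) rest' d' (border v qA)
    else None
  else Some d.

Definition abs_gram_sum (B : seq bits) : Z :=
  foldr (fun x s => Z.add (foldr (fun y t => Z.add (Z.abs (inner x y)) t) Z0 B) s) Z0 B.

(** * Hadamard equivalence of matrices given by lists of words *)

Section HadamardMoves.
Local Open Scope ring_scope.
Variable n : nat.
Implicit Types (A : 'M[int]_n) (B : seq bits).

Lemma equiv_neg_rows A (s : pred 'I_n) :
  hadamard_equiv A (\matrix_(i, j) if s i then - A i j else A i j).
Proof.
(* The rows are negated one at a time; without repetitions in [l], no negation is undone. *)
suff H (l : seq 'I_n) : uniq l ->
    hadamard_equiv A (\matrix_(i, j) if i \in l then - A i j else A i j).
  move: (H (enum s) (enum_uniq _)); congr hadamard_equiv.
  by apply/matrixP => i j; rewrite !mxE mem_enum.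
elim: l => [|k l IH] /=.
  move=> _; set A' := (X in hadamard_equiv _ X).
  by have -> : A' = A; [apply/matrixP => i j; rewrite mxE | apply: rt_refl].
case/andP=> kl /IH; set A' := (X in hadamard_equiv _ X) => {}IH.
apply: rt_trans IH _; apply: rt_step.
set A2 := (X in hadamard_step _ X).
have -> : A2 = neg_row k A'; last exact: HadamardNegRow.
apply/matrixP => i j; rewrite !mxE inE.
by case: eqP => [->|] //=; rewrite (negbTE kl).
Qed.

Lemma equiv_neg_cols A (s : pred 'I_n) :
  hadamard_equiv A (\matrix_(i, j) if s j then - A i j else A i j).
Proof.
suff H (l : seq 'I_n) : uniq l ->
    hadamard_equiv A (\matrix_(i, j) if j \in l then - A i j else A i j).
  move: (H (enum s) (enum_uniq _)); congr hadamard_equiv.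
  by apply/matrixP => i j; rewrite !mxE mem_enum.
elim: l => [|k l IH] /=.
  move=> _; set A' := (X in hadamard_equiv _ X).
  by have -> : A' = A; [apply/matrixP => i j; rewrite mxE | apply: rt_refl].
case/andP=> kl /IH; set A' := (X in hadamard_equiv _ X) => {}IH.
apply: rt_trans IH _; apply: rt_step.
set A2 := (X in hadamard_step _ X).
have -> : A2 = neg_col k A'; last exact: HadamardNegCol.
apply/matrixP => i j; rewrite !mxE inE.
by case: eqP => [->|] //=; rewrite (negbTE kl).
Qed.

Definition sgb (b : bool) : int := if b then -1 else 1.

(** Missing entries are read as [false], that is as 1, so every list of words gives a sign
    matrix. *)
Definition sign_mx B : 'M[int]_n := \matrix_(i, j) sgb (nth false (nth [::] B i) j).

Lemma sgb_neg b : sgb (~~ b) = - sgb b.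
Proof. by case: b; rewrite //= opprK. Qed.

Lemma sgb_addb a b : sgb (a (+) b) = if a then - sgb b else sgb b.
Proof. by case: a; rewrite /= ?sgb_neg. Qed.

Lemma equiv_perm_rows B B' : size B = n -> perm_eq B' B ->
  hadamard_equiv (sign_mx B) (sign_mx B').
Proof.
move=> sB pB; have sB' : size B' == n by rewrite (perm_size pB) sB.
move/eqP in sB; have /tuple_permP[p /= Ep] : perm_eq (Tuple sB') (Tuple sB) by [].
apply: rt_step; set A2 := (X in hadamard_step _ X).
have -> : A2 = row_perm p (sign_mx B); last exact: HadamardRowPerm.
apply/matrixP => i j; rewrite !mxE Ep; congr (sgb (nth _ _ _)).
by rewrite (nth_map i) ?size_enum_ord // nth_ord_enum (tnth_nth [::]).
Qed.

Lemma nth_zipw_addb f r j : size f = size r ->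
  nth false (zipw addb f r) j = nth false f j (+) nth false r j.
Proof.
elim: f r j => [|a f IH] [|c r] [|j] //= [H].
exact: IH.
Qed.

(** Adding [f] to all rows negates the columns where [f] is [true]. *)
Lemma equiv_xor B f : size f = n -> size B = n -> all (fun r => size r == n) B ->
  hadamard_equiv (sign_mx B) (sign_mx (map (zipw addb f) B)).
Proof.
move=> sf sB /all_nthP H.
apply: rt_trans (equiv_neg_cols _ (fun j => nth false f j)) _.
set A1 := (X in clos_refl_trans _ _ X _); set A2 := (X in clos_refl_trans _ _ _ X).
have -> : A1 = A2; last exact: rt_refl.
apply/matrixP => i j; rewrite !mxE (nth_map [::]) ?sB // nth_zipw_addb ?sgb_addb //.
by rewrite sf; apply/esym/eqP/H; rewrite sB.
Qed.

Definition shuffle (c : seq nat) (r : bits) : bits := [seq nth false r j | j <- c].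

Lemma equiv_shuffle B c : size B = n -> perm_eq c (iota 0 n) ->
  hadamard_equiv (sign_mx B) (sign_mx (map (shuffle c) B)).
Proof.
move=> sB pc; have sc : size c = n by rewrite (perm_size pc) size_iota.
have cn (i : 'I_n) : (nth 0%N c i < n)%N.
  by have := @mem_nth _ 0%N c i; rewrite sc (perm_mem pc) mem_iota add0n; apply.
pose g (i : 'I_n) := Ordinal (cn i).
have g_inj : injective g.
  move=> i j [] /eqP; rewrite nth_uniq ?sc //; first by move/eqP/val_inj.
  by rewrite (perm_uniq pc) iota_uniq.
apply: rt_step; set A2 := (X in hadamard_step _ X).
have -> : A2 = col_perm (perm g_inj) (sign_mx B); last exact: HadamardColPerm.
apply/matrixP => i j; rewrite !mxE permE (nth_map [::]) ?sB //=.
by rewrite (nth_map 0%N) ?sc.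
Qed.

(** In odd order, negating a row changes the parity of its number of entries -1, so it is enough to
    negate the rows of odd parity. *)
Lemma sign_matrix_lists A : sign_matrix A -> odd n ->
  exists2 B, hadamard_equiv A (sign_mx B)
  & size B = n /\ all (fun r => (size r == n) && ~~ foldr addb false r) B.
Proof.
move=> sA on.
pose r0 i := [seq A i j == -1 | j <- enum 'I_n].
pose t i := foldr addb false (r0 i).
pose r i := [seq t i (+) b | b <- r0 i].
have sr i : size (r0 i) = n by rewrite size_map size_enum_ord.
have r0E i (j : 'I_n) : nth false (r0 i) j = (A i j == -1).
  by rewrite (nth_map j) ?size_enum_ord // nth_ord_enum.
exists [seq r i | i <- enum 'I_n].
  apply: rt_trans (equiv_neg_rows _ t) _.
  set A1 := (X in clos_refl_trans _ _ X _); set A2 := (X in clos_refl_trans _ _ _ X).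
  have -> : A1 = A2; last exact: rt_refl.
  apply/matrixP => i j; rewrite !mxE (nth_map i) ?size_enum_ord // nth_ord_enum.
  by rewrite (nth_map false) ?sr // r0E sgb_addb; case: (sA i j) => ->.
split; first by rewrite size_map size_enum_ord.
apply/allP => _ /mapP[i _ ->]; rewrite size_map sr eqxx /=.
have H b s : foldr addb false [seq b (+) x | x <- s] = (b && odd (size s)) (+) foldr addb false s.
  by elim: s => [|x s /= ->]; rewrite ?andbF //;
    case: b; case: x; case: (odd _) => //=; case: (foldr _ _ _).
by rewrite /r H sr on andbT /t addbb.
Qed.

Lemma det_neg_row A k : \det (neg_row k A) = - \det A.
Proof.
rewrite (@determinant_multilinear _ _ _ A A k (-1) 0) ?mulN1r ?mul0r ?addr0 //.
- by apply/rowP => j; rewrite !mxE eqxx; rewrite mulN1r mul0r addr0.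
- by apply/matrixP => i j; rewrite !mxE eq_sym (negbTE (neq_lift _ _)).
by apply/matrixP => i j; rewrite !mxE eq_sym (negbTE (neq_lift _ _)).
Qed.

Lemma equiv_norm_det A A' : hadamard_equiv A A' -> `|\det A| = `|\det A'|.
Proof.
elim=> [X Y [s|s|k|k]||X Y Z _ -> _ ->] //.
- by rewrite row_permE det_mulmx det_perm normrM normr_sign mul1r.
- by rewrite col_permE det_mulmx det_perm normrM normr_sign mulr1.
- by rewrite det_neg_row normrN.
have -> : neg_col k X = (neg_row k X^T)^T by apply/matrixP => i j; rewrite !mxE.
by rewrite det_tr det_neg_row normrN det_tr.
Qed.

End HadamardMoves.

(** * Sorted columns and column permutations *)

Section ColumnLists.

Lemma zipwE A B C (f : A -> B -> C) s t : zipw f s t = [seq f p.1 p.2 | p <- zip s t].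
Proof. by elim: s t => [|a s IH] [|b t] //=; rewrite IH. Qed.

Lemma bits_eqbE x y : bits_eqb x y = (x == y).
Proof.
elim: x y => [|a x IH] [|b y] //=; rewrite eqseq_cons -IH.
by case: a; case: b.
Qed.

Lemma lbits_eqbE x y : lbits_eqb x y = (x == y).
Proof.
elim: x y => [|a x IH] [|b y] //=; rewrite eqseq_cons -IH bits_eqbE.
by case: (a == b).
Qed.

Lemma bits_leb_total : total bits_leb.
Proof. by elim=> [|a x IH] [|b y] //=; have := IH y; case: a; case: b. Qed.

Lemma bits_leb_trans : transitive bits_leb.
Proof.
elim=> [|b y IH] [|a x] [|c z] //=; have := IH x z; case: a; case: b; case: c => //=; exact.
Qed.

Lemma bits_leb_anti : antisymmetric bits_leb.
Proof.
elim=> [|a x IH] [|b y] //=; have := IH y.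
by case: a; case: b => //= H /H ->.
Qed.

Lemma sort_bits_perm s : perm_eq (sort_bits s) s.
Proof.
have H x t : perm_eq (insert_bits x t) (x :: t).
  elim: t => [|y t IH] //=; case: ifP => // _.
  by apply: (@perm_trans _ (y :: x :: t)); rewrite ?perm_cons //;
    apply: permEl (perm_catCA [:: y] [:: x] t).
elim: s => [|x s IH] //=; apply: perm_trans (H _ _) _; by rewrite perm_cons.
Qed.

Lemma columnsE n rs : all (fun r => size r == n) rs ->
  columns n rs = [seq [seq nth false r j | r <- rs] | j <- iota 0 n].
Proof.
elim: rs => [|r rs IH] /=.
  by move=> _; apply: (@eq_from_nth _ [::]) => [|i];
    rewrite size_nseq ?size_map ?size_iota // => Hi; rewrite nth_nseq Hi (nth_map 0) ?size_iota.
case/andP=> /eqP sr /IH ->; rewrite zipwE.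
apply: (@eq_from_nth _ [::]) => [|i];
  rewrite size_map size_zip size_map size_iota sr minnn ?size_map ?size_iota //.
move=> Hi; rewrite (nth_map (false, [::])) ?size_zip ?size_map ?size_iota ?sr ?minnn //.
by rewrite nth_zip ?size_map ?size_iota //= !(nth_map 0) ?size_iota // !nth_iota.
Qed.

Lemma nth_columns n rs i j : all (fun r => size r == n) rs -> j < n -> i < size rs ->
  nth false (nth [::] (columns n rs) j) i = nth false (nth [::] rs i) j.
Proof.
move=> H jn irs; rewrite columnsE // (nth_map 0) ?size_iota // nth_iota // add0n.
by rewrite (nth_map [::]).
Qed.

Lemma size_columns n rs : all (fun r => size r == n) rs -> size (columns n rs) = n.
Proof. by move=> H; rewrite columnsE // size_map size_iota. Qed.

Lemma size_shuffle c r : size (shuffle c r) = size c.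
Proof. by rewrite size_map. Qed.

Lemma shuffle_columns n rs rs' c :
  all (fun r => size r == n) rs -> all (fun r => size r == n) rs' -> size rs = size rs' ->
  perm_eq c (iota 0 n) -> columns n rs' = [seq nth [::] (columns n rs) j | j <- c] ->
  rs' = map (shuffle c) rs.
Proof.
move=> H H' ss pc E; have sc : size c = n by rewrite (perm_size pc) size_iota.
apply: (@eq_from_nth _ [::]) => [|i i_lt]; first by rewrite size_map ss.
rewrite (nth_map [::]) ?ss //; apply: (@eq_from_nth _ false) => [|j].
  by rewrite size_shuffle sc; apply/eqP; move/all_nthP: H'; apply.
have -> : size (nth [::] rs' i) = n by apply/eqP; move/all_nthP: H'; apply.
move=> jn; rewrite -(nth_columns H') // E (nth_map 0) ?sc // (nth_map 0) ?sc //.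
rewrite nth_columns ?ss //.
have := @mem_nth _ 0 c j; rewrite sc (perm_mem pc) mem_iota add0n; exact.
Qed.

Lemma perm_columns n rs rs' :
  all (fun r => size r == n) rs -> all (fun r => size r == n) rs' -> size rs = size rs' ->
  perm_eq (columns n rs') (columns n rs) ->
  exists2 c, perm_eq c (iota 0 n) & rs' = map (shuffle c) rs.
Proof.
move=> H H' ss /(perm_iotaP [::])[c]; rewrite size_columns // => pc E.
by exists c => //; apply: shuffle_columns E.
Qed.

(** The lexicographic order on columns lengthened by the entry of a new row: this entry decides only
    between equal columns. *)
Definition tie_leb (p q : bits * bool) := if p.1 == q.1 then p.2 ==> q.2 else bits_leb p.1 q.1.

Lemma tie_leb_total : total tie_leb.
Proof.
move=> [x a] [y b]; rewrite /tie_leb /= (eq_sym y); case: eqP => _; last exact: bits_leb_total.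
by case: a; case: b.
Qed.

Lemma tie_leb_leb p q : tie_leb p q -> bits_leb p.1 q.1.
Proof.
rewrite /tie_leb; case: eqP => // -> _; by have := bits_leb_total q.1 q.1; rewrite orbb.
Qed.

Lemma path_ties_sorted c a cols x :
  path tie_leb (c, a) (zip cols x) -> ties_sorted c a cols x.
Proof.
elim: cols c a x => [|d cols IH] c a [|b x] //= /andP[H /IH ->].
by move: H; rewrite /tie_leb bits_eqbE /=; case: a; case: b => //; case: eqP.
Qed.

(* Sorting the columns of [P] extended by [x] leaves the already sorted columns
   of [P] in place and only reorders [x] within blocks of equal columns. *)
Lemma sort_ties n P x : all (fun r => size r == n) P -> size x = n ->
  sorted bits_leb (columns n P) ->
  exists2 c, perm_eq c (iota 0 n)
  & map (shuffle c) P = P /\ ties_sorted [::] false (columns n P) (shuffle c x).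
Proof.
move=> HP sx sP; have sC := size_columns HP.
pose T := zip (columns n P) x; have sT : size T = n by rewrite size_zip sC sx minnn.
have : perm_eq (sort tie_leb T) T by rewrite perm_sort.
case/(perm_iotaP ([::], false)) => c; rewrite sT => pc E; exists c => //.
have sc : size c = n by rewrite (perm_size pc) size_iota.
(* Both sides are sorted for an antisymmetric order and are permutations of each other, hence
   equal. *)
have E1 : unzip1 (sort tie_leb T) = columns n P.
  apply: (sorted_eq bits_leb_trans bits_leb_anti) => //.
    rewrite sorted_map; apply: sub_sorted (sort_sorted tie_leb_total T) => p q; exact: tie_leb_leb.
  by rewrite -[X in perm_eq _ X](@unzip1_zip _ _ _ x) ?sC ?sx // perm_map // perm_sort.
have E2 : unzip2 (sort tie_leb T) = shuffle c x.
  rewrite E /unzip2 -map_comp; apply/eq_in_map => j jc /=.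
  by rewrite nth_zip ?sC ?sx.
split.
  apply/esym/(@shuffle_columns n) => //.
  rewrite -[LHS]E1 E /unzip1 -map_comp; apply/eq_in_map => j jc /=.
  by rewrite nth_zip ?sC ?sx.
(* The initial pair of an empty column and [false] lies below every other pair, so it adds no
   constraint to the sorted list. *)
apply: path_ties_sorted; rewrite -E1 -E2 zip_unzip.
have := sort_sorted tie_leb_total T; case: (sort _ _) => //= [[d b] s] /= ->.
by rewrite andbT /tie_leb /=; case: (d) => //; rewrite implybT.
Qed.

(** Pigeonhole: a list of length [n] that contains [n] distinct numbers has no repetition and no
    other member. *)
Lemma is_perm_perm s n : is_perm s n -> perm_eq s (iota 0 n).
Proof.
case/andP=> /eqP sn /allP H.
have [] := uniq_min_size (iota_uniq 0 n) H; first by rewrite size_iota sn.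
by move=> _ E; apply: uniq_perm; rewrite ?iota_uniq //
  (uniq_size_uniq (iota_uniq 0 n) E) size_iota sn.
Qed.

Lemma mem_parity_words n e x : size x = n -> foldr addb false x = e -> x \in parity_words n e.
Proof.
elim: x n e => [|a x IH] [|n] e //=; first by move=> _ <-.
case=> sx Hx; rewrite mem_cat; case: a Hx => /= Hx.
  by apply/orP; right; apply: map_f; apply: IH => //; rewrite -Hx negbK.
by apply/orP; left; apply: map_f; apply: IH.
Qed.

Lemma mem_foldl_filter U (T : eqType) (p : U -> pred T) (P : seq U) (X : seq T) x :
  x \in X -> all (p^~ x) P -> x \in foldl (fun X r => filter (p r) X) X P.
Proof.
elim: P X => [|r P IH] X xX //= /andP[rx H]; apply: IH => //.
by rewrite mem_filter rx.
Qed.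

End ColumnLists.

(** * Pivots of sign words *)

Section Words.
Local Open Scope ring_scope.

Definition zr (z : Z) : rat := (int_of_Z z)%:~R.

Lemma zrD x y : zr (Z.add x y) = zr x + zr y.
Proof. by rewrite /zr -intrD; congr (_%:~R); lia. Qed.
Lemma zrB x y : zr (Z.sub x y) = zr x - zr y.
Proof. by rewrite /zr -intrB; congr (_%:~R); lia. Qed.
Lemma zrM x y : zr (Z.mul x y) = zr x * zr y.
Proof. by rewrite /zr -intrM; congr (_%:~R); lia. Qed.
Lemma zrX x n : zr (Z.pow x (Z.of_nat n)) = zr x ^+ n.
Proof.
elim: n => [|n IH]; first by rewrite expr0.
by rewrite exprS -IH -zrM; congr zr; rewrite Nat2Z.inj_succ Z.pow_succ_r; lia.
Qed.
Lemma zr_le x y : (zr x <= zr y) = Z.leb x y.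
Proof. rewrite ler_int; lia. Qed.
Lemma zr_lt x y : (zr x < zr y) = Z.ltb x y.
Proof. rewrite ltr_int; lia. Qed.
Lemma zr_small : (zr 0 = 0) * (zr 4 = 4) * (zr 16 = 16) * (zr 44 = 44) * (zr 121 = 121).
Proof. by []. Qed.

Definition vec (x : bits) : 'rV[rat]_11 := \row_j (sgb (nth false x j))%:~R.

Definition ip (x y : bits) : rat := rdot (vec x) (vec y).

Definition ham (x y : bits) : nat := count id (zipw addb x y).

Lemma ham_nthE T (d : T) t x y : ham_nth d t x y = nth d t (ham x y).
Proof.
rewrite /ham; elim: x y t => [|a x IH] [|b y] t //=; try by case: t.
by rewrite IH; case: a; case: b; case: t => //= *; rewrite nth_nil.
Qed.

Lemma ham_le x y : (ham x y <= size x)%N.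
Proof.
apply: leq_trans (count_size _ _) _; rewrite zipwE size_map size_zip; exact: geq_minl.
Qed.

Lemma ipE x y : size x = 11%N -> size y = 11%N -> ip x y = 11 - 2 * (ham x y)%:R.
Proof.
move=> sx sy; have sz : size (zip x y) = 11%N by rewrite size_zip sx sy.
transitivity (\sum_(p <- zip x y) (1 - 2 * (p.1 (+) p.2)%:R : rat)).
  rewrite (big_nth (false, false)) sz big_mkord; apply: eq_bigr => j _.
  rewrite !mxE nth_zip ?sx ?sy //=.
  by case: (nth false x j); case: (nth false y j).
rewrite big_split sumrN -mulr_sumr -natr_sum /ham zipwE count_map -sum1_count /=.
rewrite (big_nth (false, false)) sz big_mkord sumr_const card_ord.
by congr (_ - _ * _%:R); rewrite [RHS]big_mkcond; apply: eq_bigr => p _; case: (_ (+) _).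
Qed.

Lemma inner_ip x y : size x = 11%N -> size y = 11%N -> zr (inner x y) = ip x y.
Proof.
move=> sx sy; rewrite ipE // /inner ham_nthE.
suff H h : (h <= 11)%N -> zr (nth Z0 ip_values h) = 11 - 2 * h%:R by rewrite H // -sx ham_le.
by do 12! (case: h => [//|h]).
Qed.

Lemma ip_diag x : size x = 11%N -> ip x x = 11.
Proof.
move=> sx; rewrite ipE // /ham; have -> : count id (zipw addb x x) = 0%N.
  by elim: x {sx} => //= a x ->; rewrite addbb.
by rewrite mulr0 subr0.
Qed.

Lemma ip_shuffle c x y : perm_eq c (iota 0 11) -> size x = 11%N -> size y = 11%N ->
  ip (shuffle c x) (shuffle c y) = ip x y.
Proof.
move=> pc sx sy; have sc : size c = 11%N by rewrite (perm_size pc) size_iota.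
rewrite !ipE ?size_shuffle // /ham; congr (_ - _ * _%:R).
set w := zipw addb x y.
have sw : size w = 11%N by rewrite /w zipwE size_map size_zip sx sy.
have -> : zipw addb (shuffle c x) (shuffle c y) = [seq nth false w j | j <- c].
  rewrite zipwE /shuffle zip_map -map_comp; apply: eq_map => j /=.
  by rewrite nth_zipw_addb ?sx ?sy.
by rewrite -[in RHS](mkseq_nth false w) sw /mkseq; apply/seq.permP/perm_map.
Qed.

Lemma size_xor f x : size f = 11%N -> size x = 11%N -> size (zipw addb f x) = 11%N.
Proof. by move=> sf sx; rewrite zipwE size_map size_zip sf sx. Qed.

Lemma zipw_addb_cancel f x y : size f = size x -> size f = size y ->
  zipw addb (zipw addb f x) (zipw addb f y) = zipw addb x y.
Proof.
elim: f x y => [|a f IH] [|b x] [|c y] //= [Hx] [Hy]; rewrite IH //.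
by case: a; case: b; case: c.
Qed.

Lemma ip_xor f x y : size f = 11%N -> size x = 11%N -> size y = 11%N ->
  ip (zipw addb f x) (zipw addb f y) = ip x y.
Proof. by move=> sf sx sy; rewrite !ipE ?size_xor // /ham zipw_addb_cancel ?sf. Qed.

Lemma dotZE k v w : (size v <= k)%N ->
  zr (dotZ v w) = \sum_(i < k) zr (nth Z0 v i) * zr (nth Z0 w i).
Proof.
elim: k v w => [|k IH] [|a v] [|b w] //= Hs; rewrite ?big_ord0 //;
  try by rewrite big1 // => i _; rewrite ?nth_nil /zr /= ?mul0r ?mulr0.
by rewrite zrD zrM big_ord_recl /= (IH v w).
Qed.

Lemma dotZC v w : dotZ v w = dotZ w v.
Proof. by elim: v w => [|a v IH] [|b w] //=; rewrite IH Z.mul_comm. Qed.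

Lemma nth_mulvZ A v l : nth Z0 (mulvZ A v) l = dotZ (nth [::] A l) v.
Proof. by elim: A l => [|r A IH] [|l] //=; rewrite IH. Qed.

Lemma form_vec P x y : form ip P x y = form (@rdot _ 11) (map vec P) (vec x) (vec y).
Proof. by apply/esym/(@form_isometry _ _ _ predT) => //; apply/allP. Qed.

(** The inverse Gram matrix yields the coefficients of a combination of the rows with the same inner
    products as [x]; it is the projection of [x], and the pivot is 11 minus its inner product with
    [x]. *)
Lemma form_inverse P q A x :
  all (fun r => size r == 11%N) P -> size x = 11%N -> is_inverse P q A -> zr q != 0 ->
  let v := map (inner x) P in
  form ip P x x = 11 - zr (dotZ v (mulvZ A v)) / zr q.
Proof.
move=> /all_nthP sP sx /allP inv q0 v; set m := size P in sP inv.
have sv : size v = m by rewrite size_map.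
pose p (i : 'I_m) := nth [::] P i; pose a (l i : 'I_m) := zr (nth Z0 (nth [::] A l) i).
pose vv (i : 'I_m) := ip x (p i).
have sp i : size (p i) = 11%N by apply/eqP/sP.
have vE (i : 'I_m) : zr (nth Z0 v i) = vv i.
  by rewrite (nth_map [::]) // inner_ip //; exact: (sp i).
have G (j l : 'I_m) : \sum_i ip (p j) (p i) * a l i = if j == l then zr q else 0.
  have jm (k : 'I_m) : val k \in iota 0 m by rewrite mem_iota add0n ltn_ord.
  have /allP/(_ _ (jm l))/Z.eqb_eq/(congr1 zr) := inv _ (jm j).
  rewrite (@dotZE m) ?size_map // -val_eqE /= => E.
  transitivity (zr (if val j == val l then q else Z0)); last by case: eqP.
  rewrite -E; apply: eq_bigr => i _; congr (_ * _).
  by rewrite (nth_map [::]) // inner_ip //; [exact: (sp j)|exact: (sp i)].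
(* The coefficients of the projection, solving the normal equations [Gw]. The transposed index order
   matches the form of [is_inverse], so no symmetry of [A] is required. *)
pose w (i : 'I_m) := (\sum_l a l i * vv l) / zr q.
have Gw j : \sum_i ip (p j) (p i) * w i = vv j.
  under eq_bigr => i _ do rewrite mulrA mulr_sumr.
  rewrite -mulr_suml exchange_big /=; apply: (canLR (mulfK q0)).
  transitivity (\sum_l vv l * \sum_i ip (p j) (p i) * a l i).
    by apply: eq_bigr => l _; rewrite mulr_sumr; apply: eq_bigr => i _; ring.
  rewrite (bigD1 j) //= G eqxx big1 ?addr0 // => l lj.
  by rewrite G eq_sym (negbTE lj) mulr0.
pose u := \sum_i w i *: vec (p i).
have dotu y : rdot u y = \sum_i w i * rdot (vec (p i)) y.
  rewrite /u; elim/big_rec2: _ => [|i s t _ <-]; first by rewrite (b_0 (@rdot_lin _ _)).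
  exact: rdot_lin.
have proj : is_projection (@rdot _ 11) (map vec P) (vec x) u.
  split=> [_ /mapP[r rP ->]|z Hz].
    have jm : (index r P < m)%N by rewrite index_mem.
    have -> : r = p (Ordinal jm) by rewrite /p /= nth_index.
    rewrite (b_B (@rdot_lin _ _)) dotu -[X in X - _]/(vv _) -Gw; apply/eqP.
    rewrite subr_eq0; apply/eqP/eq_bigr => i _; rewrite mulrC; congr (_ * _); exact: rdot_sym.
  rewrite rdot_sym dotu big1 // => i _; rewrite rdot_sym Hz ?mulr0 //.
  by apply: map_f; rewrite mem_nth.
rewrite form_vec (formE (@rdot_lin _ _) (@rdot_sym _ _) (@rdot_def _ _) _ proj).
rewrite (b_B (@rdot_lin _ _)) dotu -[X in X - _]/(ip x x) ip_diag //; congr (_ - _).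
transitivity ((\sum_i \sum_l a l i * vv l * vv i) / zr q).
  rewrite mulr_suml; apply: eq_bigr => i _.
  by rewrite [rdot _ _]rdot_sym -/(ip x (p i)) -/(vv i) /w mulrAC; congr (_ / _); rewrite mulr_suml.
rewrite exchange_big /= (@dotZE m) ?sv //; congr (_ / _); apply: eq_bigr => l _.
rewrite vE nth_mulvZ dotZC (@dotZE m) ?sv // mulr_sumr; apply: eq_bigr => i _.
by rewrite vE -/(a l i); ring.
Qed.

Lemma form_words_eq_mem P P' x y : P =i P' -> form ip P x y = form ip P' x y.
Proof.
move=> E; rewrite !form_vec; apply: (form_eq_mem (@rdot_lin _ _) (@rdot_sym _ _) (@rdot_def _ _)).
exact: eq_mem_map.
Qed.

Lemma form_words_ge0 P x : 0 <= form ip P x x.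
Proof.
by rewrite form_vec;
  apply: (form_ge0 (@rdot_lin _ _) (@rdot_sym _ _) (@rdot_ge0 _ _) (@rdot_def _ _)).
Qed.

Lemma form_words_rcons_le P a x : form ip (rcons P a) x x <= form ip P x x.
Proof.
by rewrite !form_vec map_rcons;
   apply: (form_rcons_le (@rdot_lin _ _) (@rdot_sym _ _) (@rdot_ge0 _ _) (@rdot_def _ _)).
Qed.

Lemma form_words_le_single P r x : size r = 11%N -> size x = 11%N -> r \in P ->
  form ip P x x <= 11 - ip r x ^+ 2 / 11.
Proof.
move=> sr sx rP; rewrite form_vec -{1}(ip_diag sx) -(ip_diag sr) /ip (rdot_sym (vec r)).
apply: (form_le_single (@rdot_lin _ _) (@rdot_sym _ _) (@rdot_ge0 _ _) (@rdot_def _ _)).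
exact: map_f.
Qed.

Lemma chain_vec P : chain ip P = chain (@rdot _ 11) (map vec P).
Proof. by apply/esym/(@chain_isometry _ _ _ predT) => //; apply/allP. Qed.

Lemma chain_words_perm P P' : perm_eq P P' -> chain ip P = chain ip P'.
Proof.
move=> E; rewrite !chain_vec; apply: (chain_perm (@rdot_lin _ _) (@rdot_sym _ _) (@rdot_def _ _)).
exact: perm_map.
Qed.

Lemma chain_words_le P S p : (forall y, y \in S -> form ip P y y <= p) ->
  chain (form ip P) S <= p ^+ size S.
Proof.
move=> H; have -> : chain (form ip P) S = chain (form (@rdot _ 11) (map vec P)) (map vec S).
  apply/esym/(@chain_isometry _ _ _ predT); last exact/allP.
  by move=> x y _ _; rewrite form_vec.
rewrite -(size_map vec S).
apply: (chain_le (@rdot_lin _ _) (@rdot_sym _ _) (@rdot_ge0 _ _) (@rdot_def _ _)).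
by move=> _ /mapP[y yS ->]; rewrite -form_vec; apply: H.
Qed.

Lemma sqr_det_words B : size B = 11%N ->
  \det (sign_mx 11 B) != 0 \/ chain ip B != 0 ->
  ((\det (sign_mx 11 B))%:~R : rat) ^+ 2 = chain ip B.
Proof.
move=> sB; pose A : 'M[rat]_11 := map_mx intr (sign_mx 11 B).
have -> : (\det (sign_mx 11 B))%:~R = \det A :> rat by rewrite det_map_mx.
have E : map vec B = [seq row i A | i <- enum 'I_11].
  apply: (@eq_from_nth _ 0) => [|i]; first by rewrite size_map sB size_map size_enum_ord.
  rewrite size_map sB => Hi.
  rewrite (nth_map [::]) ?sB // (nth_map ord0) ?size_enum_ord //.
  by apply/rowP => j; rewrite !mxE nth_enum_ord.
rewrite chain_vec E => H; apply: sqr_det_chain; case: H => H; [left|by right].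
by rewrite det_map_mx intr_eq0.
Qed.

End Words.

(** * Soundness of the search *)

Section NodeSoundness.
Local Open Scope ring_scope.
Local Opaque zr parity_words sign_mx ip.

(** If [d * p <= 4 * b], then raising to the power [k.+1] and multiplying the determinant bound by
    [d ^+ k] makes [d ^+ k * K * 4 ^+ k.+1] smaller than itself. *)
Lemma pruning_bound (F : realFieldType) (K d p b : F) k :
  0 < d -> 0 <= p -> 0 <= b -> K * 4 ^+ k.+1 <= d * p ^+ k.+1 ->
  b ^+ k.+1 < K * d ^+ k -> 4 * b < d * p.
Proof.
move=> d0 p0 b0 Kp bK; rewrite ltNge; apply/negP => le_b.
have le1 : (d * p) ^+ k.+1 <= (4 * b) ^+ k.+1.
  by rewrite lerXn2r ?nnegrE ?mulr_ge0 // ltW.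
have lt2 : 4 ^+ k.+1 * b ^+ k.+1 < 4 ^+ k.+1 * (K * d ^+ k) by rewrite ltr_pM2l ?exprn_gt0.
have le3 : d ^+ k * (K * 4 ^+ k.+1) <= d ^+ k * (d * p ^+ k.+1) by rewrite ler_pM2l ?exprn_gt0.
suff : d ^+ k * (K * 4 ^+ k.+1) < d ^+ k * (K * 4 ^+ k.+1) by rewrite ltxx.
apply: le_lt_trans le3 _; rewrite mulrA -exprSr -exprMn.
have -> : d ^+ k * (K * 4 ^+ k.+1) = 4 ^+ k.+1 * (K * d ^+ k) by ring.
by apply: le_lt_trans lt2; rewrite -exprMn.
Qed.

Lemma foldr_addb_count x : foldr addb false x = odd (count id x).
Proof. by elim: x => //= a x ->; rewrite oddD oddb. Qed.

Lemma even_shuffle c x : perm_eq c (iota 0 11) -> even_word x -> even_word (shuffle c x).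
Proof.
move=> pc /andP[/eqP sx ex]; rewrite /even_word size_shuffle (perm_size pc) size_iota eqxx /=.
rewrite foldr_addb_count; suff /seq.permP-> : perm_eq (shuffle c x) x by rewrite -foldr_addb_count.
by rewrite -[X in perm_eq _ X](mkseq_nth false x) sx; apply: perm_map.
Qed.

Lemma even_xor f x : even_word f -> even_word x -> even_word (zipw addb f x).
Proof.
move=> /andP[/eqP sf ef] /andP[/eqP sx ex]; rewrite /even_word size_xor //= .
suff -> : foldr addb false (zipw addb f x) = foldr addb false f (+) foldr addb false x.
  by move: ef ex; case: (foldr _ _ f); case: (foldr _ _ x).
have {ef ex sf sx} := etrans sf (esym sx).
elim: f x => [|a f IH] [|b x] //= [H]; rewrite IH //.
by case: a; case: b; case: (foldr _ _ f); case: (foldr _ _ x).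
Qed.

Lemma even_size x : even_word x -> size x = 11%N.
Proof. by case/andP=> /eqP. Qed.

Lemma all_even_size P : all even_word P -> all (fun r => size r == 11%N) P.
Proof. by apply: sub_all => x /even_size ->. Qed.

(* The bound stays abstract: automation would expand its unary numeral. *)
Variable dmax : int.
Hypothesis dmax_gt0 : 0 < dmax.
Hypothesis sqr_dmax_le : forall D : int, dmax <= `|D| -> 4 ^+ 10 * zr 102400 <= (D%:~R : rat) ^+ 2.

Definition big_det (B : seq bits) :=
  [/\ size B = 11%N, all even_word B & dmax <= `|\det (sign_mx 11 B)|].

Lemma big_det_equiv B B' : big_det B -> size B' = 11%N -> all even_word B' ->
  hadamard_equiv (sign_mx 11 B) (sign_mx 11 B') -> big_det B'.
Proof. by move=> [_ _ d] s' e' /equiv_norm_det E; split;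
  [exact: s'|exact: e'|rewrite -E; exact: d]. Qed.

Lemma big_det_chain B : big_det B -> 4 ^+ 10 * zr 102400 <= chain ip B.
Proof.
case=> sB _ d.
have dn : \det (sign_mx 11 B) != 0 by rewrite -normr_gt0; apply: lt_le_trans dmax_gt0 d.
by rewrite -(sqr_det_words sB (or_introl dn)); apply: sqr_dmax_le.
Qed.

Variable L : seq (seq bits).

Definition reaches B := exists2 R, R \in L & hadamard_equiv (sign_mx 11 B) (sign_mx 11 R).

Lemma reaches_equiv B B' : hadamard_equiv (sign_mx 11 B) (sign_mx 11 B') -> reaches B' -> reaches B.
Proof.
move=> E [R RL E'].
exists R.
exact: RL.
exact (Relation_Operators.rt_trans _ _ _ _ _ E E').
Qed.

(** The invariant passed from each table back to the previous one. The last hypothesis is the cap on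
    the pivots of the remaining rows, with its denominator cleared. *)
Definition node_sound (nd : node) :=
  forall S, big_det (rows nd ++ S) ->
  chain ip (rows nd) = 4 ^+ (size (rows nd)).-1 * zr (vol nd) ->
  (forall y, y \in S -> form ip (rows nd) y y * zr (parent_vol nd) <= 4 * zr (vol nd)) ->
  reaches (rows nd ++ S).

Lemma seq_argmax (T : eqType) (F : realDomainType) (f : T -> F) s : s != [::] ->
  exists2 x, x \in s & forall y, y \in s -> f y <= f x.
Proof.
elim: s => // a [|b s] IH _.
  by exists a => [|y]; rewrite ?mem_head // mem_seq1 => /eqP->.
have [x xs H] := IH isT; have [ax|xa] := leP (f a) (f x).
  exists x; first by rewrite inE xs orbT.
  by move=> y; rewrite inE => /predU1P[->|/H].
exists a; first exact: mem_head.
move=> y; rewrite inE => /predU1P[->|/H yx]; first exact: lexx.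
exact: le_trans yx (ltW xa).
Qed.

(** This and the next lemmas translate the integer tests of the checker, which work with c = 4 d p,
    into statements on the pivot p. *)
Lemma scaled_pivot (F : realFieldType) (d s p : F) : 0 < d -> p = 11 - s / (4 * d) ->
  44 * d - s = 4 * d * p.
Proof.
move=> /lt0r_neq0 nd ->; have d0 : 4 * d != 0 by rewrite mulf_neq0 ?pnatr_eq0.
by rewrite mulrBr [_ * (s / _)]mulrC divfK //; ring.
Qed.

Lemma scaled_parent (F : realFieldType) (d e p : F) : 0 < d -> p * e <= 4 * d ->
  4 * d * p * e <= 16 * (d * d).
Proof. by move=> d0 H; have := ler_wpM2l (ltW d0) H; lra. Qed.

Lemma filter_bound (F : realFieldType) (b d p v : F) : 0 < d -> 4 * b < d * p ->
  p <= 11 - v ^+ 2 / 11 -> 44 * b < d * (121 - v ^+ 2).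
Proof. by move=> d0 H1 H2; have := ler_wpM2l (ltW d0) H2; lra. Qed.

Lemma scaled_low (F : realFieldType) (b d p : F) : 4 * b < d * p -> 16 * b < 4 * d * p.
Proof. by move=> H; lra. Qed.

Lemma scaled_volume (F : realFieldType) (d p w : F) : 4 * d * p = 16 * w -> d * p = 4 * w.
Proof. by move=> H; lra. Qed.

Lemma cancel_power_four (F : realFieldType) (K d p c : F) m k : 0 < d -> c <= p ^+ k ->
  4 ^+ (m + k) * K <= 4 ^+ m * d * c -> K * 4 ^+ k <= d * p ^+ k.
Proof.
move=> d0 cp; rewrite exprD -!mulrA ler_pM2l ?exprn_gt0 // mulrC => /le_trans; apply.
by rewrite ler_pM2l.
Qed.

(** The exponent 10 splits into [(size P).-1], which cancels against the Gram determinant of [P],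
    and the number of rows still to be placed. *)
Lemma pivot_bound P x S d : big_det (P ++ x :: S) ->
  chain ip P = 4 ^+ (size P).-1 * d -> (0 < size P)%N -> 0 < d ->
  (forall y, y \in S -> form ip P y y <= form ip P x x) ->
  zr 102400 * 4 ^+ (size S).+1 <= d * form ip P x x ^+ (size S).+1.
Proof.
move=> bigB cP P0 d0 H; have [sB _ _] := bigB.
have := big_det_chain bigB; rewrite chain_cat cP.
have H' y : y \in x :: S -> form ip P y y <= form ip P x x by case/predU1P=> [->|/H].
have {H'} := chain_words_le H'; rewrite [size (_ :: _)]/= => le1.
have -> : 10%N = ((size P).-1 + (size S).+1)%N.
  by move: sB P0; rewrite size_cat /=; lia.
exact: cancel_power_four.
Qed.

(** A candidate that passes both tests must have consumed an edge when its turn came. *)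
Lemma edges_ok_sound tbl P d e b A X es x : edges_ok tbl P d e b A X es -> x \in X ->
  let v := map (inner x) P in
  let c := Z.sub (Z.mul 44 d) (dotZ v (mulvZ A v)) in
  Z.leb c (Z.mul 16 b) = false -> Z.ltb (Z.mul 16 (Z.mul d d)) (Z.mul c e) = false ->
  exists f, edge_ok tbl P d x c f.
Proof.
elim: X es => //= a X IH es H; rewrite inE => /predU1P[->|xX] /= l1 l2; move: H.
  by rewrite l1 l2; case: es => // f es; case E: edge_ok => // _; exists f.
by case: ifP => [_ /IH|_]; [exact|case: ifP => [_ /IH|_]; [exact|]];
   case: es => // f es; case: ifP => // _ /IH; exact.
Qed.

Lemma candidate_mem P d b x :
  x \in parity_words 11 false -> size x = 11%N -> all (fun r => size r == 11%N) P ->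
  (forall r, r \in P -> 44 * zr b < zr d * (121 - ip r x ^+ 2)) ->
  x \in candidates P d b (parity_words 11 false).
Proof.
move=> xX sx sP H; apply: mem_foldl_filter => //; apply/allP => r rP.
have sr : size r = 11%N by apply/eqP/(allP sP).
rewrite ham_nthE (nth_map Z0) ?ltnS -?sr ?ham_le //.
move: (H r rP); rewrite -(inner_ip sr sx) /inner ham_nthE; set v := nth _ _ _.
rewrite -zr_lt !(zrM, zrB) !zr_small expr2; exact.
Qed.

(** The moves that turn [rcons P x] into the rows of the child are applied to the remaining rows as
    well. They preserve inner products, so determinant, volume and pivot cap carry over, and the
    soundness of the child applies. *)
Lemma edge_reaches tbl P d x c f S : edge_ok tbl P d x c f ->
  (0 < size P)%N -> 0 < zr d -> big_det (P ++ x :: S) ->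
  chain ip P = 4 ^+ (size P).-1 * zr d -> zr c = 4 * zr d * form ip P x x ->
  (forall y, y \in S -> form ip P y y <= form ip P x x) ->
  (forall i, (i < size tbl)%N -> node_sound (nth node0 tbl i)) ->
  reaches (P ++ x :: S).
Proof.
case: f => s i; rewrite /edge_ok; set nd := nth _ _ _; set Q := rcons P x.
case/and5P=> i_lt /eqP sizeQ eR pv_gt0 /andP[/Z.eqb_eq cE /andP[pv_le /andP[perm_s cols_eq]]].
move=> P0 d_gt0 bigB cP ccE p_max /(_ _ i_lt); rewrite -/nd => sound {i_lt}.
rewrite lbits_eqbE in cols_eq; move/eqP in cols_eq.
have {}perm_s := is_perm_perm perm_s.
have vE : zr d * form ip P x x = 4 * zr (vol nd).
  by apply: scaled_volume; rewrite -ccE cE zrM zr_small.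
have pv_ge0 : 0 <= zr (parent_vol nd).
  by rewrite -zr_small zr_le; apply/Z.leb_le; move/Z.ltb_lt: pv_gt0; lia.
have {}pv_le : zr (parent_vol nd) <= zr d by rewrite zr_le.
have [sB eB _] := bigB; move: (eB); rewrite all_cat /= => /and3P[eP ex eS].
pose Qs := map (nth [::] Q) s; pose f0 := head [::] Qs.
have eQ : all even_word Q by rewrite all_rcons ex eP.
have {perm_s} pQ : perm_eq Qs Q by rewrite -[X in perm_eq _ X](mkseq_nth [::]); apply: perm_map.
have sQs : size Qs = (size P).+1 by rewrite (perm_size pQ) size_rcons.
have eQs : all even_word Qs by rewrite (perm_all _ pQ).
have ef0 : even_word f0.
  by rewrite /f0; case: (Qs) sQs eQs => //= r Qs' _ /andP[].
pose C := map (zipw addb f0) Qs.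
have eC : all even_word C.
  by apply/allP => _ /mapP[r rQ ->]; apply: even_xor ef0 _; apply: (allP eQs).
have sC : size C = size (rows nd) by rewrite size_map (perm_size pQ) sizeQ.
have pcols : perm_eq (columns 11 (rows nd)) (columns 11 C).
  by rewrite -cols_eq; apply: sort_bits_perm.
have [c2 pc2 rowsE] := perm_columns (all_even_size eC) (all_even_size eR) sC pcols.
(* One isometry, negating columns by [f0] and then permuting them, acts on chosen and remaining rows
   alike. *)
pose g r := shuffle c2 (zipw addb f0 r).
have {}rowsE : rows nd = map g Qs by rewrite rowsE /C -map_comp.
have even_g r : even_word r -> even_word (g r).
  by move=> er; apply: even_shuffle pc2 _; apply: even_xor.
have ip_g r r' : size r == 11%N -> size r' == 11%N -> ip (g r) (g r') = ip r r'.
  move=> /eqP sr /eqP sr'; have sf0 := even_size ef0.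
  by rewrite /g ip_shuffle ?size_xor // ip_xor.
have sQsz := all_even_size eQs.
pose S5 := map g S.
have eq5 : hadamard_equiv (sign_mx 11 (P ++ x :: S)) (sign_mx 11 (rows nd ++ S5)).
  have pB : perm_eq (Qs ++ S) (P ++ x :: S) by rewrite -cat_rcons perm_cat2r.
  apply: Relation_Operators.rt_trans (equiv_perm_rows sB pB) _.
  have sB2 : size (Qs ++ S) = 11%N by rewrite (perm_size pB).
  have eB2 : all even_word (Qs ++ S) by rewrite all_cat eQs eS.
  apply: Relation_Operators.rt_trans (equiv_xor (even_size ef0) sB2 (all_even_size eB2)) _.
  have -> : rows nd ++ S5 = map (shuffle c2) (map (zipw addb f0) (Qs ++ S)).
    by rewrite rowsE -map_cat -map_comp.
  by apply: equiv_shuffle pc2; rewrite size_map.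
have s5 : size (rows nd ++ S5) = 11%N.
  by rewrite rowsE -map_cat size_map size_cat sQs -sB size_cat /= addSnnS.
have e5 : all even_word (rows nd ++ S5).
  rewrite all_cat eR; apply/allP => _ /mapP[r rS ->].
  exact: (even_g _ (allP eS _ rS)).
have big5 := big_det_equiv bigB s5 e5 eq5.
apply: (reaches_equiv eq5).
apply: (sound S5 big5).
  rewrite rowsE (chain_isometry (D := fun r => size r == 11%N) ip_g sQsz).
  rewrite (chain_words_perm pQ) chain_rcons cP size_map sQs.
  by rewrite -mulrA vE -(prednK P0) exprSr -mulrA.
move=> _ /mapP[z zS ->]; rewrite rowsE.
have sz := all_even_size eS.
rewrite (form_isometry (D := fun r => size r == 11%N) ip_g sQsz (allP sz _ zS) (allP sz _ zS)).
(* After the choice of [x] the pivot of a remaining row is at most its pivot over [P], hence at most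
   that of [x]; together with [parent_vol nd <= d] this is the cap of the child. *)
rewrite (form_words_eq_mem _ _ (perm_mem pQ)) -vE mulrC.
have le_z := le_trans (form_words_rcons_le P x z) (p_max z zS).
apply: ler_pM; [exact: pv_ge0 | exact: form_words_ge0 | exact: pv_le | exact: le_z].
Qed.

(** The remaining row of largest pivot, once normalised by column permutations that fix the node, is
    among the candidates and passes both tests, so some verified edge leads on. *)
Lemma node_step tbl nd es : node_ok tbl (parity_words 11 false) nd es ->
  (forall i, (i < size tbl)%N -> node_sound (nth node0 tbl i)) ->
  node_sound nd.
Proof.
case: nd => P d e b; rewrite /node_ok.
case: gram_inverse => q A /andP[P0 /andP[P11 /andP[d0 /andP[e0 /andP[b0 /andP[powb
  /andP[/Z.eqb_eq qE /andP[sortP /andP[inv edges]]]]]]]]] sound S /= bigB cP dS.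
have [sB eB _] := bigB; move: (eB); rewrite all_cat => /andP[eP eS].
have sP := all_even_size eP.
have sPS : (size P + size S = 11)%N by rewrite -size_cat.
have S0 : S != [::] by case: (S) sPS => // /eqP; rewrite addn0 (ltn_eqF P11).
(* The greedy choice: all other remaining rows have a pivot no larger than that of [x]. *)
have [x xS max_x] := seq_argmax (fun y => form ip P y y) S0.
have ex : even_word x by apply: (allP eS).
have pS := perm_to_rem xS; set S' := rem x S in pS.
have eS' : all even_word S' by apply/allP => y /mem_rem; apply: (allP eS).
(* The permutation [c] only moves columns on which [P] agrees. It breaks the remaining symmetry, so
   that one normalised word stands for all words obtained from [x] in this way. *)
have [c pc [cPP tx]] := sort_ties sP (even_size ex) sortP.
pose x0 := shuffle c x; pose S2 := map (shuffle c) S'.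
have ex0 : even_word x0 by apply: even_shuffle.
have sx0 := even_size ex0.
have eS2 : all even_word S2 by apply/allP => _ /mapP[y yS ->]; apply/even_shuffle/(allP eS').
have formc y : even_word y -> form ip P (shuffle c y) (shuffle c y) = form ip P y y.
  move=> /even_size sy; rewrite -{1}cPP.
  apply: (@form_isometry _ _ _ (fun r => size r == 11%N)) => //; try exact/eqP.
  by move=> u v /eqP su /eqP sv; apply: ip_shuffle.
have px : form ip P x0 x0 = form ip P x x by apply: formc.
set p := form ip P x0 x0 in px.
have p_max y : y \in S2 -> form ip P y y <= p.
  by case/mapP=> z zS' ->; rewrite formc ?(allP eS') // px; apply/max_x/(mem_rem zS').
have eq2 : hadamard_equiv (sign_mx 11 (P ++ S)) (sign_mx 11 (P ++ x0 :: S2)).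
  have pB : perm_eq (P ++ x :: S') (P ++ S) by rewrite perm_cat2l perm_sym.
  apply: Relation_Operators.rt_trans (equiv_perm_rows sB pB) _.
  have -> : P ++ x0 :: S2 = map (shuffle c) (P ++ x :: S') by rewrite map_cat cPP.
  by apply: equiv_shuffle => //; rewrite (perm_size pB).
have e2 : all even_word (P ++ x0 :: S2) by rewrite all_cat eP /= ex0.
have s2 : size (P ++ x0 :: S2) = 11%N.
  by rewrite size_cat /= size_map -sPS (perm_size pS).
have big2 := big_det_equiv bigB s2 e2 eq2.
have d_gt0 : 0 < zr d by rewrite -zr_small zr_lt.
have e_gt0 : 0 < zr e by rewrite -zr_small zr_lt.
have p_ge0 : 0 <= p by apply: form_words_ge0.
have bound := pivot_bound big2 cP P0 d_gt0 p_max; rewrite -/p in bound.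
have kE : (11 - size P = (size S2).+1)%N by rewrite -sPS addKn (perm_size pS) /= size_map.
pose v := map (inner x0) P.
pose cc := Z.sub (Z.mul 44 d) (dotZ v (mulvZ A v)).
have q0 : zr q = 4 * zr d by rewrite qE zrM zr_small.
have ccE : zr cc = 4 * zr d * p.
  have nq : zr q != 0 by rewrite q0 mulf_eq0 negb_or pnatr_eq0; exact: lt0r_neq0 d_gt0.
  have pE := form_inverse sP sx0 inv nq.
  rewrite /cc zrB zrM zr_small.
  apply: (scaled_pivot d_gt0).
  rewrite -q0; exact: pE.
have b_ge0 : 0 <= zr b by rewrite -zr_small zr_le.
rewrite kE -zr_lt zrM !zrX in powb.
(* Since the child has volume d p / 4, this says that its volume exceeds [b]. *)
have low := pruning_bound d_gt0 p_ge0 b_ge0 bound powb.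
have high : zr cc * zr e <= 16 * (zr d * zr d).
  by have := dS x xS; rewrite -px ccE; apply: (scaled_parent d_gt0).
have x0cand : x0 \in filter (ties_sorted [::] false (columns 11 P))
                        (candidates P d b (parity_words 11 false)).
  rewrite mem_filter tx; apply: (candidate_mem _ sx0 sP).
    exact: (mem_parity_words sx0 (negbTE (proj2 (andP ex0)))).
  move=> r rP; apply: (filter_bound d_gt0 low).
  by apply: (form_words_le_single _ sx0 rP); apply/eqP/(allP sP).
have [||f f_ok] := edges_ok_sound edges x0cand; rewrite -/v -/cc.
- by apply/negbTE; rewrite -zr_le zrM ccE zr_small -ltNge; apply: scaled_low.
- by apply/negbTE; rewrite -zr_lt !zrM zr_small -leNgt; exact: high.
apply: (reaches_equiv eq2).
exact: (edge_reaches f_ok P0 d_gt0 big2 cP ccE p_max sound).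
Qed.

End NodeSoundness.

(** * The search graph *)

(** The value 4 of [parent_vol] makes the initial cap 4 * 11 / 4 = 11, the squared norm of every
    row, so that it holds trivially. *)
Definition table1 : seq node := [::
  mkn [::] 11 4 27].

Definition edges1 : seq (seq edge) := [::
  [:: mke 0x110 0; mke 0x110 1]].

Definition table2 : seq node := [::
  mkn [:: 3968]%positive 28 11 69;
  mkn [:: 4064]%positive 30 11 74].

(** An empty list marks a dead end: no candidate for this node passes the pivot tests. *)
Definition edges2 : seq (seq edge) := [::
  [::];
  [:: mke 0x1120 0; mke 0x1021 0; mke 0x1210 1]].

Definition table3 : seq node := [::
  mkn [:: 3968; 3704]%positive 76 30 187;
  mkn [:: 4064; 3868]%positive 81 30 197].

Definition edges3 : seq (seq edge) := [::
  [:: mke 0x13210 0; mke 0x13210 1; mke 0x13210 3];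
  [:: mke 0x12130 2; mke 0x12031 2; mke 0x11032 2; mke 0x13210 6; mke 0x12130 4; mke 0x12031
    4; mke 0x11032 4; mke 0x13210 7; mke 0x12130 5; mke 0x12031 5; mke 0x11032 5; mke 0x13210 8]].

Definition table4 : seq node := [::
  mkn [:: 3968; 3704; 2552]%positive 192 76 470;
  mkn [:: 3968; 3704; 3444]%positive 192 76 470;
  mkn [:: 3968; 3704; 2548]%positive 204 81 495;
  mkn [:: 3968; 3704; 3686]%positive 192 76 470;
  mkn [:: 3968; 3704; 3430]%positive 204 81 495;
  mkn [:: 3968; 3704; 3655]%positive 204 81 495;
  mkn [:: 4064; 3868; 2300]%positive 216 81 520;
  mkn [:: 4064; 3868; 3290]%positive 216 81 520;
  mkn [:: 4064; 3868; 3731]%positive 216 81 520].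

Definition edges4 : seq (seq edge) := [::
  [::];
  [::];
  [:: mke 0x134210 1; mke 0x143210 3; mke 0x142310 3; mke 0x124310 1];
  [::];
  [:: mke 0x134210 0; mke 0x132410 1; mke 0x123410 1; mke 0x131042 1; mke 0x130142 1; mke
    0x124310 0; mke 0x121043 1; mke 0x120143 1; mke 0x110342 3; mke 0x110243 3; mke 0x134210 2;
    mke 0x134201 2; mke 0x131042 2; mke 0x124310 2; mke 0x124301 2; mke 0x134210 6; mke 0x124310
    6; mke 0x121043 2];
  [:: mke 0x131024 2; mke 0x121034 2];
  [:: mke 0x132140 7; mke 0x132041 7; mke 0x131042 7; mke 0x121043 7];
  [:: mke 0x132140 4; mke 0x132041 4; mke 0x131042 4; mke 0x121034 7; mke 0x123140 4; mke
    0x123041 4; mke 0x131024 7; mke 0x121043 4; mke 0x113240 4; mke 0x132014 7; mke 0x132104 7;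
    mke 0x103241 4; mke 0x113042 4; mke 0x112043 4; mke 0x103142 4; mke 0x102143 4; mke 0x143210
    10; mke 0x132140 8; mke 0x132041 9; mke 0x132140 9; mke 0x132041 8; mke 0x131042 9; mke
    0x121043 9; mke 0x130142 9; mke 0x120143 9; mke 0x143210 11; mke 0x131240 9; mke 0x130241 9;
    mke 0x131042 8; mke 0x110243 9; mke 0x143120 11; mke 0x143021 11; mke 0x121340 9; mke
    0x120341 9; mke 0x110342 9; mke 0x121043 8; mke 0x142130 11; mke 0x142031 11; mke 0x141032
    11];
  [:: mke 0x132140 5; mke 0x132041 5; mke 0x131042 5; mke 0x123140 5; mke 0x123041 5; mke
    0x113240 5; mke 0x132104 8; mke 0x132014 8; mke 0x103241 5; mke 0x131024 8; mke 0x121034 8;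
    mke 0x132140 11; mke 0x132041 11; mke 0x113042 5; mke 0x103142 5; mke 0x131042 11; mke
    0x121043 5; mke 0x112043 5; mke 0x102143 5; mke 0x121043 11]].

Definition table5 : seq node := [::
  mkn [:: 3968; 3704; 2552; 3430]%positive 512 204 1238;
  mkn [:: 3968; 3704; 3444; 2538]%positive 512 204 1238;
  mkn [:: 3968; 3704; 3444; 2915]%positive 512 204 1238;
  mkn [:: 3968; 3704; 2548; 2538]%positive 512 204 1238;
  mkn [:: 3968; 3704; 2548; 3406]%positive 540 216 1294;
  mkn [:: 3968; 3704; 2548; 3427]%positive 540 216 1294;
  mkn [:: 3968; 3704; 3686; 3413]%positive 512 204 1238;
  mkn [:: 3968; 3704; 3430; 2846]%positive 540 216 1294;
  mkn [:: 3968; 3704; 3430; 2901]%positive 540 216 1294;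
  mkn [:: 3968; 3704; 3430; 3357]%positive 540 216 1294;
  mkn [:: 4064; 3868; 3290; 2742]%positive 567 216 1348;
  mkn [:: 4064; 3868; 3290; 2745]%positive 567 216 1348].

Definition edges5 : seq (seq edge) := [::
  [:: mke 0x1543210 21; mke 0x1543210 22; mke 0x1542310 22; mke 0x1543210 24; mke 0x1543210
    26; mke 0x1542310 26; mke 0x1543210 28];
  [:: mke 0x1105432 22; mke 0x1543210 32; mke 0x1325410 32; mke 0x1543210 34; mke 0x1543210
    37; mke 0x1325410 37; mke 0x1543210 39];
  [:: mke 0x1453210 37; mke 0x1452310 37; mke 0x1451032 39; mke 0x1325410 26; mke 0x1321054
    37; mke 0x1231054 37];
  [:: mke 0x1104352 24; mke 0x1435210 34];
  [:: mke 0x1324510 0; mke 0x1324510 1; mke 0x1432510 5; mke 0x1423510 5; mke 0x1342510 11;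
    mke 0x1342501 11; mke 0x1435210 31; mke 0x1435210 33; mke 0x1435201 33; mke 0x1453210 43;
    mke 0x1243510 11; mke 0x1243501 11; mke 0x1425310 31; mke 0x1452310 43; mke 0x1425301 33;
    mke 0x1425310 33; mke 0x1325410 23; mke 0x1321054 31; mke 0x1231054 31; mke 0x1432510 7; mke
    0x1423510 7; mke 0x1432510 8; mke 0x1432510 17; mke 0x1432501 17; mke 0x1432510 18; mke
    0x1432501 18; mke 0x1435210 38; mke 0x1435201 38; mke 0x1453210 44; mke 0x1435210 40; mke
    0x1423510 17; mke 0x1423501 17; mke 0x1423510 18; mke 0x1423501 18; mke 0x1452310 44; mke
    0x1425301 38; mke 0x1425310 38; mke 0x1425310 40; mke 0x1325410 41; mke 0x1235410 41; mke
    0x1543210 47; mke 0x1543210 49];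
  [:: mke 0x1432510 4; mke 0x1324510 2; mke 0x1432510 6; mke 0x1423510 6; mke 0x1342510 14;
    mke 0x1342501 14; mke 0x1435210 35; mke 0x1432510 16; mke 0x1432501 16; mke 0x1435210 36;
    mke 0x1435201 36; mke 0x1435210 44; mke 0x1243510 14; mke 0x1243501 14; mke 0x1425310 35;
    mke 0x1423510 16; mke 0x1423501 16; mke 0x1425310 44; mke 0x1425301 36; mke 0x1425310 36;
    mke 0x1453210 49; mke 0x1325410 27; mke 0x1321054 35; mke 0x1231054 35];
  [:: mke 0x1324510 34; mke 0x1104532 34; mke 0x1325410 28; mke 0x1321054 34; mke 0x1320154
    34; mke 0x1321054 39; mke 0x1320154 39; mke 0x1103254 34; mke 0x1231054 39; mke 0x1230154
    39; mke 0x1102354 34; mke 0x1105432 28];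
  [:: mke 0x1432051 1; mke 0x1435210 25; mke 0x1423051 1; mke 0x1324051 1; mke 0x1432510 10;
    mke 0x1432501 33; mke 0x1423501 33; mke 0x1342501 33; mke 0x1324501 33; mke 0x1425310 25;
    mke 0x1243501 33; mke 0x1234501 33; mke 0x1325410 25; mke 0x1432510 9; mke 0x1342510 9; mke
    0x1432510 19; mke 0x1435210 42; mke 0x1345210 42; mke 0x1243510 9; mke 0x1423510 19; mke
    0x1425310 42; mke 0x1324510 19; mke 0x1435210 52; mke 0x1425310 52; mke 0x1325410 52; mke
    0x1325410 42; mke 0x1245310 42; mke 0x1235410 42];
  [:: mke 0x1432051 2; mke 0x1432501 3; mke 0x1435210 29; mke 0x1423051 2; mke 0x1324051 2;
    mke 0x1432510 12; mke 0x1432510 13; mke 0x1432051 14; mke 0x1432501 36; mke 0x1423501 38;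
    mke 0x1342051 14; mke 0x1342501 36; mke 0x1324501 38; mke 0x1423501 3; mke 0x1423510 13; mke
    0x1423051 14; mke 0x1432501 38; mke 0x1423501 36; mke 0x1432150 8; mke 0x1432501 15; mke
    0x1432150 18; mke 0x1431052 38; mke 0x1425310 29; mke 0x1243051 14; mke 0x1243501 36; mke
    0x1234501 38; mke 0x1423150 18; mke 0x1421053 38; mke 0x1410352 44; mke 0x1410253 44; mke
    0x1324510 52; mke 0x1324501 3; mke 0x1324510 13; mke 0x1324051 14; mke 0x1342501 38; mke
    0x1324501 36; mke 0x1342150 8; mke 0x1342501 15; mke 0x1342150 18; mke 0x1341052 38; mke
    0x1234051 14; mke 0x1243501 38; mke 0x1234501 36; mke 0x1325410 29; mke 0x1324150 18; mke
    0x1310452 44; mke 0x1423510 52; mke 0x1310254 44; mke 0x1321054 38; mke 0x1243150 8; mke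
    0x1243501 15; mke 0x1243150 18; mke 0x1234150 18; mke 0x1432510 52; mke 0x1210453 44; mke
    0x1210354 44; mke 0x1432501 20; mke 0x1104352 49; mke 0x1104253 49; mke 0x1103254 49; mke
    0x1241053 38; mke 0x1231054 38];
  [:: mke 0x1432105 3; mke 0x1435210 30; mke 0x1432150 13; mke 0x1432051 13; mke 0x1423510 40;
    mke 0x1324510 40; mke 0x1432150 7; mke 0x1432051 7; mke 0x1431052 40; mke 0x1430152 40; mke
    0x1423150 17; mke 0x1423051 17; mke 0x1421035 38; mke 0x1420135 38; mke 0x1324510 42; mke
    0x1324501 42; mke 0x1342150 7; mke 0x1342051 7; mke 0x1341052 40; mke 0x1340152 40; mke
    0x1324150 17; mke 0x1324051 17; mke 0x1423510 42; mke 0x1423501 42; mke 0x1321045 38; mke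
    0x1320145 38; mke 0x1243105 9; mke 0x1104352 47; mke 0x1421053 41; mke 0x1321054 41];
  [:: mke 0x1432150 45; mke 0x1432051 45; mke 0x1431052 45; mke 0x1423150 45; mke 0x1423051
    45; mke 0x1421053 45; mke 0x1324150 45; mke 0x1324051 45; mke 0x1321054 45; mke 0x1413052
    45; mke 0x1412053 45; mke 0x1314052 45; mke 0x1312054 45; mke 0x1214053 45; mke 0x1213054
    45; mke 0x1543210 54; mke 0x1432150 53; mke 0x1423150 53; mke 0x1324051 53; mke 0x1324150
    53; mke 0x1423051 53; mke 0x1432051 53; mke 0x1413250 53; mke 0x1403251 53; mke 0x1314052
    53; mke 0x1214053 53; mke 0x1304152 53; mke 0x1204153 53; mke 0x1103254 53; mke 0x1543210
    55; mke 0x1542310 55; mke 0x1314250 53; mke 0x1304251 53; mke 0x1413052 53; mke 0x1403152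
    53; mke 0x1104253 53; mke 0x1203154 53; mke 0x1534210 55; mke 0x1213054 53; mke 0x1532410
    55; mke 0x1431052 53; mke 0x1541320 55; mke 0x1531420 55; mke 0x1214350 53; mke 0x1204351
    53; mke 0x1104352 53; mke 0x1402153 53; mke 0x1302154 53; mke 0x1412053 53; mke 0x1524310
    55; mke 0x1312054 53; mke 0x1523410 55; mke 0x1421053 53; mke 0x1514320 55; mke 0x1521430
    55; mke 0x1321054 53; mke 0x1513420 55; mke 0x1512430 55];
  [:: mke 0x1432150 48; mke 0x1432051 48; mke 0x1431052 46; mke 0x1423150 48; mke 0x1423051
    48; mke 0x1421053 46; mke 0x1413250 51; mke 0x1403251 51; mke 0x1413052 50; mke 0x1412053
    50; mke 0x1403152 50; mke 0x1402153 50; mke 0x1103245 53; mke 0x1453210 55; mke 0x1452310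
    55; mke 0x1324150 48; mke 0x1324051 48; mke 0x1321054 46; mke 0x1314250 51; mke 0x1304251
    51; mke 0x1314052 50; mke 0x1304152 50; mke 0x1104235 53; mke 0x1302154 50; mke 0x1354210
    55; mke 0x1312054 50; mke 0x1352410 55; mke 0x1214350 51; mke 0x1204351 51; mke 0x1104325
    53; mke 0x1204153 50; mke 0x1203154 50; mke 0x1214053 50; mke 0x1254310 55; mke 0x1213054
    50; mke 0x1253410 55; mke 0x1543210 56]].

Definition table6 : seq node := [::
  mkn [:: 3968; 3680; 2552; 3414; 2742]%positive 1296 540 3105;
  mkn [:: 3968; 3680; 2552; 3414; 2766]%positive 1296 540 3105;
  mkn [:: 3968; 3680; 2552; 3414; 2773]%positive 1296 540 3105;
  mkn [:: 3968; 3680; 2552; 3414; 2893]%positive 1296 540 3105;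
  mkn [:: 3968; 3680; 3420; 2748; 3611]%positive 1296 540 3105;
  mkn [:: 3968; 3680; 3420; 2778; 2870]%positive 1296 540 3105;
  mkn [:: 3968; 3680; 3420; 2778; 2873]%positive 1296 540 3105;
  mkn [:: 3968; 3680; 3420; 2778; 2887]%positive 1296 540 3105;
  mkn [:: 3968; 3680; 3420; 2778; 3607]%positive 1296 540 3105;
  mkn [:: 3968; 3680; 3420; 2899; 3599]%positive 1296 540 3105;
  mkn [:: 3968; 3184; 2924; 2778; 2486]%positive 1296 540 3105;
  mkn [:: 3968; 3184; 2924; 2778; 3246]%positive 1296 540 3105;
  mkn [:: 3968; 3184; 2924; 2778; 2489]%positive 1296 540 3105;
  mkn [:: 3968; 3184; 2924; 2778; 2517]%positive 1296 540 3105;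
  mkn [:: 3968; 3184; 2924; 2778; 3277]%positive 1296 540 3105;
  mkn [:: 3968; 3184; 2924; 2778; 3655]%positive 1296 540 3105;
  mkn [:: 3968; 3184; 2924; 3278; 3613]%positive 1296 540 3105;
  mkn [:: 3968; 3184; 2924; 3278; 2787]%positive 1296 540 3105;
  mkn [:: 3968; 3184; 2924; 3278; 3627]%positive 1296 540 3105;
  mkn [:: 3968; 3184; 2924; 3659; 3367]%positive 1296 540 3105;
  mkn [:: 3968; 3184; 3662; 3373; 3227]%positive 1296 540 3105;
  mkn [:: 3968; 3704; 2552; 3430; 2790]%positive 1280 512 3074;
  mkn [:: 3968; 3704; 2552; 3430; 2902]%positive 1280 512 3074;
  mkn [:: 3968; 3704; 2552; 3430; 2774]%positive 1344 540 3197;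
  mkn [:: 3968; 3704; 2552; 3430; 3358]%positive 1280 512 3074;
  mkn [:: 3968; 3704; 2552; 3430; 2846]%positive 1344 540 3197;
  mkn [:: 3968; 3704; 2552; 3430; 2917]%positive 1280 512 3074;
  mkn [:: 3968; 3704; 2552; 3430; 2789]%positive 1344 540 3197;
  mkn [:: 3968; 3704; 2552; 3430; 3413]%positive 1280 512 3074;
  mkn [:: 3968; 3704; 2552; 3430; 2901]%positive 1344 540 3197;
  mkn [:: 3968; 3704; 2552; 3430; 3357]%positive 1344 540 3197;
  mkn [:: 3968; 3704; 3444; 2538; 2774]%positive 1344 540 3197;
  mkn [:: 3968; 3704; 3444; 2538; 2894]%positive 1280 512 3074;
  mkn [:: 3968; 3704; 3444; 2538; 2846]%positive 1344 540 3197;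
  mkn [:: 3968; 3704; 3444; 2538; 2521]%positive 1280 512 3074;
  mkn [:: 3968; 3704; 3444; 2538; 2789]%positive 1344 540 3197;
  mkn [:: 3968; 3704; 3444; 2538; 2893]%positive 1344 540 3197;
  mkn [:: 3968; 3704; 3444; 2538; 2915]%positive 1280 512 3074;
  mkn [:: 3968; 3704; 3444; 2538; 2899]%positive 1344 540 3197;
  mkn [:: 3968; 3704; 3444; 2538; 3403]%positive 1280 512 3074;
  mkn [:: 3968; 3704; 3444; 2538; 3355]%positive 1344 540 3197;
  mkn [:: 3968; 3704; 3444; 2915; 3283]%positive 1344 540 3197;
  mkn [:: 3968; 3704; 3444; 2915; 3355]%positive 1344 540 3197;
  mkn [:: 3968; 3704; 2548; 2538; 3358]%positive 1344 540 3197;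
  mkn [:: 3968; 3704; 2548; 2538; 3405]%positive 1344 540 3197;
  mkn [:: 3968; 3704; 2548; 3406; 2734]%positive 1404 567 3310;
  mkn [:: 3968; 3704; 2548; 3406; 2765]%positive 1404 567 3310;
  mkn [:: 3968; 3704; 2548; 3406; 3373]%positive 1344 540 3197;
  mkn [:: 3968; 3704; 2548; 3406; 2861]%positive 1404 567 3310;
  mkn [:: 3968; 3704; 2548; 3406; 3427]%positive 1344 540 3197;
  mkn [:: 3968; 3704; 2548; 3406; 2915]%positive 1404 567 3310;
  mkn [:: 3968; 3704; 2548; 3406; 3379]%positive 1404 567 3310;
  mkn [:: 3968; 3704; 3686; 3413; 2861]%positive 1344 540 3197;
  mkn [:: 3968; 3704; 3430; 2901; 2859]%positive 1404 567 3310;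
  mkn [:: 4064; 3868; 3290; 2742; 2414]%positive 1458 567 3412;
  mkn [:: 4064; 3868; 3290; 2742; 2489]%positive 1458 567 3412;
  mkn [:: 4064; 3868; 3290; 2745; 3719]%positive 1458 567 3412].

Definition edges6 : seq (seq edge) := [::
  [::];
  [::];
  [::];
  [::];
  [::];
  [::];
  [::];
  [::];
  [::];
  [::];
  [::];
  [::];
  [::];
  [::];
  [::];
  [::];
  [::];
  [::];
  [::];
  [::];
  [::];
  [::];
  [::];
  [:: mke 0x15432610 17; mke 0x14532610 17; mke 0x15410632 17; mke 0x14510632 17; mke
    0x15643210 87; mke 0x15642310 87; mke 0x16543210 90; mke 0x16453210 90; mke 0x14652310 87;
    mke 0x14653210 87; mke 0x15432610 21; mke 0x14532610 21; mke 0x15410632 21; mke 0x14510632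
    21; mke 0x16543210 91; mke 0x16542310 91; mke 0x16543210 92; mke 0x16453210 92; mke
    0x16452310 91; mke 0x16453210 91];
  [::];
  [:: mke 0x15234610 7; mke 0x14235610 7; mke 0x15014632 7; mke 0x14015632 7; mke 0x15643210
    85; mke 0x15462310 87; mke 0x14562310 87; mke 0x14653210 85; mke 0x15432610 22; mke
    0x14532610 22; mke 0x15410632 22; mke 0x14510632 22; mke 0x16543210 95; mke 0x16543210 96;
    mke 0x16453210 96; mke 0x16453210 95];
  [::];
  [:: mke 0x15432610 18; mke 0x14532610 18; mke 0x15410632 18; mke 0x14510632 18; mke
    0x15643210 88; mke 0x15642310 88; mke 0x15643210 92; mke 0x14653210 92; mke 0x14652310 88;
    mke 0x14653210 88];
  [::];
  [:: mke 0x15234610 8; mke 0x14235610 8; mke 0x15014632 8; mke 0x14015632 8; mke 0x15234610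
    9; mke 0x15014632 9; mke 0x15432610 20; mke 0x15410632 20; mke 0x15643210 86; mke 0x15462310
    88; mke 0x15462310 91; mke 0x15643210 89; mke 0x15643210 94; mke 0x15463210 96; mke
    0x14235610 9; mke 0x14015632 9; mke 0x14532610 20; mke 0x14510632 20; mke 0x14562310 91; mke
    0x14562310 88; mke 0x14653210 86; mke 0x14563210 96; mke 0x14653210 94; mke 0x14653210 89;
    mke 0x15643210 98; mke 0x14653210 98; mke 0x15641032 98; mke 0x14651032 98];
  [:: mke 0x15432610 19; mke 0x15423610 19; mke 0x15410632 19; mke 0x15401632 19; mke
    0x15463210 89; mke 0x15462310 89; mke 0x15463210 95; mke 0x15462310 95; mke 0x14532610 19;
    mke 0x14523610 19; mke 0x14510632 19; mke 0x14501632 19; mke 0x14563210 95; mke 0x14562310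
    95; mke 0x14563210 89; mke 0x14562310 89];
  [:: mke 0x15432160 17; mke 0x15432061 17; mke 0x14510326 0; mke 0x14501326 0; mke 0x13254610
    61; mke 0x13254601 61; mke 0x15410632 41; mke 0x16543210 100; mke 0x16543201 100; mke
    0x14510623 41; mke 0x16452310 100; mke 0x16452301 100; mke 0x15432610 25; mke 0x15432601 25;
    mke 0x15432610 53; mke 0x15432601 53; mke 0x11054632 35; mke 0x10154632 35; mke 0x14510632
    76; mke 0x14501632 76; mke 0x16543210 101; mke 0x15410623 76; mke 0x15401623 76; mke
    0x16452310 101; mke 0x13524610 81; mke 0x13524601 81; mke 0x11054632 84; mke 0x16543210 103;
    mke 0x16543201 103; mke 0x11045623 84; mke 0x16452310 103; mke 0x16452301 103];
  [::];
  [:: mke 0x15423601 0; mke 0x15104263 7; mke 0x14325061 7; mke 0x14501623 0; mke 0x13425601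
    10; mke 0x12543601 55; mke 0x11504623 10; mke 0x15106432 87; mke 0x10451623 55; mke
    0x15462310 100; mke 0x13526410 100; mke 0x14326510 87; mke 0x15432610 26; mke 0x15432601 54;
    mke 0x14150632 34; mke 0x15342610 34; mke 0x15432601 75; mke 0x14510632 26; mke 0x16543210
    107; mke 0x14510623 75; mke 0x14510623 54; mke 0x16451032 107; mke 0x15324601 83; mke
    0x16543210 108; mke 0x14105623 83; mke 0x16543210 109; mke 0x16451032 109; mke 0x16451032
    108];
  [::];
  [:: mke 0x15432160 18; mke 0x15432061 18; mke 0x15432610 38; mke 0x15432601 38; mke
    0x14510326 1; mke 0x14501326 1; mke 0x15140263 60; mke 0x15041263 60; mke 0x15462310 101;
    mke 0x15410632 45; mke 0x15643210 105; mke 0x15643201 105; mke 0x14150362 60; mke 0x14051362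
    60; mke 0x14563210 101; mke 0x14510623 45; mke 0x14652310 105; mke 0x14652301 105; mke
    0x13254610 72; mke 0x13254601 72];
  [:: mke 0x15423601 1; mke 0x15104263 8; mke 0x14325061 8; mke 0x14532610 36; mke 0x14501623
    1; mke 0x15410632 36; mke 0x15342610 23; mke 0x15243601 59; mke 0x15243610 60; mke
    0x15104623 12; mke 0x15106432 88; mke 0x15140263 58; mke 0x13254610 71; mke 0x15326410 105;
    mke 0x15410632 44; mke 0x15410623 47; mke 0x15461032 107; mke 0x14325601 12; mke 0x14532610
    44; mke 0x14532601 47; mke 0x11045632 71; mke 0x14352061 58; mke 0x14051632 60; mke
    0x14150632 23; mke 0x14563210 107; mke 0x14051623 59; mke 0x14562310 105; mke 0x14326510 88;
    mke 0x13254610 74; mke 0x13524601 79; mke 0x11045632 74; mke 0x11405623 79; mke 0x16543210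
    112; mke 0x16451032 112];
  [::];
  [:: mke 0x15423601 2; mke 0x15104263 9; mke 0x15432160 20; mke 0x15432601 40; mke 0x15410632
    37; mke 0x15410236 2; mke 0x13425601 11; mke 0x15243601 57; mke 0x15243610 58; mke
    0x15104263 12; mke 0x15106432 89; mke 0x15041263 59; mke 0x15462310 103; mke 0x15324601 77;
    mke 0x15410632 43; mke 0x15643210 106; mke 0x15410623 46; mke 0x15643210 109; mke 0x13425601
    13; mke 0x14532610 49; mke 0x10154362 35; mke 0x13542610 29; mke 0x13452601 64; mke
    0x14501362 76; mke 0x14510362 26; mke 0x15643210 110; mke 0x14510623 52; mke 0x15643210 112;
    mke 0x13245160 65; mke 0x13526410 103; mke 0x13426510 91; mke 0x13250164 109; mke 0x13421065
    103];
  [::];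
  [:: mke 0x15432160 19; mke 0x15432061 19; mke 0x15432610 39; mke 0x15432601 39; mke
    0x15410263 2; mke 0x15401263 2; mke 0x15140263 57; mke 0x15041263 57; mke 0x15410632 42; mke
    0x15326401 106; mke 0x15326410 106; mke 0x15461032 108; mke 0x15460132 108; mke 0x15432610
    24; mke 0x15432601 24; mke 0x14532610 50; mke 0x14532601 50; mke 0x14150362 34; mke
    0x14051362 34; mke 0x14105362 78; mke 0x13526401 108; mke 0x13526410 108; mke 0x13421056
    103; mke 0x13420156 103];
  [:: mke 0x14532610 3; mke 0x15410362 21; mke 0x14523610 3; mke 0x15410263 21; mke 0x13542106
    29; mke 0x13542061 64; mke 0x13524601 103; mke 0x13452160 64; mke 0x13425610 103; mke
    0x15410362 25; mke 0x12543106 29; mke 0x12543061 64; mke 0x12534601 103; mke 0x12453160 64;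
    mke 0x12435610 103; mke 0x15410263 25; mke 0x15410632 51; mke 0x15410623 51; mke 0x13521064
    108; mke 0x13420165 108; mke 0x12531064 108; mke 0x12430165 108];
  [:: mke 0x15432061 3; mke 0x15410362 22; mke 0x14532160 22; mke 0x14510263 3; mke 0x13524061
    13; mke 0x15432610 48; mke 0x14051326 34; mke 0x14501362 75; mke 0x13524601 108; mke
    0x13240156 109; mke 0x15243106 34; mke 0x15423160 75; mke 0x11405263 13; mke 0x14510632 48;
    mke 0x11052346 109; mke 0x11405623 108; mke 0x13526410 95; mke 0x13420156 108; mke
    0x11502346 108; mke 0x11406532 95];
  [:: mke 0x14235106 10; mke 0x13245106 10; mke 0x12543160 41; mke 0x12543061 41; mke
    0x11054362 90; mke 0x10512436 10; mke 0x11502436 10; mke 0x15210463 41; mke 0x15210364 41;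
    mke 0x14326510 90; mke 0x15432610 33; mke 0x15432610 78; mke 0x15432601 78; mke 0x15436210
    110; mke 0x15436201 110; mke 0x12105643 33; mke 0x12105643 78; mke 0x12106534 110; mke
    0x12105634 78; mke 0x12106543 110];
  [:: mke 0x14235106 11; mke 0x15324106 23; mke 0x15234160 46; mke 0x15234061 46; mke
    0x15234160 47; mke 0x15234061 47; mke 0x15104362 94; mke 0x15012346 12; mke 0x15102346 12;
    mke 0x15201463 43; mke 0x15210463 43; mke 0x15210463 42; mke 0x15210364 45; mke 0x15201364
    44; mke 0x15210364 44; mke 0x12105634 110; mke 0x14325610 14; mke 0x14352160 28; mke
    0x14352061 28; mke 0x14352610 65; mke 0x14352601 65; mke 0x14536210 101; mke 0x14536210 107;
    mke 0x14536201 107; mke 0x12105463 33; mke 0x11052463 84; mke 0x14326510 92; mke 0x14230165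
    101; mke 0x14231065 101; mke 0x10125364 74; mke 0x11025364 74; mke 0x12106543 98];
  [:: mke 0x15432610 27; mke 0x14532610 27; mke 0x15432610 82; mke 0x15432601 82; mke
    0x14532610 82; mke 0x14532601 82; mke 0x15436210 114; mke 0x14536210 114; mke 0x15463210
    116; mke 0x15423610 82; mke 0x15423601 82; mke 0x14523610 82; mke 0x14523601 82; mke
    0x15462310 116; mke 0x14526310 114; mke 0x15426310 114; mke 0x13256410 114; mke 0x12356410
    114; mke 0x13265410 116; mke 0x13264510 116; mke 0x12346510 114; mke 0x13246510 114];
  [:: mke 0x15324160 66; mke 0x15324061 66; mke 0x15234160 66; mke 0x15234061 66; mke
    0x15321064 102; mke 0x15231064 102; mke 0x13256410 116; mke 0x14325160 66; mke 0x14325061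
    66; mke 0x14235160 66; mke 0x14235061 66; mke 0x13246510 116; mke 0x14231065 102; mke
    0x14321065 102];
  [:: mke 0x13254610 4; mke 0x13254106 24; mke 0x12354106 24; mke 0x13254160 50; mke
    0x13254061 50; mke 0x15436210 109; mke 0x15436201 109; mke 0x12105436 110; mke 0x12354160
    50; mke 0x12354061 50; mke 0x13105426 110; mke 0x15426301 109; mke 0x15426310 109; mke
    0x13210546 25; mke 0x12310546 25; mke 0x11302564 81; mke 0x10312564 81; mke 0x13245106 24;
    mke 0x12345106 24; mke 0x13245160 50; mke 0x13245061 50; mke 0x14536210 109; mke 0x14536201
    109; mke 0x12104536 110; mke 0x12345160 50; mke 0x12345061 50; mke 0x13104526 110; mke
    0x14526301 109; mke 0x14526310 109; mke 0x13210456 25; mke 0x12310456 25; mke 0x11302465 81;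
    mke 0x10312465 81; mke 0x13210546 6; mke 0x13102564 68; mke 0x13102465 68];
  [:: mke 0x15432610 30; mke 0x15324160 63; mke 0x15436201 104; mke 0x15342601 67; mke
    0x15463210 115; mke 0x15234061 63; mke 0x15426310 104; mke 0x15243610 67; mke 0x15462301
    115; mke 0x15326410 93; mke 0x15231046 102; mke 0x12345610 114; mke 0x14532610 30; mke
    0x14325160 63; mke 0x14536201 104; mke 0x14352601 67; mke 0x14563210 115; mke 0x14235061 63;
    mke 0x14526310 104; mke 0x14253610 67; mke 0x14562301 115; mke 0x12354610 114; mke
    0x14231056 102; mke 0x14326510 93; mke 0x13210546 117; mke 0x13210456 117];
  [:: mke 0x13254610 5; mke 0x15432610 28; mke 0x15423610 28; mke 0x13254160 49; mke
    0x13254061 49; mke 0x15342610 101; mke 0x15341062 107; mke 0x15340162 107; mke 0x12105463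
    110; mke 0x12354160 49; mke 0x12354061 49; mke 0x15243610 101; mke 0x13105462 110; mke
    0x15240163 107; mke 0x15241063 107; mke 0x13210564 53; mke 0x12310564 53; mke 0x13245160 52;
    mke 0x13245061 52; mke 0x14352160 79; mke 0x14352061 79; mke 0x14536210 112; mke 0x14536201
    112; mke 0x12105463 98; mke 0x12345160 52; mke 0x12345061 52; mke 0x14253160 79; mke
    0x14253061 79; mke 0x13105462 98; mke 0x14526301 112; mke 0x14526310 112; mke 0x13210564 51;
    mke 0x12310564 51; mke 0x13210645 6; mke 0x13102654 68; mke 0x11032465 72; mke 0x10132465
    72];
  [:: mke 0x14235610 15; mke 0x15342610 62; mke 0x15342601 66; mke 0x15436201 102; mke
    0x15436210 115; mke 0x15243601 62; mke 0x15243610 66; mke 0x15426310 102; mke 0x15426301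
    115; mke 0x15321064 93; mke 0x15321064 104; mke 0x14235610 16; mke 0x14532610 32; mke
    0x13425610 70; mke 0x14352601 73; mke 0x14536201 111; mke 0x14532610 80; mke 0x15463210 117;
    mke 0x14351062 113; mke 0x12435601 70; mke 0x14253610 73; mke 0x14526310 111; mke 0x14523601
    80; mke 0x15462301 117; mke 0x14250163 113; mke 0x13210564 118; mke 0x13210465 117; mke
    0x14326510 97; mke 0x14321065 111];
  [:: mke 0x15342610 63; mke 0x15342601 63; mke 0x15243610 63; mke 0x15243601 63; mke
    0x15321046 104; mke 0x15231046 104; mke 0x14532610 31; mke 0x14523610 31; mke 0x14536210
    113; mke 0x14536201 113; mke 0x15463210 118; mke 0x15462310 118; mke 0x14526301 113; mke
    0x14526310 113; mke 0x14321056 111; mke 0x14231056 111];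
  [:: mke 0x15432061 5; mke 0x13524016 13; mke 0x15432160 48; mke 0x14501326 26; mke
    0x13524601 107; mke 0x13425016 13; mke 0x14532160 48; mke 0x15401326 26; mke 0x13425601 107;
    mke 0x14501362 54; mke 0x15401362 54; mke 0x15423106 26; mke 0x15423160 54; mke 0x11405236
    13; mke 0x14523106 26; mke 0x14523160 54; mke 0x11504236 13; mke 0x14510362 48; mke
    0x15410362 48; mke 0x15410263 5; mke 0x11504623 107; mke 0x11405623 107; mke 0x13254061 14;
    mke 0x13245061 14; mke 0x13254610 56; mke 0x14015362 83; mke 0x15014362 83; mke 0x13526410
    96; mke 0x13520146 107; mke 0x13245601 109; mke 0x13254601 109; mke 0x13420156 107; mke
    0x13426510 96; mke 0x15234160 83; mke 0x11054623 109; mke 0x11045263 14; mke 0x11502346 107;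
    mke 0x11406532 96; mke 0x14235160 83; mke 0x11054263 14; mke 0x11506432 96; mke 0x11402356
    107; mke 0x11045623 109; mke 0x11054632 56];
  [:: mke 0x15432061 16; mke 0x14532061 16; mke 0x15436210 99; mke 0x15423061 16; mke
    0x15432601 113; mke 0x14523601 113; mke 0x14523061 16; mke 0x14532601 113; mke 0x15423601
    113; mke 0x15426310 99; mke 0x15410362 116; mke 0x15410263 116; mke 0x15324610 69; mke
    0x13542061 70; mke 0x15230146 113; mke 0x13452061 70; mke 0x14230156 113; mke 0x12543061 70;
    mke 0x15320146 113; mke 0x13524160 82; mke 0x15321064 114; mke 0x12453061 70; mke 0x14320156
    113; mke 0x12534160 82; mke 0x14321065 114; mke 0x15231064 114; mke 0x14231065 114];
  [:: mke 0x16543210 122; mke 0x16453210 122; mke 0x16534210 122; mke 0x16354210 122; mke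
    0x16435210 122; mke 0x16345210 122; mke 0x16524310 122; mke 0x16254310 122; mke 0x16425310
    122; mke 0x16245310 122; mke 0x16325410 122; mke 0x16235410 122];
  [:: mke 0x15432160 119; mke 0x15423061 119; mke 0x15103264 119; mke 0x15204163 119; mke
    0x15314062 119; mke 0x15643210 122; mke 0x14235160 121; mke 0x14325061 121; mke 0x14321065
    120; mke 0x13145260 121; mke 0x10125463 121; mke 0x10215364 121; mke 0x10214365 120; mke
    0x16543210 123; mke 0x13415062 121; mke 0x16534120 123; mke 0x13412065 120; mke 0x12045361
    121; mke 0x11035462 121; mke 0x15624310 123; mke 0x11305264 121; mke 0x11304265 120; mke
    0x12405163 121; mke 0x12403165 120; mke 0x16524031 123; mke 0x15613420 123];
  [:: mke 0x14513620 123; mke 0x14512630 123; mke 0x14153620 123; mke 0x13512640 123; mke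
    0x14152630 123; mke 0x13152640 123]].

Definition table7 : seq node := [::
  mkn [:: 3968; 3680; 2552; 3420; 2774; 2862]%positive 3216 1344 7639;
  mkn [:: 3968; 3680; 2552; 3420; 2774; 2869]%positive 3216 1344 7639;
  mkn [:: 3968; 3680; 2552; 3420; 2774; 2891]%positive 3216 1344 7639;
  mkn [:: 3968; 3680; 2552; 3420; 2899; 3275]%positive 3216 1344 7639;
  mkn [:: 3968; 3680; 2552; 2534; 3413; 2741]%positive 3216 1344 7639;
  mkn [:: 3968; 3680; 2552; 2534; 3413; 2765]%positive 3216 1344 7639;
  mkn [:: 3968; 3680; 2552; 2534; 3413; 2891]%positive 3216 1344 7639;
  mkn [:: 3968; 3680; 2552; 3414; 2774; 2862]%positive 3216 1344 7639;
  mkn [:: 3968; 3680; 2552; 3414; 2774; 2869]%positive 3216 1344 7639;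
  mkn [:: 3968; 3680; 2552; 3414; 2774; 2893]%positive 3216 1344 7639;
  mkn [:: 3968; 3680; 2552; 3414; 2742; 2894]%positive 3216 1344 7639;
  mkn [:: 3968; 3680; 2552; 3414; 2742; 2901]%positive 3216 1344 7639;
  mkn [:: 3968; 3680; 2552; 3414; 2894; 2773]%positive 3216 1344 7639;
  mkn [:: 3968; 3680; 2552; 3414; 2766; 2901]%positive 3216 1344 7639;
  mkn [:: 3968; 3680; 2552; 3414; 2766; 2773]%positive 3216 1344 7639;
  mkn [:: 3968; 3680; 2552; 3414; 2773; 2867]%positive 3348 1404 7873;
  mkn [:: 3968; 3680; 2552; 3414; 2773; 2891]%positive 3348 1404 7873;
  mkn [:: 3968; 3680; 3420; 2780; 2874; 3254]%positive 3216 1344 7639;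
  mkn [:: 3968; 3680; 3420; 2780; 2874; 3257]%positive 3216 1344 7639;
  mkn [:: 3968; 3680; 3420; 2780; 2874; 2887]%positive 3216 1344 7639;
  mkn [:: 3968; 3680; 3420; 2780; 2874; 3607]%positive 3216 1344 7639;
  mkn [:: 3968; 3680; 3420; 2780; 2899; 3275]%positive 3216 1344 7639;
  mkn [:: 3968; 3680; 3420; 2780; 2899; 3599]%positive 3216 1344 7639;
  mkn [:: 3968; 3680; 3420; 2748; 2906; 3607]%positive 3216 1344 7639;
  mkn [:: 3968; 3680; 3420; 2906; 2773; 2861]%positive 3216 1344 7639;
  mkn [:: 3968; 3680; 3420; 2906; 2773; 3275]%positive 3216 1344 7639;
  mkn [:: 3968; 3680; 3420; 2906; 2773; 3599]%positive 3216 1344 7639;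
  mkn [:: 3968; 3680; 3420; 2778; 2870; 3246]%positive 3348 1404 7873;
  mkn [:: 3968; 3680; 3420; 2778; 2870; 2873]%positive 3216 1344 7639;
  mkn [:: 3968; 3680; 3420; 2778; 2870; 3613]%positive 3216 1344 7639;
  mkn [:: 3968; 3680; 3420; 2778; 2870; 3599]%positive 3348 1404 7873;
  mkn [:: 3968; 3680; 3420; 2778; 2873; 2887]%positive 3348 1404 7873;
  mkn [:: 3968; 3680; 3420; 2778; 2873; 3607]%positive 3348 1404 7873;
  mkn [:: 3968; 3680; 3420; 2778; 2773; 3599]%positive 3216 1344 7639;
  mkn [:: 3968; 3680; 3420; 2778; 3613; 2887]%positive 3216 1344 7639;
  mkn [:: 3968; 3680; 3420; 2778; 2887; 3607]%positive 3216 1344 7639;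
  mkn [:: 3968; 3184; 2924; 2780; 2490; 3245]%positive 3204 1344 7618;
  mkn [:: 3968; 3184; 2924; 2780; 2490; 2787]%positive 3204 1344 7618;
  mkn [:: 3968; 3184; 2924; 2780; 3246; 3357]%positive 3204 1344 7618;
  mkn [:: 3968; 3184; 2924; 2780; 3246; 2787]%positive 3204 1344 7618;
  mkn [:: 3968; 3184; 2924; 2780; 3246; 3659]%positive 3204 1344 7618;
  mkn [:: 3968; 3184; 2924; 2794; 2518; 3614]%positive 3204 1344 7618;
  mkn [:: 3968; 3184; 2924; 2794; 2518; 2489]%positive 3204 1344 7618;
  mkn [:: 3968; 3184; 2924; 2794; 2518; 2741]%positive 3204 1344 7618;
  mkn [:: 3968; 3184; 2924; 2794; 2518; 3277]%positive 3204 1344 7618;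
  mkn [:: 3968; 3184; 2924; 2794; 2518; 3655]%positive 3204 1344 7618;
  mkn [:: 3968; 3184; 2924; 2794; 3614; 2773]%positive 3204 1344 7618;
  mkn [:: 3968; 3184; 2924; 2794; 3614; 3277]%positive 3204 1344 7618;
  mkn [:: 3968; 3184; 2924; 2794; 2521; 2741]%positive 3204 1344 7618;
  mkn [:: 3968; 3184; 2924; 2794; 2521; 3245]%positive 3204 1344 7618;
  mkn [:: 3968; 3184; 2924; 2794; 2773; 3245]%positive 3204 1344 7618;
  mkn [:: 3968; 3184; 2924; 2794; 2773; 2867]%positive 3204 1344 7618;
  mkn [:: 3968; 3184; 2924; 2794; 2773; 3623]%positive 3204 1344 7618;
  mkn [:: 3968; 3184; 2924; 2794; 3277; 3371]%positive 3204 1344 7618;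
  mkn [:: 3968; 3184; 2924; 2794; 3277; 3623]%positive 3204 1344 7618;
  mkn [:: 3968; 3184; 2924; 2778; 2486; 3406]%positive 3204 1344 7618;
  mkn [:: 3968; 3184; 2924; 2778; 2486; 2489]%positive 3204 1344 7618;
  mkn [:: 3968; 3184; 2924; 2778; 3406; 2517]%positive 3204 1344 7618;
  mkn [:: 3968; 3184; 2924; 2778; 3406; 3613]%positive 3204 1344 7618;
  mkn [:: 3968; 3184; 2924; 2778; 3406; 2531]%positive 3204 1344 7618;
  mkn [:: 3968; 3184; 2924; 2778; 3406; 3627]%positive 3204 1344 7618;
  mkn [:: 3968; 3184; 2924; 2778; 3246; 3358]%positive 3204 1344 7618;
  mkn [:: 3968; 3184; 2924; 2778; 3246; 2489]%positive 3321 1404 7825;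
  mkn [:: 3968; 3184; 2924; 2778; 3246; 2741]%positive 3321 1404 7825;
  mkn [:: 3968; 3184; 2924; 2778; 3246; 3661]%positive 3204 1344 7618;
  mkn [:: 3968; 3184; 2924; 2778; 3246; 3277]%positive 3204 1344 7618;
  mkn [:: 3968; 3184; 2924; 2778; 3246; 3613]%positive 3321 1404 7825;
  mkn [:: 3968; 3184; 2924; 2778; 3246; 3655]%positive 3321 1404 7825;
  mkn [:: 3968; 3184; 2924; 2778; 2773; 2531]%positive 3204 1344 7618;
  mkn [:: 3968; 3184; 2924; 2778; 2517; 2867]%positive 3321 1404 7825;
  mkn [:: 3968; 3184; 2924; 2778; 2517; 3403]%positive 3321 1404 7825;
  mkn [:: 3968; 3184; 2924; 2778; 3277; 3613]%positive 3204 1344 7618;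
  mkn [:: 3968; 3184; 2924; 2778; 3277; 3403]%positive 3204 1344 7618;
  mkn [:: 3968; 3184; 2924; 2778; 3277; 3627]%positive 3321 1404 7825;
  mkn [:: 3968; 3184; 2924; 2778; 3277; 3655]%positive 3204 1344 7618;
  mkn [:: 3968; 3184; 2924; 3662; 3245; 2787]%positive 3204 1344 7618;
  mkn [:: 3968; 3184; 2924; 3662; 2787; 3371]%positive 3204 1344 7618;
  mkn [:: 3968; 3184; 2924; 3278; 3614; 3371]%positive 3204 1344 7618;
  mkn [:: 3968; 3184; 2924; 3278; 3245; 2787]%positive 3204 1344 7618;
  mkn [:: 3968; 3184; 2924; 3278; 3613; 3403]%positive 3204 1344 7618;
  mkn [:: 3968; 3184; 2924; 3278; 3613; 3371]%positive 3321 1404 7825;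
  mkn [:: 3968; 3184; 2924; 3278; 2787; 3403]%positive 3204 1344 7618;
  mkn [:: 3968; 3184; 2924; 3278; 2787; 3371]%positive 3321 1404 7825;
  mkn [:: 3968; 3184; 2924; 3278; 3659; 3367]%positive 3204 1344 7618;
  mkn [:: 3968; 3184; 2924; 3278; 3627; 3367]%positive 3204 1344 7618;
  mkn [:: 3968; 3704; 2552; 3430; 2790; 2846]%positive 3328 1344 7838;
  mkn [:: 3968; 3704; 2552; 3430; 2790; 2901]%positive 3328 1344 7838;
  mkn [:: 3968; 3704; 2552; 3430; 2902; 2734]%positive 3328 1344 7838;
  mkn [:: 3968; 3704; 2552; 3430; 2902; 2789]%positive 3328 1344 7838;
  mkn [:: 3968; 3704; 2552; 3430; 2902; 2861]%positive 3328 1344 7838;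
  mkn [:: 3968; 3704; 2552; 3430; 2774; 2734]%positive 3328 1344 7838;
  mkn [:: 3968; 3704; 2552; 3430; 2774; 2917]%positive 3328 1344 7838;
  mkn [:: 3968; 3704; 2552; 3430; 2774; 2789]%positive 3328 1344 7838;
  mkn [:: 3968; 3704; 2552; 3430; 2774; 2869]%positive 3456 1404 8063;
  mkn [:: 3968; 3704; 2552; 3430; 3358; 2901]%positive 3328 1344 7838;
  mkn [:: 3968; 3704; 2552; 3430; 2846; 2917]%positive 3328 1344 7838;
  mkn [:: 3968; 3704; 2552; 3430; 2846; 3413]%positive 3328 1344 7838;
  mkn [:: 3968; 3704; 2552; 3430; 2789; 2899]%positive 3456 1404 8063;
  mkn [:: 3968; 3704; 2552; 3430; 3413; 2867]%positive 3328 1344 7838;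
  mkn [:: 3968; 3704; 2552; 3430; 2901; 2859]%positive 3456 1404 8063;
  mkn [:: 3968; 3704; 3444; 2538; 2774; 2862]%positive 3328 1344 7838;
  mkn [:: 3968; 3704; 3444; 2538; 2774; 2521]%positive 3328 1344 7838;
  mkn [:: 3968; 3704; 3444; 2538; 2774; 2893]%positive 3456 1404 8063;
  mkn [:: 3968; 3704; 3444; 2538; 2774; 2915]%positive 3328 1344 7838;
  mkn [:: 3968; 3704; 3444; 2538; 2774; 2867]%positive 3456 1404 8063;
  mkn [:: 3968; 3704; 3444; 2538; 2894; 2789]%positive 3328 1344 7838;
  mkn [:: 3968; 3704; 3444; 2538; 2894; 2867]%positive 3328 1344 7838;
  mkn [:: 3968; 3704; 3444; 2538; 2846; 2521]%positive 3328 1344 7838;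
  mkn [:: 3968; 3704; 3444; 2538; 2846; 2915]%positive 3328 1344 7838;
  mkn [:: 3968; 3704; 3444; 2538; 2846; 2899]%positive 3328 1344 7838;
  mkn [:: 3968; 3704; 3444; 2538; 2521; 2867]%positive 3328 1344 7838;
  mkn [:: 3968; 3704; 3444; 2538; 2789; 2899]%positive 3456 1404 8063;
  mkn [:: 3968; 3704; 3444; 2538; 2893; 2899]%positive 3328 1344 7838;
  mkn [:: 3968; 3704; 3444; 2538; 2893; 2867]%positive 3456 1404 8063;
  mkn [:: 3968; 3704; 3444; 2538; 2899; 3251]%positive 3456 1404 8063;
  mkn [:: 3968; 3704; 2548; 2538; 3358; 2893]%positive 3456 1404 8063;
  mkn [:: 3968; 3704; 2548; 2538; 3405; 2733]%positive 3456 1404 8063;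
  mkn [:: 3968; 3704; 2548; 2538; 3405; 2899]%positive 3456 1404 8063;
  mkn [:: 3968; 3704; 2548; 2538; 3405; 3379]%positive 3456 1404 8063;
  mkn [:: 3968; 3704; 2548; 3406; 2734; 2845]%positive 3564 1458 8251;
  mkn [:: 3968; 3704; 2548; 3406; 2765; 2915]%positive 3564 1458 8251;
  mkn [:: 3968; 3704; 2548; 3406; 2861; 2899]%positive 3564 1458 8251;
  mkn [:: 4064; 3868; 3290; 2742; 2414; 2489]%positive 3645 1458 8391;
  mkn [:: 4064; 3868; 3290; 2742; 2489; 3189]%positive 3645 1458 8391].

Definition edges7 : seq (seq edge) := [::
  [:: mke 0x165743021 0; mke 0x165743210 4];
  [:: mke 0x165743021 1];
  [:: mke 0x165743120 2; mke 0x165743201 5];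
  [:: mke 0x165743210 3; mke 0x165473102 4];
  [::];
  [::];
  [::];
  [:: mke 0x167453210 26; mke 0x167453210 29; mke 0x176543210 33];
  [:: mke 0x167453210 27; mke 0x167543210 30; mke 0x132016754 31];
  [:: mke 0x167543210 28; mke 0x167453210 31; mke 0x167453210 36];
  [:: mke 0x154763210 29; mke 0x154763120 29; mke 0x176543210 44];
  [:: mke 0x167543210 44; mke 0x132105476 31; mke 0x131205476 31];
  [:: mke 0x165743120 30; mke 0x164753210 31; mke 0x167453210 48];
  [:: mke 0x165743120 33; mke 0x154763210 36; mke 0x154763210 48];
  [:: mke 0x165473102 44; mke 0x145673201 48; mke 0x145673210 48];
  [::];
  [::];
  [:: mke 0x165437210 0; mke 0x176543210 60];
  [:: mke 0x165437210 1];
  [:: mke 0x165437210 2; mke 0x167543210 65];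
  [:: mke 0x162015743 28; mke 0x162015743 30; mke 0x165743210 57];
  [:: mke 0x165437210 3; mke 0x126510743 60];
  [:: mke 0x165743210 56; mke 0x126015743 33];
  [:: mke 0x162104375 30; mke 0x161204375 30; mke 0x167543210 74];
  [:: mke 0x165437210 4; mke 0x165210347 5];
  [:: mke 0x165437210 5; mke 0x156210437 4];
  [:: mke 0x165473120 57; mke 0x126105374 33; mke 0x121605734 44];
  [::];
  [::];
  [:: mke 0x165473021 60; mke 0x154210376 5];
  [::];
  [::];
  [::];
  [:: mke 0x165437102 74; mke 0x120613547 44; mke 0x121603547 44];
  [:: mke 0x165473120 65; mke 0x146201735 4];
  [:: mke 0x143102756 5; mke 0x124310675 60];
  [:: mke 0x165437210 95; mke 0x162150743 72; mke 0x165347120 95; mke 0x156347210 99; mke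
    0x156437120 99];
  [:: mke 0x165437210 94; mke 0x112506743 47; mke 0x165347120 94; mke 0x165437210 96; mke
    0x112506743 53; mke 0x165347120 96];
  [::];
  [:: mke 0x156437210 97; mke 0x156347120 97; mke 0x156021743 87];
  [:: mke 0x165347210 100; mke 0x165437120 100; mke 0x165437210 98; mke 0x156210743 76; mke
    0x165347120 98];
  [:: mke 0x164537210 116; mke 0x163547210 116];
  [:: mke 0x164537210 92; mke 0x163547210 92; mke 0x145367120 108; mke 0x126510743 79; mke
    0x135467120 108; mke 0x126510734 79];
  [:: mke 0x121506374 47; mke 0x112065374 85; mke 0x121506734 54];
  [:: mke 0x162150473 72; mke 0x163547210 117; mke 0x163457120 121];
  [:: mke 0x164537210 93; mke 0x163547210 93; mke 0x165437210 115];
  [:: mke 0x165432701 94; mke 0x153647210 122];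
  [:: mke 0x165432701 95; mke 0x165347210 124];
  [:: mke 0x121506374 53; mke 0x156210374 9; mke 0x121506374 54];
  [:: mke 0x165347120 91; mke 0x156432701 98; mke 0x156210347 8; mke 0x163457120 113];
  [:: mke 0x165432701 97; mke 0x156210374 8; mke 0x165437120 101; mke 0x156201347 10];
  [:: mke 0x156210743 9; mke 0x112065743 85];
  [:: mke 0x165431702 91; mke 0x156432701 96; mke 0x156210734 8];
  [:: mke 0x156210437 7; mke 0x164537120 90];
  [:: mke 0x156210473 76; mke 0x156210734 7];
  [:: mke 0x145210376 6];
  [:: mke 0x112304567 54; mke 0x121304567 54; mke 0x112403567 54; mke 0x121403567 54];
  [:: mke 0x165431702 92; mke 0x154367120 112; mke 0x154367210 110; mke 0x116402753 78];
  [:: mke 0x164532701 100; mke 0x156347120 120; mke 0x165347120 128];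
  [:: mke 0x164532701 99; mke 0x145632701 117];
  [:: mke 0x165431702 93; mke 0x146532701 124; mke 0x165437120 125];
  [:: mke 0x134210765 6; mke 0x165437210 118; mke 0x156437120 118];
  [::];
  [:: mke 0x165347210 102; mke 0x135641702 119];
  [:: mke 0x163542701 105; mke 0x165437120 103; mke 0x145201376 10];
  [:: mke 0x165437120 105; mke 0x154631702 110; mke 0x165347120 127];
  [:: mke 0x165437120 104; mke 0x154632701 109; mke 0x165347120 126];
  [:: mke 0x165437210 119; mke 0x165347120 119];
  [:: mke 0x165437210 106; mke 0x165437120 107; mke 0x116320547 79; mke 0x164537210 106; mke
    0x164537120 107; mke 0x113620547 79];
  [::];
  [:: mke 0x165347120 111; mke 0x165347210 109];
  [:: mke 0x165437210 114; mke 0x156437120 114; mke 0x136542701 128; mke 0x135641702 128; mke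
    0x132140765 73];
  [:: mke 0x146351702 90; mke 0x146531702 106; mke 0x123401657 16];
  [::];
  [:: mke 0x163542701 120; mke 0x164531702 108; mke 0x132140675 73; mke 0x123401756 16];
  [:: mke 0x156021473 87];
  [:: mke 0x156102734 10; mke 0x164532701 116; mke 0x164531702 122];
  [:: mke 0x154632701 127; mke 0x145631702 127; mke 0x136210754 77];
  [:: mke 0x156431702 112; mke 0x146531702 112];
  [:: mke 0x156431702 113; mke 0x164532701 114];
  [::];
  [:: mke 0x115302647 78; mke 0x156431702 107; mke 0x164532701 118; mke 0x164537120 123];
  [:: mke 0x165431702 111; mke 0x143651702 111];
  [:: mke 0x136210574 77];
  [:: mke 0x146531702 121; mke 0x145631702 121];
  [:: mke 0x145326710 32; mke 0x145106732 32; mke 0x123106754 32; mke 0x176543210 188; mke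
    0x165432710 69; mke 0x165410732 69; mke 0x163210754 69; mke 0x176543210 189];
  [:: mke 0x145326710 37; mke 0x145106732 37; mke 0x165432710 58; mke 0x165410732 58; mke
    0x123106754 37; mke 0x163210754 58; mke 0x167543210 189; mke 0x145326710 41; mke 0x145106732
    41; mke 0x123106754 41; mke 0x176543210 190; mke 0x176543210 192; mke 0x176325410 192; mke
    0x176105432 192];
  [:: mke 0x162345107 11; mke 0x160145327 11; mke 0x132106475 32; mke 0x131206745 43; mke
    0x176543210 194; mke 0x156432710 70; mke 0x156410732 70; mke 0x163210754 81; mke 0x176543210
    195; mke 0x163210745 168; mke 0x161032745 168; mke 0x176543210 196];
  [:: mke 0x162345107 12; mke 0x160145327 12; mke 0x132106475 37; mke 0x132610754 132; mke
    0x110632754 132; mke 0x163120754 71; mke 0x167543210 195; mke 0x132106745 49; mke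
    0x176543210 197; mke 0x132610754 149; mke 0x110632754 149; mke 0x176543210 198; mke
    0x132610745 156; mke 0x110632745 156];
  [:: mke 0x162354107 13; mke 0x160154327 13; mke 0x163210574 58; mke 0x163210745 135; mke
    0x161032745 135; mke 0x167543210 196; mke 0x131206745 46; mke 0x145632710 68; mke
    0x145610732 68; mke 0x167543210 198; mke 0x131206745 52; mke 0x176543210 201; mke
    0x132610754 163; mke 0x110632754 163];
  [:: mke 0x176543210 203; mke 0x121304657 43; mke 0x131204657 43; mke 0x176543210 204; mke
    0x176542310 204; mke 0x141320765 89];
  [:: mke 0x165432710 61; mke 0x165410732 61; mke 0x153210674 81; mke 0x167543210 204; mke
    0x164752310 196; mke 0x123546710 19; mke 0x101546732 19; mke 0x132105476 41; mke 0x132105476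
    49; mke 0x132107564 201; mke 0x132510764 134; mke 0x132510764 147; mke 0x132510746 153; mke
    0x110532746 153];
  [:: mke 0x165432710 59; mke 0x165423710 59; mke 0x165410732 59; mke 0x165401732 59; mke
    0x165743210 195; mke 0x165742310 195; mke 0x141320675 89; mke 0x176543210 207; mke
    0x123104567 49; mke 0x132104567 49; mke 0x123410576 149; mke 0x132410576 149; mke
    0x101432576 149; mke 0x110432576 149; mke 0x123410675 147; mke 0x132410675 147];
  [:: mke 0x145106732 39; mke 0x165432710 62; mke 0x167543210 205; mke 0x167452310 205; mke
    0x145106732 42; mke 0x167542310 206; mke 0x167453210 206; mke 0x154763210 191; mke
    0x176543210 209; mke 0x167543210 208; mke 0x167452310 208];
  [:: mke 0x162130547 71; mke 0x165472310 204; mke 0x131206547 46; mke 0x154763210 192; mke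
    0x113206754 55; mke 0x113207654 207; mke 0x113206547 84; mke 0x176543210 213; mke
    0x131026547 84; mke 0x176453210 213];
  [:: mke 0x152364710 20; mke 0x150164732 20; mke 0x153210674 69; mke 0x164572310 196; mke
    0x154632710 67; mke 0x154610732 67; mke 0x131205476 52; mke 0x176543210 215; mke 0x132510764
    161];
  [:: mke 0x152364710 21; mke 0x150164732 21; mke 0x164235710 34; mke 0x164015732 34; mke
    0x164235710 35; mke 0x164015732 35; mke 0x152310647 81; mke 0x164572310 195; mke 0x152310674
    168; mke 0x150132674 168; mke 0x164753210 189; mke 0x154632710 66; mke 0x154610732 66; mke
    0x131205467 52; mke 0x113205476 55; mke 0x176543210 216; mke 0x132510674 161; mke
    0x132510476 25; mke 0x176543210 217; mke 0x110532476 25; mke 0x167453210 217; mke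
    0x113205764 170];
  [:: mke 0x165432710 63; mke 0x165410732 63; mke 0x165742310 199; mke 0x165743210 208; mke
    0x165741032 208; mke 0x165743210 200; mke 0x164753210 199; mke 0x164752310 208; mke
    0x164750132 208; mke 0x164752310 200; mke 0x154321076 191; mke 0x154763210 212];
  [:: mke 0x160154732 22; mke 0x165432710 64; mke 0x154236710 38; mke 0x123610574 156; mke
    0x110632574 163; mke 0x113206745 84; mke 0x165743210 217; mke 0x145236710 38; mke
    0x123610475 156; mke 0x110632475 163; mke 0x113206754 84; mke 0x164753210 217; mke
    0x123610574 153; mke 0x123610475 153; mke 0x154327610 192; mke 0x110632754 25; mke
    0x154763210 213];
  [:: mke 0x165234710 40; mke 0x165014732 40; mke 0x156234710 40; mke 0x156014732 40; mke
    0x165743210 193; mke 0x165743210 214; mke 0x164572310 200; mke 0x164753210 202; mke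
    0x154672310 200; mke 0x154763210 202];
  [:: mke 0x153246710 11; mke 0x154601723 11; mke 0x150132764 11; mke 0x176543210 218; mke
    0x165432710 82; mke 0x165432701 169; mke 0x115046723 82; mke 0x145610732 186; mke
    0x176543210 219; mke 0x125301746 169; mke 0x135264701 186; mke 0x115046732 169; mke
    0x125301764 82; mke 0x176543210 220; mke 0x105123746 186];
  [:: mke 0x164523170 59; mke 0x164523071 59; mke 0x164510327 14; mke 0x164501327 14; mke
    0x164510723 141; mke 0x167452310 219; mke 0x167452301 219; mke 0x110546273 151; mke
    0x101546273 151; mke 0x110327564 213; mke 0x101523476 150; mke 0x110523476 150; mke
    0x135246170 155; mke 0x135246071 155; mke 0x101532674 144; mke 0x110532674 144];
  [:: mke 0x154326071 39; mke 0x163254710 174; mke 0x165410732 140; mke 0x164510723 140; mke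
    0x154326701 51; mke 0x154632701 157; mke 0x145061732 173; mke 0x154061723 173; mke
    0x154327610 199; mke 0x132546710 185; mke 0x110546372 184; mke 0x110456273 184];
  [:: mke 0x165432170 61; mke 0x165410237 15; mke 0x163254701 175; mke 0x165410732 138; mke
    0x125301674 82; mke 0x167452310 220; mke 0x153246710 18; mke 0x154632710 162; mke
    0x101564372 68; mke 0x101532764 144; mke 0x101564723 137; mke 0x125301746 167; mke
    0x101532476 19; mke 0x176543210 223];
  [:: mke 0x165432170 62; mke 0x163254701 176; mke 0x165410732 139; mke 0x164510723 139; mke
    0x101654732 88; mke 0x167543210 221; mke 0x167452310 221; mke 0x135246170 179; mke
    0x153627410 224; mke 0x142637510 224; mke 0x153427610 206];
  [:: mke 0x163245710 12; mke 0x164532710 129; mke 0x164501723 12; mke 0x160145723 129; mke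
    0x165743210 219; mke 0x160132754 12; mke 0x163201754 129; mke 0x101623754 150; mke
    0x145160372 172; mke 0x176543210 225; mke 0x145610723 150; mke 0x132654710 150; mke
    0x132564071 172; mke 0x101263475 172];
  [:: mke 0x165423701 13; mke 0x161054732 13; mke 0x165410732 130; mke 0x162354701 130; mke
    0x162310745 13; mke 0x161023745 130; mke 0x165743210 220; mke 0x136254701 80; mke
    0x146510732 80; mke 0x101623754 166; mke 0x145610723 166; mke 0x132654710 166; mke
    0x106123745 80; mke 0x153421076 223];
  [:: mke 0x164523071 14; mke 0x151064273 21; mke 0x164325071 34; mke 0x164501723 14; mke
    0x163425701 45; mke 0x101564273 160; mke 0x165472310 219; mke 0x115023674 169; mke
    0x164327510 195; mke 0x154362710 75; mke 0x151046273 164; mke 0x145610723 158; mke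
    0x120317564 217; mke 0x135246071 158; mke 0x135201674 143; mke 0x141605723 187; mke
    0x176543210 227; mke 0x150132467 24; mke 0x153201674 142];
  [:: mke 0x165423701 15; mke 0x151064273 20; mke 0x125364701 159; mke 0x115032674 70; mke
    0x165472310 220; mke 0x153264071 67; mke 0x145610372 80; mke 0x135201764 143; mke
    0x145610723 165; mke 0x153201467 18; mke 0x176543210 228];
  [:: mke 0x164523071 15; mke 0x165104273 35; mke 0x134265701 23; mke 0x124365071 159; mke
    0x161504273 45; mke 0x165107432 196; mke 0x101465723 160; mke 0x134201657 82; mke
    0x104132675 186; mke 0x134256107 80; mke 0x134256071 165; mke 0x141065273 66; mke
    0x167543210 227; mke 0x145610723 164; mke 0x142310576 24; mke 0x141023765 142; mke
    0x176543210 229; mke 0x141023576 18];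
  [:: mke 0x161054273 22; mke 0x165432170 64; mke 0x165410732 131; mke 0x135246107 45; mke
    0x101623574 166; mke 0x156410723 155; mke 0x165743210 227; mke 0x134256107 45; mke
    0x101623475 166; mke 0x146510723 155; mke 0x164753210 227; mke 0x132654170 141; mke
    0x136210574 138; mke 0x136210475 138; mke 0x135427610 204; mke 0x106132547 23];
  [:: mke 0x165432170 63; mke 0x165432701 136; mke 0x164510327 17; mke 0x156041273 173; mke
    0x165472310 221; mke 0x156410732 148; mke 0x165743210 226; mke 0x146051372 173; mke
    0x164573210 221; mke 0x146510723 148; mke 0x164752310 226; mke 0x135246170 177; mke
    0x153421076 206];
  [:: mke 0x165104273 38; mke 0x124356071 167; mke 0x156243710 172; mke 0x110654372 38; mke
    0x165107432 198; mke 0x134201576 167; mke 0x156410723 151; mke 0x142310756 24; mke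
    0x143265701 24; mke 0x143265071 162; mke 0x101465732 151; mke 0x146150372 75; mke
    0x164573210 227; mke 0x101342765 172; mke 0x135260174 227; mke 0x142310576 162];
  [:: mke 0x165423701 17; mke 0x165104273 40; mke 0x165410732 133; mke 0x165104723 50; mke
    0x165107432 200; mke 0x156410732 146; mke 0x156410723 152; mke 0x146532710 145; mke
    0x146352071 171; mke 0x164572310 226; mke 0x135264710 181; mke 0x153421076 224];
  [:: mke 0x165104273 42; mke 0x165243701 171; mke 0x156243710 171; mke 0x165104273 51; mke
    0x165107432 202; mke 0x165472310 224; mke 0x142536710 224; mke 0x165410723 154; mke
    0x136542710 83];
  [:: mke 0x162534071 139; mke 0x162534170 140; mke 0x161053472 205; mke 0x165210473 139; mke
    0x165210374 140; mke 0x164327510 205; mke 0x154362170 86; mke 0x145326170 181; mke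
    0x154637201 221; mke 0x120165374 86; mke 0x154327610 208; mke 0x102156374 181; mke
    0x120617543 221; mke 0x120156743 208];
  [:: mke 0x165234170 152; mke 0x165234071 152; mke 0x156234170 152; mke 0x156234071 152; mke
    0x165104372 214; mke 0x156102347 51; mke 0x165102347 51; mke 0x101652374 185; mke
    0x110652374 185];
  [:: mke 0x156243071 154; mke 0x156243071 157; mke 0x110654372 209; mke 0x165210473 148; mke
    0x165201473 145; mke 0x156210374 148; mke 0x156201374 145; mke 0x120615734 221; mke
    0x120516743 221; mke 0x146352710 177; mke 0x120165743 86; mke 0x110526743 184; mke
    0x164321075 208; mke 0x164230175 221; mke 0x110625734 184; mke 0x153421076 208; mke
    0x153240176 221];
  [:: mke 0x165104372 212; mke 0x156012437 50; mke 0x156102437 50; mke 0x165201473 146; mke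
    0x165210473 146; mke 0x156201374 146; mke 0x156210374 146; mke 0x146352710 179; mke
    0x146352701 179; mke 0x164230157 221; mke 0x164231057 221; mke 0x153240167 221; mke
    0x153241067 221];
  [:: mke 0x154326170 182; mke 0x145326071 182; mke 0x154673210 231; mke 0x154236071 182; mke
    0x145236170 182; mke 0x145672310 231; mke 0x123657410 230; mke 0x132647510 230; mke
    0x154327610 210];
  [:: mke 0x132564710 178; mke 0x156342701 183; mke 0x123564701 178; mke 0x156243710 183; mke
    0x132657410 231; mke 0x165321074 222; mke 0x132465701 178; mke 0x146352710 183; mke
    0x123465710 178; mke 0x146253701 183; mke 0x123647510 231; mke 0x164231075 222; mke
    0x132541076 210];
  [:: mke 0x156437201 222; mke 0x156201473 231; mke 0x156427310 222; mke 0x156310472 231; mke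
    0x165327410 211; mke 0x146352710 180; mke 0x146352701 182; mke 0x146253701 180; mke
    0x146253710 182; mke 0x164231057 222; mke 0x154321076 230];
  [:: mke 0x154321076 233; mke 0x121435076 233; mke 0x176543210 234; mke 0x167435210 234; mke
    0x153412076 233; mke 0x167524310 234; mke 0x142513076 233; mke 0x131524076 233; mke
    0x176452310 234; mke 0x167513420 234];
  [:: mke 0x165314072 232; mke 0x165743210 234; mke 0x134615072 232; mke 0x134756210 234; mke
    0x101546372 232; mke 0x101576432 234; mke 0x176543210 235; mke 0x173456210 235]].

Definition table8 : seq node := [::
  mkn [:: 3968; 3680; 2552; 3420; 2780; 2870; 3246]%positive 7680 3216 18211;
  mkn [:: 3968; 3680; 2552; 3420; 2780; 2870; 3253]%positive 7680 3216 18211;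
  mkn [:: 3968; 3680; 2552; 3420; 2780; 2870; 2891]%positive 7680 3216 18211;
  mkn [:: 3968; 3680; 2552; 3420; 2780; 2899; 3275]%positive 7680 3216 18211;
  mkn [:: 3968; 3680; 2552; 3420; 2906; 2773; 2861]%positive 7680 3216 18211;
  mkn [:: 3968; 3680; 2552; 3420; 2906; 2773; 3275]%positive 7680 3216 18211;
  mkn [:: 3968; 3680; 2552; 3420; 2778; 2870; 3246]%positive 7632 3204 18135;
  mkn [:: 3968; 3680; 2552; 3420; 2534; 2773; 2861]%positive 7632 3204 18135;
  mkn [:: 3968; 3680; 2552; 3420; 2534; 2773; 2891]%positive 7632 3204 18135;
  mkn [:: 3968; 3680; 2552; 3420; 2534; 2899; 3275]%positive 7632 3204 18135;
  mkn [:: 3968; 3680; 2552; 3420; 2902; 2765; 3283]%positive 7632 3204 18135;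
  mkn [:: 3968; 3680; 2552; 3420; 2774; 2870; 3246]%positive 7936 3328 18613;
  mkn [:: 3968; 3680; 2552; 3420; 2774; 2870; 3253]%positive 7936 3328 18613;
  mkn [:: 3968; 3680; 2552; 3420; 2774; 2870; 2891]%positive 7936 3328 18613;
  mkn [:: 3968; 3680; 2552; 3420; 2774; 2862; 2869]%positive 7936 3328 18613;
  mkn [:: 3968; 3680; 2552; 3420; 2774; 2862; 2899]%positive 7936 3328 18613;
  mkn [:: 3968; 3680; 2552; 3420; 2774; 2869; 3411]%positive 7632 3204 18135;
  mkn [:: 3968; 3680; 2552; 3420; 2774; 2869; 2891]%positive 8208 3456 19036;
  mkn [:: 3968; 3680; 2552; 3420; 2774; 2899; 3275]%positive 7936 3328 18613;
  mkn [:: 3968; 3680; 2552; 3420; 2774; 2891; 3275]%positive 7936 3328 18613;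
  mkn [:: 3968; 3680; 2552; 3420; 2899; 3283; 3371]%positive 7936 3328 18613;
  mkn [:: 3968; 3680; 2552; 2534; 3413; 2773; 2861]%positive 7936 3328 18613;
  mkn [:: 3968; 3680; 2552; 2534; 3413; 2773; 2891]%positive 7936 3328 18613;
  mkn [:: 3968; 3680; 2552; 2534; 3413; 2741; 2893]%positive 7936 3328 18613;
  mkn [:: 3968; 3680; 2552; 2534; 3413; 2893; 2771]%positive 7936 3328 18613;
  mkn [:: 3968; 3680; 2552; 2534; 3413; 2765; 2771]%positive 7936 3328 18613;
  mkn [:: 3968; 3680; 2552; 3414; 2774; 2870; 3246]%positive 7680 3216 18211;
  mkn [:: 3968; 3680; 2552; 3414; 2774; 2870; 3253]%positive 7680 3216 18211;
  mkn [:: 3968; 3680; 2552; 3414; 2774; 2870; 2893]%positive 7680 3216 18211;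
  mkn [:: 3968; 3680; 2552; 3414; 2774; 2894; 3246]%positive 7680 3216 18211;
  mkn [:: 3968; 3680; 2552; 3414; 2774; 2894; 2869]%positive 7680 3216 18211;
  mkn [:: 3968; 3680; 2552; 3414; 2774; 2894; 3277]%positive 7680 3216 18211;
  mkn [:: 3968; 3680; 2552; 3414; 2774; 2862; 3246]%positive 7936 3328 18613;
  mkn [:: 3968; 3680; 2552; 3414; 2774; 2862; 2901]%positive 7680 3216 18211;
  mkn [:: 3968; 3680; 2552; 3414; 2774; 2862; 2869]%positive 7936 3328 18613;
  mkn [:: 3968; 3680; 2552; 3414; 2774; 2862; 2893]%positive 7936 3328 18613;
  mkn [:: 3968; 3680; 2552; 3414; 2774; 2901; 3277]%positive 7680 3216 18211;
  mkn [:: 3968; 3680; 2552; 3414; 2774; 2869; 3253]%positive 7936 3328 18613;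
  mkn [:: 3968; 3680; 2552; 3414; 2774; 2869; 2893]%positive 7936 3328 18613;
  mkn [:: 3968; 3680; 2552; 3414; 2774; 2869; 3251]%positive 8208 3456 19036;
  mkn [:: 3968; 3680; 2552; 3414; 2774; 2869; 2891]%positive 8208 3456 19036;
  mkn [:: 3968; 3680; 2552; 3414; 2774; 2893; 3277]%positive 7936 3328 18613;
  mkn [:: 3968; 3680; 2552; 3414; 2774; 2893; 3275]%positive 8208 3456 19036;
  mkn [:: 3968; 3680; 2552; 3414; 2742; 2894; 3246]%positive 7936 3328 18613;
  mkn [:: 3968; 3680; 2552; 3414; 2742; 2894; 2901]%positive 7680 3216 18211;
  mkn [:: 3968; 3680; 2552; 3414; 2742; 2894; 2773]%positive 7936 3328 18613;
  mkn [:: 3968; 3680; 2552; 3414; 2742; 2901; 3253]%positive 7936 3328 18613;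
  mkn [:: 3968; 3680; 2552; 3414; 2742; 2901; 3283]%positive 7632 3204 18135;
  mkn [:: 3968; 3680; 2552; 3414; 2894; 2901; 3277]%positive 7680 3216 18211;
  mkn [:: 3968; 3680; 2552; 3414; 2894; 2773; 3277]%positive 7936 3328 18613;
  mkn [:: 3968; 3680; 2552; 3414; 2894; 2773; 2867]%positive 8208 3456 19036;
  mkn [:: 3968; 3680; 2552; 3414; 2894; 2773; 3275]%positive 8208 3456 19036;
  mkn [:: 3968; 3680; 2552; 3414; 2766; 2901; 3277]%positive 7936 3328 18613;
  mkn [:: 3968; 3680; 2552; 3414; 2766; 2901; 3283]%positive 7632 3204 18135;
  mkn [:: 3968; 3680; 2552; 3414; 2766; 2901; 3403]%positive 7632 3204 18135;
  mkn [:: 3968; 3680; 2552; 3414; 2766; 2773; 3405]%positive 7936 3328 18613;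
  mkn [:: 3968; 3680; 3420; 2780; 2876; 2899; 3599]%positive 7680 3216 18211;
  mkn [:: 3968; 3680; 3420; 2780; 2906; 2869; 3599]%positive 7680 3216 18211;
  mkn [:: 3968; 3680; 3420; 2780; 2874; 3258; 3607]%positive 7936 3328 18613;
  mkn [:: 3968; 3680; 3420; 2780; 2874; 3254; 3257]%positive 7936 3328 18613;
  mkn [:: 3968; 3680; 3420; 2780; 2874; 3254; 3613]%positive 7680 3216 18211;
  mkn [:: 3968; 3680; 3420; 2780; 2874; 3254; 3611]%positive 7936 3328 18613;
  mkn [:: 3968; 3680; 3420; 2780; 2874; 3254; 3599]%positive 8208 3456 19036;
  mkn [:: 3968; 3680; 3420; 2780; 2874; 3257; 3607]%positive 8208 3456 19036;
  mkn [:: 3968; 3680; 3420; 2780; 2874; 2869; 3599]%positive 7936 3328 18613;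
  mkn [:: 3968; 3680; 3420; 2780; 2874; 3613; 2887]%positive 7680 3216 18211;
  mkn [:: 3968; 3680; 3420; 2780; 2874; 2899; 3599]%positive 7936 3328 18613;
  mkn [:: 3968; 3680; 3420; 2780; 2874; 3611; 2887]%positive 7936 3328 18613;
  mkn [:: 3968; 3680; 3420; 2780; 2874; 2887; 3607]%positive 7936 3328 18613;
  mkn [:: 3968; 3680; 3420; 2780; 2899; 3283; 3599]%positive 7936 3328 18613;
  mkn [:: 3968; 3680; 3420; 2780; 2899; 3275; 3607]%positive 7936 3328 18613;
  mkn [:: 3968; 3680; 3420; 2748; 2906; 3258; 3607]%positive 7936 3328 18613;
  mkn [:: 3968; 3680; 3420; 2748; 2906; 3286; 3599]%positive 7632 3204 18135;
  mkn [:: 3968; 3680; 3420; 2748; 2906; 3289; 3607]%positive 7632 3204 18135;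
  mkn [:: 3968; 3680; 3420; 2748; 2906; 2901; 3599]%positive 7680 3216 18211;
  mkn [:: 3968; 3680; 3420; 2748; 2906; 2773; 3599]%positive 7936 3328 18613;
  mkn [:: 3968; 3680; 3420; 2906; 3286; 3379; 3599]%positive 7632 3204 18135;
  mkn [:: 3968; 3680; 3420; 2906; 3289; 3379; 3599]%positive 7632 3204 18135;
  mkn [:: 3968; 3680; 3420; 2906; 2773; 2861; 3611]%positive 7632 3204 18135;
  mkn [:: 3968; 3680; 3420; 2906; 2773; 2861; 3399]%positive 7632 3204 18135;
  mkn [:: 3968; 3680; 3420; 2906; 2773; 2861; 3607]%positive 7936 3328 18613;
  mkn [:: 3968; 3680; 3420; 2906; 2773; 3283; 3599]%positive 7936 3328 18613;
  mkn [:: 3968; 3680; 3420; 2906; 2773; 3275; 3607]%positive 7936 3328 18613;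
  mkn [:: 3968; 3680; 3420; 2778; 2870; 3246; 3613]%positive 8208 3456 19036;
  mkn [:: 3968; 3680; 3420; 2778; 2870; 2873; 2773]%positive 7936 3328 18613;
  mkn [:: 3968; 3680; 3420; 2778; 2870; 2873; 3607]%positive 7632 3204 18135;
  mkn [:: 3968; 3680; 3420; 2778; 2870; 2873; 3599]%positive 8208 3456 19036;
  mkn [:: 3968; 3680; 3420; 2778; 3614; 2873; 2887]%positive 7632 3204 18135;
  mkn [:: 3968; 3680; 3420; 2778; 2873; 2887; 3607]%positive 8208 3456 19036;
  mkn [:: 3968; 3680; 3420; 2778; 2773; 3411; 3599]%positive 7936 3328 18613;
  mkn [:: 3968; 3184; 3048; 2902; 3630; 2869; 3405]%positive 7620 3204 18116;
  mkn [:: 3968; 3184; 3916; 2748; 2794; 2521; 3611]%positive 7620 3204 18116;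
  mkn [:: 3968; 3184; 3916; 2748; 2538; 2870; 2517]%positive 7620 3204 18116;
  mkn [:: 3968; 3184; 3916; 2748; 2538; 2870; 3627]%positive 7620 3204 18116;
  mkn [:: 3968; 3184; 3916; 2794; 2522; 2870; 2533]%positive 7620 3204 18116;
  mkn [:: 3968; 3184; 3916; 2794; 2522; 2870; 3371]%positive 7620 3204 18116;
  mkn [:: 3968; 3184; 3916; 2794; 2522; 2873; 2533]%positive 7620 3204 18116;
  mkn [:: 3968; 3184; 3916; 2794; 2522; 2533; 3371]%positive 7620 3204 18116;
  mkn [:: 3968; 3184; 3916; 2794; 2522; 3371; 3271]%positive 7620 3204 18116;
  mkn [:: 3968; 3184; 3916; 2794; 2874; 3230; 2521]%positive 7620 3204 18116;
  mkn [:: 3968; 3184; 3916; 2794; 2874; 3230; 3623]%positive 7620 3204 18116;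
  mkn [:: 3968; 3184; 3916; 2794; 2774; 2521; 3611]%positive 7620 3204 18116;
  mkn [:: 3968; 3184; 3916; 2794; 2870; 3230; 2773]%positive 7830 3321 18447;
  mkn [:: 3968; 3184; 3916; 2794; 2870; 3230; 3627]%positive 7620 3204 18116;
  mkn [:: 3968; 3184; 3916; 2794; 2870; 3230; 3371]%positive 7830 3321 18447;
  mkn [:: 3968; 3184; 3916; 2794; 2870; 3230; 3611]%positive 7620 3204 18116;
  mkn [:: 3968; 3184; 3916; 2794; 2870; 2873; 2533]%positive 7620 3204 18116;
  mkn [:: 3968; 3184; 3916; 2794; 2870; 2873; 2773]%positive 7620 3204 18116;
  mkn [:: 3968; 3184; 3916; 2794; 2870; 2533; 2899]%positive 7620 3204 18116;
  mkn [:: 3968; 3184; 3916; 2794; 2870; 2533; 3371]%positive 7830 3321 18447;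
  mkn [:: 3968; 3184; 3916; 2794; 2870; 2533; 3623]%positive 7620 3204 18116;
  mkn [:: 3968; 3184; 3916; 2794; 2870; 2773; 3611]%positive 7830 3321 18447;
  mkn [:: 3968; 3184; 3916; 2794; 2870; 2773; 3623]%positive 7620 3204 18116;
  mkn [:: 3968; 3184; 3916; 2794; 2870; 2899; 3371]%positive 7620 3204 18116;
  mkn [:: 3968; 3184; 3916; 2794; 2870; 3371; 3611]%positive 7620 3204 18116;
  mkn [:: 3968; 3184; 3916; 2794; 2537; 2899; 3271]%positive 7620 3204 18116;
  mkn [:: 3968; 3184; 3916; 2794; 2521; 2915; 3611]%positive 7620 3204 18116;
  mkn [:: 3968; 3184; 3916; 2794; 2521; 2915; 3271]%positive 7620 3204 18116;
  mkn [:: 3968; 3184; 3916; 2794; 2521; 3371; 3611]%positive 7620 3204 18116;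
  mkn [:: 3968; 3184; 3916; 2794; 2521; 3371; 3271]%positive 7830 3321 18447;
  mkn [:: 3968; 3184; 3916; 2794; 2873; 3245; 3611]%positive 7620 3204 18116;
  mkn [:: 3968; 3184; 3916; 2794; 2873; 2899; 3623]%positive 7620 3204 18116;
  mkn [:: 3968; 3184; 3916; 2794; 2773; 2915; 3611]%positive 7620 3204 18116;
  mkn [:: 3968; 3184; 3916; 2794; 2773; 3611; 3623]%positive 7620 3204 18116;
  mkn [:: 3968; 3184; 3916; 2794; 2915; 3611; 3271]%positive 7620 3204 18116;
  mkn [:: 3968; 3184; 3916; 2794; 2899; 3627; 3271]%positive 7620 3204 18116;
  mkn [:: 3968; 3184; 3916; 2794; 2899; 3371; 3271]%positive 7830 3321 18447;
  mkn [:: 3968; 3184; 3916; 2794; 2899; 3371; 3623]%positive 7620 3204 18116;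
  mkn [:: 3968; 3184; 3916; 2794; 2899; 3611; 3271]%positive 7620 3204 18116;
  mkn [:: 3968; 3184; 2924; 2780; 2490; 3246; 3357]%positive 7872 3328 18513;
  mkn [:: 3968; 3184; 2924; 2780; 2490; 3246; 2787]%positive 7872 3328 18513;
  mkn [:: 3968; 3184; 2924; 2780; 2490; 2485; 2787]%positive 7872 3328 18513;
  mkn [:: 3968; 3184; 2924; 2780; 2490; 3245; 3357]%positive 7872 3328 18513;
  mkn [:: 3968; 3184; 2924; 2780; 2490; 3245; 2787]%positive 8100 3456 18869;
  mkn [:: 3968; 3184; 2924; 2780; 2490; 2787; 2899]%positive 7872 3328 18513;
  mkn [:: 3968; 3184; 2924; 2780; 3246; 3358; 3659]%positive 7872 3328 18513;
  mkn [:: 3968; 3184; 2924; 2780; 3246; 3357; 3659]%positive 8100 3456 18869;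
  mkn [:: 3968; 3184; 2924; 2780; 3246; 2787; 3659]%positive 7872 3328 18513;
  mkn [:: 3968; 3184; 2924; 2794; 2518; 3614; 2773]%positive 7872 3328 18513;
  mkn [:: 3968; 3184; 2924; 2794; 2518; 3614; 2741]%positive 8100 3456 18869;
  mkn [:: 3968; 3184; 2924; 2794; 2518; 3614; 3277]%positive 8100 3456 18869;
  mkn [:: 3968; 3184; 2924; 2794; 2518; 3614; 3655]%positive 7872 3328 18513;
  mkn [:: 3968; 3184; 2924; 2794; 2518; 2521; 2741]%positive 7872 3328 18513;
  mkn [:: 3968; 3184; 2924; 2794; 2518; 2489; 2773]%positive 7872 3328 18513;
  mkn [:: 3968; 3184; 2924; 2794; 2518; 2489; 2741]%positive 7872 3328 18513;
  mkn [:: 3968; 3184; 2924; 2794; 2518; 2489; 3277]%positive 8100 3456 18869;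
  mkn [:: 3968; 3184; 2924; 2794; 2518; 2741; 3277]%positive 8100 3456 18869;
  mkn [:: 3968; 3184; 2924; 2794; 2518; 2741; 2867]%positive 7872 3328 18513;
  mkn [:: 3968; 3184; 2924; 2794; 2518; 2741; 3655]%positive 8100 3456 18869;
  mkn [:: 3968; 3184; 2924; 2794; 2518; 3277; 3403]%positive 7872 3328 18513;
  mkn [:: 3968; 3184; 2924; 2794; 2518; 3277; 3655]%positive 7872 3328 18513;
  mkn [:: 3968; 3184; 2924; 2794; 3614; 2773; 3277]%positive 7872 3328 18513;
  mkn [:: 3968; 3184; 2924; 2794; 3614; 2773; 3245]%positive 8100 3456 18869;
  mkn [:: 3968; 3184; 2924; 2794; 3614; 2773; 2899]%positive 7872 3328 18513;
  mkn [:: 3968; 3184; 2924; 2794; 3614; 2773; 2867]%positive 8100 3456 18869;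
  mkn [:: 3968; 3184; 2924; 2794; 3614; 2773; 3623]%positive 7872 3328 18513;
  mkn [:: 3968; 3184; 2924; 2794; 3614; 3277; 3403]%positive 7872 3328 18513;
  mkn [:: 3968; 3184; 2924; 2794; 3614; 3277; 3371]%positive 8100 3456 18869;
  mkn [:: 3968; 3184; 2924; 2794; 3614; 3277; 3623]%positive 7872 3328 18513;
  mkn [:: 3968; 3184; 2924; 2794; 2521; 2741; 3277]%positive 7872 3328 18513;
  mkn [:: 3968; 3184; 2924; 2794; 2521; 2741; 3245]%positive 7872 3328 18513;
  mkn [:: 3968; 3184; 2924; 2794; 2521; 2741; 2867]%positive 7872 3328 18513;
  mkn [:: 3968; 3184; 2924; 2794; 2521; 3277; 3371]%positive 7872 3328 18513;
  mkn [:: 3968; 3184; 2924; 2794; 2521; 3245; 3371]%positive 7872 3328 18513;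
  mkn [:: 3968; 3184; 2924; 2794; 2773; 3277; 3623]%positive 7872 3328 18513;
  mkn [:: 3968; 3184; 2924; 2794; 2773; 3245; 3655]%positive 7872 3328 18513;
  mkn [:: 3968; 3184; 2924; 2794; 2773; 3245; 3623]%positive 7872 3328 18513;
  mkn [:: 3968; 3184; 2924; 2794; 2773; 2867; 3655]%positive 7872 3328 18513;
  mkn [:: 3968; 3184; 2924; 2794; 3277; 3403; 3623]%positive 7872 3328 18513;
  mkn [:: 3968; 3184; 2924; 2794; 3277; 3371; 3655]%positive 7872 3328 18513;
  mkn [:: 3968; 3184; 2924; 2778; 2486; 2489; 2773]%positive 7872 3328 18513;
  mkn [:: 3968; 3184; 2924; 2778; 3406; 2517; 3613]%positive 8100 3456 18869;
  mkn [:: 3968; 3184; 2924; 2778; 3406; 3613; 3627]%positive 7872 3328 18513;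
  mkn [:: 3968; 3184; 2924; 2778; 3406; 2531; 3627]%positive 8100 3456 18869;
  mkn [:: 3968; 3184; 2924; 2778; 3246; 3358; 2489]%positive 8100 3456 18869;
  mkn [:: 3968; 3184; 2924; 2778; 3246; 3358; 3661]%positive 7872 3328 18513;
  mkn [:: 3968; 3184; 2924; 2778; 3246; 3358; 3655]%positive 8100 3456 18869;
  mkn [:: 3968; 3184; 2924; 2778; 3246; 2489; 3277]%positive 8100 3456 18869;
  mkn [:: 3968; 3184; 2924; 2778; 3246; 2489; 3613]%positive 8262 3564 19120;
  mkn [:: 3968; 3184; 2924; 2778; 3246; 2741; 3277]%positive 8100 3456 18869;
  mkn [:: 3968; 3184; 2924; 2778; 3246; 2741; 2531]%positive 8262 3564 19120;
  mkn [:: 3968; 3184; 2924; 2778; 3246; 2741; 3627]%positive 8100 3456 18869;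
  mkn [:: 3968; 3184; 2924; 2778; 3246; 2741; 3655]%positive 8262 3564 19120;
  mkn [:: 3968; 3184; 2924; 2778; 3246; 3613; 3403]%positive 8262 3564 19120;
  mkn [:: 3968; 3184; 2924; 2778; 3246; 3613; 3655]%positive 8100 3456 18869;
  mkn [:: 3968; 3184; 2924; 2778; 2517; 3403; 3655]%positive 8100 3456 18869;
  mkn [:: 3968; 3184; 2924; 3662; 3245; 2787; 3371]%positive 7872 3328 18513;
  mkn [:: 3968; 3184; 2924; 3278; 3613; 3403; 3623]%positive 7872 3328 18513;
  mkn [:: 3968; 3704; 2552; 3430; 2790; 2846; 3230]%positive 8192 3328 19011;
  mkn [:: 3968; 3704; 2552; 3430; 2790; 2846; 2901]%positive 8192 3328 19011;
  mkn [:: 3968; 3704; 2552; 3430; 2790; 2901; 3285]%positive 8192 3328 19011;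
  mkn [:: 3968; 3704; 2552; 3430; 2790; 2901; 3253]%positive 8448 3456 19405;
  mkn [:: 3968; 3704; 2552; 3430; 2790; 2901; 2861]%positive 8192 3328 19011;
  mkn [:: 3968; 3704; 2552; 3430; 2790; 2901; 2859]%positive 8448 3456 19405;
  mkn [:: 3968; 3704; 2552; 3430; 2902; 2734; 3230]%positive 8192 3328 19011;
  mkn [:: 3968; 3704; 2552; 3430; 2902; 2734; 2789]%positive 8192 3328 19011;
  mkn [:: 3968; 3704; 2552; 3430; 2902; 2734; 2861]%positive 8192 3328 19011;
  mkn [:: 3968; 3704; 2552; 3430; 2902; 2789; 3285]%positive 8192 3328 19011;
  mkn [:: 3968; 3704; 2552; 3430; 2902; 2789; 2861]%positive 8192 3328 19011;
  mkn [:: 3968; 3704; 2552; 3430; 2902; 2789; 3283]%positive 8448 3456 19405;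
  mkn [:: 3968; 3704; 2552; 3430; 2902; 2789; 2859]%positive 8448 3456 19405;
  mkn [:: 3968; 3704; 2552; 3430; 2902; 2861; 3357]%positive 8192 3328 19011;
  mkn [:: 3968; 3704; 2552; 3430; 2902; 2861; 3355]%positive 8448 3456 19405;
  mkn [:: 3968; 3704; 2552; 3430; 2774; 2734; 3358]%positive 8192 3328 19011;
  mkn [:: 3968; 3704; 2552; 3430; 2774; 2734; 2917]%positive 8192 3328 19011;
  mkn [:: 3968; 3704; 2552; 3430; 2774; 2734; 2869]%positive 8448 3456 19405;
  mkn [:: 3968; 3704; 2552; 3430; 2774; 2917; 3253]%positive 8448 3456 19405;
  mkn [:: 3968; 3704; 2552; 3430; 2774; 2789; 3413]%positive 8192 3328 19011;
  mkn [:: 3968; 3704; 2552; 3430; 2774; 2789; 2867]%positive 8448 3456 19405;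
  mkn [:: 3968; 3704; 2552; 3430; 2774; 2869; 2893]%positive 8448 3456 19405;
  mkn [:: 3968; 3704; 2552; 3430; 2774; 2869; 3251]%positive 8640 3564 19698;
  mkn [:: 3968; 3704; 2552; 3430; 2774; 2869; 2891]%positive 8640 3564 19698;
  mkn [:: 3968; 3704; 2552; 3430; 3358; 2901; 3283]%positive 8448 3456 19405;
  mkn [:: 3968; 3704; 2552; 3430; 3358; 2901; 2867]%positive 8192 3328 19011;
  mkn [:: 3968; 3704; 2552; 3430; 3358; 2901; 2859]%positive 8448 3456 19405;
  mkn [:: 3968; 3704; 2552; 3430; 2846; 2917; 3357]%positive 8192 3328 19011;
  mkn [:: 3968; 3704; 2552; 3430; 2846; 3413; 2861]%positive 8192 3328 19011;
  mkn [:: 3968; 3704; 2552; 3430; 2846; 3413; 2867]%positive 8192 3328 19011;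
  mkn [:: 3968; 3704; 3444; 2538; 2774; 2862; 3230]%positive 8192 3328 19011;
  mkn [:: 3968; 3704; 3444; 2538; 2774; 2862; 2789]%positive 8192 3328 19011;
  mkn [:: 3968; 3704; 3444; 2538; 2774; 2862; 2899]%positive 8192 3328 19011;
  mkn [:: 3968; 3704; 3444; 2538; 2774; 2521; 2867]%positive 8448 3456 19405;
  mkn [:: 3968; 3704; 3444; 2538; 2774; 2893; 2867]%positive 8640 3564 19698;
  mkn [:: 3968; 3704; 3444; 2538; 2774; 2915; 3283]%positive 8192 3328 19011;
  mkn [:: 3968; 3704; 3444; 2538; 2774; 2915; 3251]%positive 8448 3456 19405;
  mkn [:: 3968; 3704; 3444; 2538; 2894; 2789; 3277]%positive 8192 3328 19011;
  mkn [:: 3968; 3704; 3444; 2538; 2894; 2789; 2867]%positive 8448 3456 19405;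
  mkn [:: 3968; 3704; 3444; 2538; 2846; 2521; 2867]%positive 8192 3328 19011;
  mkn [:: 3968; 3704; 3444; 2538; 2846; 2915; 3355]%positive 8192 3328 19011;
  mkn [:: 3968; 3704; 3444; 2538; 2846; 2899; 3371]%positive 8192 3328 19011;
  mkn [:: 3968; 3704; 3444; 2538; 2789; 2899; 3251]%positive 8640 3564 19698;
  mkn [:: 3968; 3704; 2548; 2538; 3358; 2893; 3245]%positive 8640 3564 19698;
  mkn [:: 3968; 3704; 2548; 3406; 2734; 2845; 2915]%positive 8748 3645 19862;
  mkn [:: 3968; 3704; 2548; 3406; 2765; 2915; 3283]%positive 8748 3645 19862;
  mkn [:: 4064; 3868; 3290; 2742; 2414; 2489; 3189]%positive 8748 3645 19862;
  mkn [:: 4064; 3868; 3290; 2742; 2489; 3189; 3627]%positive 8748 3645 19862].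

Definition edges8 : seq (seq edge) := [::
  [::];
  [::];
  [::];
  [::];
  [::];
  [::];
  [::];
  [::];
  [::];
  [::];
  [::];
  [:: mke 0x1765843210 1];
  [:: mke 0x1876543210 8];
  [:: mke 0x1765843210 2];
  [:: mke 0x1765843021 0; mke 0x1876543210 10];
  [:: mke 0x1765843210 3; mke 0x1785643120 10];
  [::];
  [::];
  [:: mke 0x1765843210 4];
  [:: mke 0x1765843210 5];
  [:: mke 0x1765843210 6];
  [:: mke 0x1756483102 1; mke 0x1765483210 6; mke 0x1785643210 11; mke 0x1785643210 13; mke
    0x1786534210 14];
  [:: mke 0x1765483102 2; mke 0x1567483210 5; mke 0x1765384102 2; mke 0x1567384210 5; mke
    0x1786543210 12; mke 0x1785643210 15; mke 0x1785634210 15];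
  [:: mke 0x1658743210 13; mke 0x1658743120 13; mke 0x1876543210 21];
  [:: mke 0x1675384102 3; mke 0x1756384201 4; mke 0x1768543120 14; mke 0x1758643210 15; mke
    0x1785643210 23];
  [:: mke 0x1765843102 21; mke 0x1567843201 23; mke 0x1567843210 23];
  [::];
  [::];
  [::];
  [::];
  [::];
  [::];
  [::];
  [::];
  [:: mke 0x1320176854 11; mke 0x1310254678 23; mke 0x1876543210 26];
  [:: mke 0x1320176854 13; mke 0x1310254687 23; mke 0x1786543210 26];
  [::];
  [::];
  [:: mke 0x1310254867 23; mke 0x1320176854 15];
  [::];
  [::];
  [::];
  [::];
  [::];
  [::];
  [:: mke 0x1321075486 13; mke 0x1301264587 15; mke 0x1876543210 27];
  [::];
  [::];
  [::];
  [::];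
  [::];
  [::];
  [::];
  [::];
  [::];
  [::];
  [::];
  [::];
  [::];
  [:: mke 0x1765438210 0; mke 0x1653478102 8; mke 0x1876543210 29];
  [::];
  [:: mke 0x1785634210 29];
  [::];
  [::];
  [:: mke 0x1720165843 12; mke 0x1107243658 21];
  [::];
  [:: mke 0x1720165843 14; mke 0x1107243856 21];
  [::];
  [::];
  [::];
  [::];
  [::];
  [::];
  [::];
  [::];
  [:: mke 0x1721064385 14; mke 0x1701253486 14];
  [::];
  [::];
  [::];
  [::];
  [::];
  [::];
  [::];
  [::];
  [::];
  [::];
  [::];
  [::];
  [::];
  [::];
  [::];
  [::];
  [::];
  [::];
  [::];
  [::];
  [::];
  [::];
  [::];
  [::];
  [::];
  [::];
  [::];
  [::];
  [::];
  [::];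
  [::];
  [::];
  [::];
  [::];
  [::];
  [::];
  [::];
  [::];
  [::];
  [::];
  [::];
  [::];
  [::];
  [::];
  [::];
  [::];
  [::];
  [::];
  [::];
  [::];
  [::];
  [::];
  [::];
  [::];
  [:: mke 0x1675438210 37; mke 0x1675348120 37];
  [:: mke 0x1765438210 33; mke 0x1765348120 33; mke 0x1756438210 33; mke 0x1756348120 33];
  [:: mke 0x1765438210 36; mke 0x1675438120 36];
  [:: mke 0x1675438210 35; mke 0x1675348120 35];
  [:: mke 0x1765438210 34; mke 0x1675438120 34; mke 0x1435768210 34; mke 0x1345768120 34];
  [:: mke 0x1765438210 39; mke 0x1756438120 39];
  [::];
  [:: mke 0x1756438210 38; mke 0x1756348120 38];
  [:: mke 0x1364752801 38];
  [::];
  [:: mke 0x1763548210 42];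
  [::];
  [::];
  [::];
  [::];
  [:: mke 0x1735468120 41];
  [::];
  [::];
  [::];
  [::];
  [::];
  [:: mke 0x1753648210 44];
  [:: mke 0x1765432801 35];
  [:: mke 0x1765432801 34];
  [::];
  [:: mke 0x1675432801 33];
  [:: mke 0x1765432801 36];
  [::];
  [::];
  [::];
  [::];
  [::];
  [::];
  [:: mke 0x1576432801 39];
  [::];
  [::];
  [:: mke 0x1657432801 37];
  [::];
  [::];
  [::];
  [::];
  [:: mke 0x1543761802 40];
  [::];
  [:: mke 0x1475632801 42];
  [::];
  [::];
  [:: mke 0x1765438210 43; mke 0x1756438120 43];
  [::];
  [::];
  [:: mke 0x1375641802 43];
  [::];
  [:: mke 0x1765348210 40];
  [::];
  [::];
  [:: mke 0x1574632801 41];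
  [::];
  [::];
  [::];
  [::];
  [:: mke 0x1453276810 16; mke 0x1451076832 16; mke 0x1231076854 16; mke 0x1132054687 25; mke
    0x1154032687 25; mke 0x1354210687 25; mke 0x1135420876 58];
  [::];
  [:: mke 0x1876543210 60; mke 0x1867453210 60; mke 0x1876325410 60; mke 0x1867235410 60];
  [:: mke 0x1132054876 25; mke 0x1231076854 19; mke 0x1135420876 31; mke 0x1315402876 31];
  [::];
  [::];
  [:: mke 0x1762345108 7; mke 0x1760145328 7; mke 0x1321076485 16; mke 0x1231054678 24; mke
    0x1632710845 57; mke 0x1610732845 57; mke 0x1235410786 51];
  [:: mke 0x1312076845 20; mke 0x1231054687 24; mke 0x1235410876 51];
  [::];
  [:: mke 0x1231054867 24; mke 0x1321076845 24];
  [:: mke 0x1327610854 50; mke 0x1107632854 50; mke 0x1326710845 50; mke 0x1106732845 50];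
  [:: mke 0x1327610854 53; mke 0x1107632854 53];
  [::];
  [::];
  [::];
  [:: mke 0x1213074658 20; mke 0x1321065487 19; mke 0x1326510874 45; mke 0x1632510847 56; mke
    0x1532610847 56];
  [:: mke 0x1786543210 61; mke 0x1786542310 62; mke 0x1654873210 60; mke 0x1876543210 63; mke
    0x1412307658 32];
  [:: mke 0x1768543210 62; mke 0x1548763210 62; mke 0x1327510864 48; mke 0x1325710846 48];
  [:: mke 0x1765432810 28; mke 0x1674532810 28; mke 0x1765410832 28; mke 0x1674510832 28];
  [:: mke 0x1765432810 30; mke 0x1412307856 32; mke 0x1321075684 63; mke 0x1327410586 50; mke
    0x1017432586 53; mke 0x1327410685 48; mke 0x1654328710 60; mke 0x1876543210 66];
  [:: mke 0x1768543210 63; mke 0x1768452310 63; mke 0x1547682310 62; mke 0x1457683210 62; mke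
    0x1768543210 66; mke 0x1768452310 66];
  [:: mke 0x1768543210 64; mke 0x1678453210 64];
  [:: mke 0x1768543210 65; mke 0x1768452310 65];
  [:: mke 0x1547863210 66; mke 0x1457863210 66; mke 0x1546872310 66; mke 0x1456872310 66];
  [:: mke 0x1523410786 56; mke 0x1523410687 56; mke 0x1310276548 9; mke 0x1132054786 28; mke
    0x1310267548 9; mke 0x1132054687 28];
  [::];
  [::];
  [:: mke 0x1752364810 17; mke 0x1750164832 17; mke 0x1642375810 17; mke 0x1640175832 17; mke
    0x1325710864 17; mke 0x1324610875 17; mke 0x1105732864 17; mke 0x1104632875 17];
  [:: mke 0x1750164832 18; mke 0x1642375810 18; mke 0x1401632785 57; mke 0x1523710684 57; mke
    0x1132075864 9; mke 0x1324610785 17; mke 0x1105732684 17; mke 0x1310264875 9];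
  [::];
  [:: mke 0x1753246810 7; mke 0x1754601823 7; mke 0x1750132864 7; mke 0x1610457382 55; mke
    0x1264357081 55; mke 0x1426301785 52; mke 0x1123057486 55];
  [:: mke 0x1426301875 52];
  [:: mke 0x1764523180 30; mke 0x1674510823 49; mke 0x1321075864 66; mke 0x1017523486 54; mke
    0x1352746180 49; mke 0x1537210684 46; mke 0x1536428710 62];
  [:: mke 0x1675410832 47; mke 0x1674510823 47; mke 0x1635247180 59];
  [::];
  [:: mke 0x1765410832 46; mke 0x1537201864 46];
  [::];
  [:: mke 0x1017623854 54; mke 0x1457610823 54; mke 0x1327654810 54];
  [:: mke 0x1751064283 18; mke 0x1634275801 22; mke 0x1132046875 55; mke 0x1457610823 55; mke
    0x1234601785 18; mke 0x1051723864 22];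
  [::];
  [:: mke 0x1372456180 22; mke 0x1160547382 22; mke 0x1051623784 22; mke 0x1243701685 22];
  [::];
  [:: mke 0x1762534081 47; mke 0x1672534180 47; mke 0x1761053482 65; mke 0x1764328510 64; mke
    0x1207165834 59];
  [::];
  [::];
  [::];
  [::]].

Definition table9 : seq node := [::
  mkn [:: 3968; 3680; 2552; 3420; 2780; 2870; 3246; 3253]%positive 18880 7936 43969;
  mkn [:: 3968; 3680; 2552; 3420; 2534; 2773; 2869; 3245]%positive 18672 7936 43726;
  mkn [:: 3968; 3680; 2552; 3420; 2534; 2773; 2869; 2891]%positive 18672 7936 43726;
  mkn [:: 3968; 3680; 2552; 3420; 2534; 2773; 2861; 2899]%positive 18672 7936 43726;
  mkn [:: 3968; 3680; 2552; 3420; 2534; 2773; 2899; 3275]%positive 18672 7936 43726;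
  mkn [:: 3968; 3680; 2552; 3420; 2534; 2773; 2891; 3275]%positive 18672 7936 43726;
  mkn [:: 3968; 3680; 2552; 3420; 2534; 2899; 3283; 3371]%positive 18672 7936 43726;
  mkn [:: 3968; 3680; 2552; 3420; 2774; 2870; 3246; 3253]%positive 19456 8192 44635;
  mkn [:: 3968; 3680; 2552; 3420; 2774; 2870; 3253; 3411]%positive 18672 7936 43726;
  mkn [:: 3968; 3680; 2552; 3420; 2774; 2862; 2869; 2765]%positive 19456 8192 44635;
  mkn [:: 3968; 3680; 2552; 3420; 2774; 2862; 2869; 2891]%positive 18672 7936 43726;
  mkn [:: 3968; 3680; 2552; 2534; 3413; 2773; 2869; 3245]%positive 18880 7936 43969;
  mkn [:: 3968; 3680; 2552; 2534; 3413; 2773; 2869; 2891]%positive 18880 7936 43969;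
  mkn [:: 3968; 3680; 2552; 2534; 3413; 2773; 2893; 3245]%positive 18880 7936 43969;
  mkn [:: 3968; 3680; 2552; 2534; 3413; 2773; 2893; 2867]%positive 18880 7936 43969;
  mkn [:: 3968; 3680; 2552; 2534; 3413; 2773; 2893; 3275]%positive 18880 7936 43969;
  mkn [:: 3968; 3680; 2552; 2534; 3413; 2773; 2861; 3245]%positive 19456 8192 44635;
  mkn [:: 3968; 3680; 2552; 2534; 3413; 2773; 2861; 2867]%positive 19456 8192 44635;
  mkn [:: 3968; 3680; 2552; 2534; 3413; 2773; 2861; 2891]%positive 19456 8192 44635;
  mkn [:: 3968; 3680; 2552; 2534; 3413; 2773; 2891; 3275]%positive 19456 8192 44635;
  mkn [:: 3968; 3680; 2552; 2534; 3413; 2741; 2893; 3245]%positive 19456 8192 44635;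
  mkn [:: 3968; 3680; 2552; 2534; 3413; 2741; 2893; 2899]%positive 18880 7936 43969;
  mkn [:: 3968; 3680; 2552; 2534; 3413; 2741; 2893; 2771]%positive 19456 8192 44635;
  mkn [:: 3968; 3680; 2552; 2534; 3413; 2893; 2899; 3275]%positive 18880 7936 43969;
  mkn [:: 3968; 3680; 2552; 2534; 3413; 2893; 2771; 3275]%positive 19456 8192 44635;
  mkn [:: 3968; 3680; 2552; 2534; 3413; 2765; 2771; 3403]%positive 19456 8192 44635;
  mkn [:: 3968; 3680; 2552; 3414; 2774; 2862; 2869; 2891]%positive 18672 7936 43726;
  mkn [:: 3968; 3680; 2552; 3414; 2742; 2894; 2773; 2867]%positive 18672 7936 43726;
  mkn [:: 3968; 3680; 3420; 2780; 2874; 3254; 3257; 2869]%positive 19456 8192 44635;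
  mkn [:: 3968; 3680; 3420; 2780; 2874; 3254; 3257; 3607]%positive 18672 7936 43726;
  mkn [:: 3968; 3680; 3420; 2780; 2874; 3254; 3257; 3599]%positive 19968 8448 45218;
  mkn [:: 3968; 3680; 3420; 2778; 2870; 2873; 2773; 3411]%positive 19456 8192 44635;
  mkn [:: 3968; 3680; 3420; 2778; 2870; 2873; 2773; 3599]%positive 19968 8448 45218;
  mkn [:: 3968; 3184; 3916; 2794; 2522; 2870; 2873; 2533]%positive 18560 7872 43595;
  mkn [:: 3968; 3184; 3916; 2794; 2522; 2870; 2533; 2773]%positive 18560 7872 43595;
  mkn [:: 3968; 3184; 3916; 2794; 2522; 2870; 2533; 3371]%positive 18900 8100 43992;
  mkn [:: 3968; 3184; 3916; 2794; 2522; 2870; 3371; 3611]%positive 18560 7872 43595;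
  mkn [:: 3968; 3184; 3916; 2794; 2522; 2873; 2533; 3371]%positive 18560 7872 43595;
  mkn [:: 3968; 3184; 3916; 2794; 2522; 2533; 3371; 3271]%positive 18560 7872 43595;
  mkn [:: 3968; 3184; 3916; 2794; 2522; 3371; 3611; 3271]%positive 18560 7872 43595;
  mkn [:: 3968; 3184; 3916; 2794; 2870; 3230; 2773; 3611]%positive 18900 8100 43992;
  mkn [:: 3968; 3184; 3916; 2794; 2870; 2533; 2899; 3371]%positive 18900 8100 43992;
  mkn [:: 3968; 3184; 3916; 2794; 2521; 2915; 3611; 3271]%positive 18900 8100 43992;
  mkn [:: 3968; 3184; 3916; 2794; 2521; 3371; 3611; 3271]%positive 18900 8100 43992;
  mkn [:: 3968; 3184; 3916; 2794; 2773; 2915; 3611; 3271]%positive 18560 7872 43595;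
  mkn [:: 3968; 3184; 2924; 2780; 2490; 2485; 2787; 2899]%positive 19200 8192 44340;
  mkn [:: 3968; 3184; 2924; 2794; 2518; 3614; 2773; 2867]%positive 19584 8448 44781;
  mkn [:: 3968; 3184; 2924; 2794; 2518; 3614; 2741; 3277]%positive 19764 8640 44987;
  mkn [:: 3968; 3184; 2924; 2794; 2518; 3614; 2741; 2867]%positive 19584 8448 44781;
  mkn [:: 3968; 3184; 2924; 2794; 2518; 3614; 2741; 3655]%positive 19584 8448 44781;
  mkn [:: 3968; 3184; 2924; 2794; 2518; 3614; 3277; 3403]%positive 19584 8448 44781;
  mkn [:: 3968; 3184; 2924; 2794; 2518; 2521; 2741; 2867]%positive 19200 8192 44340;
  mkn [:: 3968; 3184; 2924; 2794; 2518; 2489; 2773; 2867]%positive 19200 8192 44340;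
  mkn [:: 3968; 3184; 2924; 2794; 2518; 2489; 3277; 3403]%positive 19584 8448 44781;
  mkn [:: 3968; 3184; 2924; 2794; 2518; 2741; 3277; 3655]%positive 19584 8448 44781;
  mkn [:: 3968; 3184; 2924; 2794; 3614; 2773; 3277; 3623]%positive 19200 8192 44340;
  mkn [:: 3968; 3184; 2924; 2794; 3614; 2773; 2899; 3623]%positive 19200 8192 44340;
  mkn [:: 3968; 3184; 2924; 2794; 3614; 3277; 3403; 3623]%positive 19200 8192 44340;
  mkn [:: 3968; 3184; 2924; 2778; 2486; 2489; 2773; 2915]%positive 19200 8192 44340;
  mkn [:: 3968; 3184; 2924; 2778; 3246; 2741; 3277; 2531]%positive 19764 8640 44987;
  mkn [:: 3968; 3704; 2552; 3430; 2790; 2901; 3253; 3277]%positive 20480 8448 45794;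
  mkn [:: 3968; 3704; 2552; 3430; 2774; 2734; 3358; 2869]%positive 20480 8448 45794;
  mkn [:: 3968; 3704; 2552; 3430; 2774; 2734; 2917; 3253]%positive 20480 8448 45794;
  mkn [:: 3968; 3704; 2552; 3430; 2774; 2734; 2869; 2893]%positive 20480 8448 45794;
  mkn [:: 3968; 3704; 2552; 3430; 2774; 2734; 2869; 3251]%positive 20736 8640 46079;
  mkn [:: 3968; 3704; 2552; 3430; 2774; 2734; 2869; 2891]%positive 20736 8640 46079;
  mkn [:: 3968; 3704; 2552; 3430; 2774; 2789; 2867; 2891]%positive 20480 8448 45794].

Definition edges9 : seq (seq edge) := [::
  [::];
  [::];
  [::];
  [::];
  [::];
  [::];
  [::];
  [::];
  [::];
  [:: mke 0x17856439021 2; mke 0x18765943021 4];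
  [::];
  [::];
  [::];
  [::];
  [::];
  [::];
  [::];
  [:: mke 0x14873561092 2; mke 0x18795643210 5; mke 0x19876543210 7];
  [:: mke 0x18795643210 6; mke 0x18976543210 7];
  [::];
  [::];
  [::];
  [:: mke 0x18659743210 6; mke 0x17568934021 6];
  [::];
  [::];
  [:: mke 0x14876539102 3; mke 0x14785639102 3];
  [::];
  [::];
  [:: mke 0x18765439210 0; mke 0x18765439210 4];
  [::];
  [::];
  [:: mke 0x18765439210 1; mke 0x16783452109 3];
  [::];
  [::];
  [::];
  [::];
  [::];
  [::];
  [::];
  [::];
  [::];
  [::];
  [::];
  [::];
  [::];
  [:: mke 0x18765439210 10; mke 0x17865439120 10; mke 0x18756439210 10; mke 0x17856439120 10];
  [::];
  [::];
  [::];
  [::];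
  [::];
  [::];
  [::];
  [::];
  [::];
  [::];
  [:: mke 0x17685432901 10];
  [::];
  [::];
  [::];
  [:: mke 0x19876543210 12; mke 0x16134520987 9];
  [:: mke 0x17654983210 12; mke 0x11320986574 12; mke 0x19876543210 13; mke 0x19813206574 13];
  [:: mke 0x19876543210 14; mke 0x16325810947 11];
  [:: mke 0x11320876594 12; mke 0x18796542310 14; mke 0x14123087965 8];
  [:: mke 0x18796543210 13; mke 0x16235710849 11; mke 0x16325810749 11];
  [:: mke 0x18713206594 13];
  [:: mke 0x14123087695 8; mke 0x13281076594 14; mke 0x18327410695 11]].

(** With one row missing the pruning threshold is just below 102400, and every completion above it
    must match a leaf exactly. This rules out determinants beyond the bound. *)
Definition table10 : seq node := [::
  mkn [:: 3968; 3680; 2528; 3420; 2780; 2874; 3254; 3257; 2869]%positive 45056 19456 102399;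
  mkn [:: 3968; 3680; 2528; 3420; 2778; 2870; 2873; 2773; 3411]%positive 45056 19456 102399;
  mkn [:: 3968; 3680; 3408; 2540; 2780; 2874; 3254; 3257; 2869]%positive 45056 19456 102399;
  mkn [:: 3968; 3680; 3408; 2540; 2778; 2870; 2873; 2773; 2531]%positive 45056 19456 102399;
  mkn [:: 3968; 3680; 2552; 3420; 2780; 2870; 3246; 3253; 2861]%positive 46080 19456 102399;
  mkn [:: 3968; 3680; 2552; 2534; 3413; 2773; 2869; 3245; 3251]%positive 46080 19456 102399;
  mkn [:: 3968; 3680; 2552; 2534; 3413; 2773; 2893; 3245; 3275]%positive 46080 19456 102399;
  mkn [:: 3968; 3680; 2552; 2534; 3413; 2773; 2861; 2867; 2891]%positive 46080 19456 102399;
  mkn [:: 3968; 3680; 3420; 2780; 2874; 3254; 3257; 2869; 3599]%positive 48128 20480 102399;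
  mkn [:: 3968; 3680; 3420; 2778; 2870; 2873; 2773; 3411; 3599]%positive 48128 20480 102399;
  mkn [:: 3968; 3184; 3916; 2794; 2522; 2870; 2873; 2533; 2773]%positive 44800 19200 102399;
  mkn [:: 3968; 3184; 2924; 2794; 2518; 3614; 2741; 2867; 3655]%positive 46848 20480 102399;
  mkn [:: 3968; 3704; 2552; 3430; 2790; 2901; 3253; 3277; 2861]%positive 49152 20480 102399;
  mkn [:: 3968; 3704; 2552; 3430; 2774; 2734; 3358; 2869; 3251]%positive 49152 20480 102399;
  mkn [:: 3968; 3704; 2552; 3430; 2774; 2734; 2917; 3253; 3277]%positive 49152 20480 102399].

Definition edges10 : seq (seq edge) := [::
  [::];
  [:: mke 0x1789456a3210 0];
  [::];
  [:: mke 0x19876540a321 0];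
  [::];
  [::];
  [::];
  [::];
  [:: mke 0x19438675a102 1];
  [::];
  [:: mke 0x1798654a2301 2; mke 0x127659840a31 1];
  [:: mke 0x19876435a210 2];
  [::];
  [::];
  [:: mke 0x1789465231a0 2; mke 0x1789465320a1 2; mke 0x17651230498a 1; mke 0x14981230765a 1]].

(** The common volume 102400 is 327680^2 / 4^10. *)
Definition table11 : seq node := [::
  mkn [:: 3968; 3680; 2528; 3408; 2780; 2874; 3254; 3257; 2869; 2771]%positive 102400 45056 0;
  mkn [:: 3968; 3680; 3100; 2906; 2742; 2745; 2901; 3283; 3379; 3599]%positive 102400 44800 0;
  mkn [:: 3968; 3184; 3916; 2876; 2794; 2534; 3230; 2521; 2773; 3245]%positive 102400 44800 0].

(** * Classification *)

Section EquivSym.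
Local Open Scope ring_scope.
Variable n : nat.
Implicit Types A : 'M[int]_n.

Lemma hadamard_step_sym A A' : hadamard_step A A' -> hadamard_step A' A.
Proof.
case=> [s|s|k|k].
- have {2}-> : A = row_perm s^-1 (row_perm s A); last exact: HadamardRowPerm.
  by apply/matrixP => i j; rewrite !mxE permKV.
- have {2}-> : A = col_perm s^-1 (col_perm s A); last exact: HadamardColPerm.
  by apply/matrixP => i j; rewrite !mxE permKV.
- have {2}-> : A = neg_row k (neg_row k A); last exact: HadamardNegRow.
  by apply/matrixP => i j; rewrite !mxE; case: eqP => // _; rewrite opprK.
have {2}-> : A = neg_col k (neg_col k A); last exact: HadamardNegCol.
by apply/matrixP => i j; rewrite !mxE; case: eqP => // _; rewrite opprK.
Qed.

Lemma hadamard_equiv_sym A A' : hadamard_equiv A A' -> hadamard_equiv A' A.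
Proof.
elim=> [X Y /hadamard_step_sym|X|X Y Z _ H1 _ H2]; first exact: rt_step.
  exact: rt_refl.
exact: rt_trans H2 H1.
Qed.

Lemma hadamard_class_eq A A' : hadamard_equiv A A' -> hadamard_class A = hadamard_class A'.
Proof.
move=> E; apply/predeqP => B; split; last exact: rt_trans E.
exact: rt_trans (hadamard_equiv_sym E).
Qed.

Definition abs_gram A : rat :=
  \sum_i \sum_j `|rdot (row i (map_mx intr A)) (row j (map_mx intr A))|.

(** Row permutations reindex the outer sums, row negations change only signs of inner products, and
    column moves preserve all inner products of rows. *)
Lemma abs_gram_equiv A A' : hadamard_equiv A A' -> abs_gram A = abs_gram A'.
Proof.
elim=> [X Y [s|s|k|k]||X Y Z _ -> _ ->] //; rewrite /abs_gram.
- rewrite (reindex_perm s) /=; apply: eq_bigr => i _; rewrite (reindex_perm s) /=.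
  apply: eq_bigr => j _; congr (`|_|); apply: eq_bigr => l _; rewrite !mxE //.
- apply: eq_bigr => i _; apply: eq_bigr => j _; congr (`|_|).
  by rewrite /rdot (reindex_perm s) /=; apply: eq_bigr => l _; rewrite !mxE.
- apply: eq_bigr => i _; apply: eq_bigr => j _.
  pose e (i : 'I_n) : rat := (-1) ^+ (i == k).
  have -> : rdot (row i (map_mx intr (neg_row k X))) (row j (map_mx intr (neg_row k X))) =
            e i * e j * rdot (row i (map_mx intr X)) (row j (map_mx intr X)).
    rewrite /rdot mulr_sumr; apply: eq_bigr => l _; rewrite !mxE /e.
    by case: (i == k); case: (j == k); rewrite ?rmorphN /= ?expr0 ?expr1; ring.
  by rewrite !normrM !normr_sign !mul1r.
apply: eq_bigr => i _; apply: eq_bigr => j _; congr (`|_|).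
apply: eq_bigr => l _; rewrite !mxE; case: eqP => // _.
by rewrite !rmorphN /= mulrNN.
Qed.

End EquivSym.

Section Classification.
Local Open Scope ring_scope.

Lemma abs_gram_words B : size B = 11%N -> all (fun r => size r == 11%N) B ->
  abs_gram (sign_mx 11 B) = zr (abs_gram_sum B).
Proof.
move=> sB eB.
have rowE (i : 'I_11) : row i (map_mx intr (sign_mx 11 B)) = vec (nth [::] B i).
  by apply/rowP => j; rewrite !mxE.
have zr_abs x : zr (Z.abs x) = `|zr x| by rewrite /zr -intr_norm; congr (_%:~R); lia.
transitivity (\sum_(x <- B) \sum_(y <- B) `|ip x y|).
  rewrite (big_nth [::]) sB big_mkord; apply: eq_bigr => i _.
  by rewrite (big_nth [::]) sB big_mkord; apply: eq_bigr => j _; rewrite !rowE.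
have H x (C : seq bits) : size x = 11%N -> all (fun r => size r == 11%N) C ->
    zr (foldr (fun y t => Z.add (Z.abs (inner x y)) t) Z0 C) = \sum_(y <- C) `|ip x y|.
  move=> sx; elim: C => [|y C IH] /=; first by rewrite big_nil.
  by case/andP=> /eqP sy /IH E; rewrite zrD big_cons E zr_abs inner_ip.
suff H2 (C : seq bits) : all (fun r => size r == 11%N) C ->
    zr (foldr (fun x s => Z.add (foldr (fun y t => Z.add (Z.abs (inner x y)) t) Z0 B) s) Z0 C) =
    \sum_(x <- C) \sum_(y <- B) `|ip x y| by rewrite -H2.
elim: C => [|x C IH] /=; first by rewrite big_nil.
by case/andP=> /eqP sx /IH E; rewrite zrD big_cons E H.
Qed.

Lemma level_sound dmax L tbl nds ess :
  (forall D : int, dmax <= `|D| -> 4 ^+ 10 * zr 102400 <= (D%:~R : rat) ^+ 2) -> 0 < dmax ->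
  level_ok tbl (parity_words 11 false) nds ess ->
  (forall i, (i < size tbl)%N -> node_sound dmax L (nth node0 tbl i)) ->
  forall i, (i < size nds)%N -> node_sound dmax L (nth node0 nds i).
Proof.
move=> Hd d0 + sound; elim: nds ess => [|nd nds IH] [|es ess] //=.
case E: (node_ok _ _ _ _) => // /IH {}IH [|i] /=; last exact: IH.
by move=> _; apply: node_step E sound.
Qed.

Local Arguments Z.mul : simpl never.
Local Arguments Z.sub : simpl never.
Local Arguments Z.div : simpl never.

(** Each row multiplies the chain by its pivot, which is four times the ratio of the new volume to
    the old one. *)
Lemma last_volumeP pre rest d qA d' : (0 < size pre)%N ->
  all (fun r => size r == 11%N) (pre ++ rest) -> chain ip pre = 4 ^+ (size pre).-1 * zr d ->
  last_volume pre rest d qA = Some d' ->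
  chain ip (pre ++ rest) = 4 ^+ (size (pre ++ rest)).-1 * zr d'.
Proof.
elim: rest pre d qA => [|x rest IH] pre d [q A] pre0 sB cP /=; first by case=> <-; rewrite cats0.
case: ifP => // /and4P[/Z.eqb_eq qE inv /Z.eqb_eq cE d0] volE.
rewrite -cat_rcons; apply: IH volE; rewrite ?size_rcons ?cat_rcons //.
move: sB; rewrite all_cat /= => /and3P[sP /eqP sx _].
have d_gt0 : 0 < zr d by rewrite -zr_small zr_lt.
have q0 : zr q = 4 * zr d by rewrite qE zrM zr_small.
have nq : zr q != 0 by rewrite q0 mulf_eq0 negb_or pnatr_eq0; exact: lt0r_neq0 d_gt0.
have := form_inverse sP sx inv nq; rewrite q0 => /(scaled_pivot d_gt0) pE.
move/(congr1 zr): cE; rewrite zrB !zrM !zr_small pE => /scaled_volume vE.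
by rewrite chain_rcons cP -mulrA vE -(prednK pre0) exprSr -mulrA.
Qed.

(** * Verification of the search graph and its consequence for large determinants *)

Lemma level1_ok : level_ok table2 (parity_words 11 false) table1 edges1.
Proof. vm_cast_no_check (erefl true). Qed.
Lemma level2_ok : level_ok table3 (parity_words 11 false) table2 edges2.
Proof. vm_cast_no_check (erefl true). Qed.
Lemma level3_ok : level_ok table4 (parity_words 11 false) table3 edges3.
Proof. vm_cast_no_check (erefl true). Qed.
Lemma level4_ok : level_ok table5 (parity_words 11 false) table4 edges4.
Proof. vm_cast_no_check (erefl true). Qed.
Lemma level5_ok : level_ok table6 (parity_words 11 false) table5 edges5.
Proof. vm_cast_no_check (erefl true). Qed.
Lemma level6_ok : level_ok table7 (parity_words 11 false) table6 edges6.
Proof. vm_cast_no_check (erefl true). Qed.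
Lemma level7_ok : level_ok table8 (parity_words 11 false) table7 edges7.
Proof. vm_cast_no_check (erefl true). Qed.
Lemma level8_ok : level_ok table9 (parity_words 11 false) table8 edges8.
Proof. vm_cast_no_check (erefl true). Qed.
Lemma level9_ok : level_ok table10 (parity_words 11 false) table9 edges9.
Proof. vm_cast_no_check (erefl true). Qed.
Lemma level10_ok : level_ok table11 (parity_words 11 false) table10 edges10.
Proof. vm_cast_no_check (erefl true). Qed.

Definition leaves : seq (seq bits) := map rows table11.

Lemma table11_size : all (fun nd => size (rows nd) == 11%N) table11.
Proof. by vm_compute. Qed.

Section Bound.
Variable dmax : int.
Hypothesis dmax_gt0 : 0 < dmax.
Hypothesis sqr_dmax_le : forall D : int, dmax <= `|D| -> 4 ^+ 10 * zr 102400 <= (D%:~R : rat) ^+ 2.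

Lemma root_sound i : (i < size table1)%N -> node_sound dmax leaves (nth node0 table1 i).
Proof.
move: i.
apply: (level_sound sqr_dmax_le dmax_gt0 level1_ok).
apply: (level_sound sqr_dmax_le dmax_gt0 level2_ok).
apply: (level_sound sqr_dmax_le dmax_gt0 level3_ok).
apply: (level_sound sqr_dmax_le dmax_gt0 level4_ok).
apply: (level_sound sqr_dmax_le dmax_gt0 level5_ok).
apply: (level_sound sqr_dmax_le dmax_gt0 level6_ok).
apply: (level_sound sqr_dmax_le dmax_gt0 level7_ok).
apply: (level_sound sqr_dmax_le dmax_gt0 level8_ok).
apply: (level_sound sqr_dmax_le dmax_gt0 level9_ok).
apply: (level_sound sqr_dmax_le dmax_gt0 level10_ok).
(* A leaf already has 11 rows, so nothing remains to be added and it is equivalent to itself. *)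
move=> i i_lt S [sB _ _] _ _.
have /eqP s11 := all_nthP node0 table11_size i i_lt.
have -> : S = [::] by apply/size0nil; move: sB; rewrite size_cat; move: s11; lia.
rewrite cats0; exists (rows (nth node0 table11 i)); last exact: rt_refl.
by rewrite -(nth_map _ [::] rows i_lt); apply: mem_nth; rewrite size_map.
Qed.

Lemma big_det_reaches (A : 'M[int]_11) : sign_matrix A -> dmax <= `|\det A| ->
  exists2 R, R \in leaves & hadamard_equiv A (sign_mx 11 R).
Proof.
move=> sA dA; have [B eqB [sB eB]] := sign_matrix_lists sA isT.
have eB0 : even_word (head [::] B) by case: (B) sB eB => //= r B' _ /andP[].
(* Negating columns makes the first row constant, as the root requires; even parity survives because
   the first row is even itself. *)
pose B' := map (zipw addb (head [::] B)) B.
have eqB' : hadamard_equiv A (sign_mx 11 B').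
  by apply: (rt_trans _ _ _ _ _ eqB); apply: equiv_xor => //;
    [exact: even_size|exact: all_even_size].
suff [R RL E] : reaches leaves B' by exists R => //; apply: (rt_trans _ _ _ _ _ eqB' E).
have sB' : size B' = 11%N by rewrite size_map.
have eB' : all even_word B' by
  apply/allP => _ /mapP[r rB ->]; apply: even_xor => //; apply: (allP eB).
have [S B'E] : exists S, B' = nseq 11 false :: S.
  rewrite /B'; case: (B) sB eB0 => // r C _ /even_size sr; exists (map (zipw addb r) C).
  have -> : nseq 11 false = zipw addb r r; last by [].
  by rewrite -[in LHS]sr; elim: (r) => // a r' /= ->; rewrite addbb.
have big : big_det dmax B' by split=> //; rewrite -(equiv_norm_det eqB').
have := @root_sound 0 isT S; rewrite /= -B'E; apply=> //.
  by rewrite /= mulr1 ip_diag.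
move=> y yS.
have sy : size y = 11%N.
  by apply: even_size; apply: (allP eB'); rewrite B'E inE yS orbT.
(* The initial cap holds because a pivot is at most the squared norm 11. *)
rewrite mulrC ler_wpM2l //; apply: le_trans (form_words_rcons_le [::] (nseq 11 false) y) _.
by rewrite /form /= ip_diag.
Qed.

End Bound.
End Classification.

Lemma zr_inj : injective zr.
Proof. by move=> x y /intr_inj/(can_inj int_of_ZK). Qed.

(** * Determinants of the leaves, maximality and inequivalence *)

Section MaximalDeterminant.
Local Open Scope ring_scope.
Local Opaque zr sign_mx ip.

Lemma leaves_chain R : R \in leaves ->
  [/\ size R = 11%N, all (fun r => size r == 11%N) R & chain ip R = 4 ^+ 10 * zr 102400].
Proof.
have H : all (fun R => [&& size R == 11%N, all (fun r => size r == 11%N) R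
    & if last_volume [:: head [::] R] (behead R) (Zpos 11) (Zpos 44, [:: [:: Zpos 4]]) is Some d
      then Z.eqb d 102400 else false]) leaves by vm_compute.
move/(allP H) => {H} /and3P[/eqP sR eR].
have RE : R = [:: head [::] R] ++ behead R by case: (R) sR.
have eR' : all (fun r => size r == 11%N) ([:: head [::] R] ++ behead R) by rewrite -RE.
have s0 : size (head [::] R) = 11%N by move: eR'; rewrite cat1s => /andP[/eqP].
have c0 : chain ip [:: head [::] R] = 4 ^+ (size [:: head [::] R]).-1 * zr 11.
  by rewrite /= mulr1 ip_diag // expr0 mul1r.
have volP qA d := @last_volumeP [:: head [::] R] (behead R) (Zpos 11) qA d isT eR' c0.
rewrite -RE sR in volP; move: (volP (Zpos 44, [:: [:: Zpos 4]])) => {}volP.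
case: last_volume volP => [d|_]; last by [].
move/(_ _ erefl) => volP /Z.eqb_eq dE; rewrite dE in volP.
by split; [exact: sR|exact: eR|exact: volP].
Qed.

Definition dmax : int := 5 * 2 ^+ 16.

Lemma dmax_gt0 : 0 < dmax.
Proof. by rewrite mulr_gt0 ?exprn_gt0. Qed.

Lemma sqr_dmax : (dmax%:~R : rat) ^+ 2 = 4 ^+ 10 * zr 102400.
Proof.
have -> : zr 102400 = zr (Z.mul 25 (Z.pow 4 (Z.of_nat 6))) by [].
(* The identity 327680^2 = 4^10 * 25 * 4^6 is proved with a variable in place of 2, so that no large
   numeral is expanded. *)
have H (t : rat) : (5 * t ^+ 16) ^+ 2 = (t * t) ^+ 10 * (25 * (t * t) ^+ 6) by ring.
rewrite zrM zrX /dmax intrM rmorphXn.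
have -> : zr 25 = 25 by [].
have -> : zr 4 = 2 * 2 by [].
have {1}-> : 4 = 2 * 2 :> rat by [].
exact: H.
Qed.

Local Opaque dmax.

Lemma sqr_dmax_le (D : int) : dmax <= `|D| -> 4 ^+ 10 * zr 102400 <= (D%:~R : rat) ^+ 2.
Proof.
move=> d; rewrite -sqr_dmax -[X in _ <= X]real_normK; last exact: num_real.
rewrite -intr_norm; apply: lerXn2r.
- by rewrite nnegrE ler0z; exact: ltW dmax_gt0.
- by rewrite nnegrE ler0z; exact: normr_ge0.
by rewrite ler_int; exact: d.
Qed.

Lemma leaves_det R : R \in leaves -> `|\det (sign_mx 11 R)| = dmax.
Proof.
case/leaves_chain => sR _ cR.
(* Here the nonzero product of pivots is known and the determinant is deduced from it. *)
have c0 : chain ip R != 0 by rewrite cR -sqr_dmax sqrf_eq0 intr_eq0; exact: lt0r_neq0 dmax_gt0.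
have := sqr_det_words sR (or_intror c0); rewrite cR -sqr_dmax {c0 cR}.
move: (\det _) => D /eqP; rewrite -[X in X == _]real_normK; last exact: num_real.
rewrite -intr_norm => /eqP H.
have : (`|D|%:~R : rat) = dmax%:~R.
  apply: (pexpIrn (isT : (0 < 2)%N)); last exact: H.
  - by rewrite nnegrE ler0z; exact: normr_ge0.
  by rewrite nnegrE ler0z; exact: ltW dmax_gt0.
by move/intr_inj.
Qed.

Lemma sign_matrix_mx n B : sign_matrix (sign_mx n B).
Proof. by move=> i j; rewrite mxE; case: nth; [right|left]. Qed.

(** A matrix of larger determinant would also be equivalent to a leaf, and all leaves have
    determinant exactly [dmax] in absolute value. *)
Lemma D_optimal_leaf R : R \in leaves -> D_optimal 11 (sign_mx 11 R).
Proof.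
move=> RL; split=> [|B sB]; first exact: sign_matrix_mx.
rewrite (leaves_det RL) leNgt; apply/negP => lt.
have [R' R'L /equiv_norm_det E] := big_det_reaches dmax_gt0 sqr_dmax_le sB (ltW lt).
by rewrite E (leaves_det R'L) ltxx in lt.
Qed.

(** A leaf attains the bound, so an optimal matrix is large enough for the search to apply. *)
Lemma D_optimal_equiv_leaf A : D_optimal 11 A ->
  exists2 R, R \in leaves & hadamard_equiv A (sign_mx 11 R).
Proof.
case=> sA max; apply: (big_det_reaches dmax_gt0 sqr_dmax_le sA).
have L0 : nth [::] leaves 0 \in leaves by apply: mem_nth.
by rewrite -(leaves_det L0); apply/max/sign_matrix_mx.
Qed.

Lemma leaves_inequiv i j : (i < 3)%N -> (j < 3)%N ->
  hadamard_equiv (sign_mx 11 (nth [::] leaves i)) (sign_mx 11 (nth [::] leaves j)) -> i = j.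
Proof.
have sl : size leaves = 3%N by [].
rewrite -sl => i3 j3 /abs_gram_equiv E.
have [si ei _] := leaves_chain (mem_nth [::] i3).
have [sj ej _] := leaves_chain (mem_nth [::] j3).
rewrite (abs_gram_words si ei) (abs_gram_words sj ej) in E.
have uniq_sums : uniq (map abs_gram_sum leaves) by vm_compute.
have si' : (i < size (map abs_gram_sum leaves))%N by rewrite size_map.
have sj' : (j < size (map abs_gram_sum leaves))%N by rewrite size_map.
apply/eqP; rewrite -(nth_uniq Z0 si' sj' uniq_sums); apply/eqP.
rewrite (nth_map [::] _ _ i3) (nth_map [::] _ _ j3).
exact: (zr_inj E).
Qed.

End MaximalDeterminant.

Local Open Scope classical_set_scope.
Local Open Scope card_scope.

Theorem mainTheorem3 :
  [set hadamard_class A | A in D_optimal 11] #= `I_3.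
Proof.
pose f i := hadamard_class (sign_mx 11 (nth [::] leaves i)).
suff -> : [set hadamard_class A | A in D_optimal 11] = f @` `I_3.
  apply: inj_card_eq => i j; rewrite !inE /= => i3 j3 fij.
  apply: leaves_inequiv => //.
  (* Equal classes share their representatives, which turns the equality into an equivalence of two
     leaves. *)
  have : f j (sign_mx 11 (nth [::] leaves j)) by apply: rt_refl.
  by rewrite -fij.
apply/predeqP => C; split=> [[A optA <-]|[i i3 <-]].
  have [R RL E] := D_optimal_equiv_leaf optA; exists (index R leaves).
    by move: (RL); rewrite -index_mem.
  by rewrite /f nth_index // (hadamard_class_eq E).
exists (sign_mx 11 (nth [::] leaves i)) => //.
by apply: D_optimal_leaf; apply: mem_nth.
Qed.
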